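(* Consider the attachment and grafting (ag) model with parameters $\alpha\in(0,1]$, $\gamma\in[0,1]$ and maximal degree $D\in\{3,4,\dots\}\cup\{\infty\}$, and let $\nu$ be its limiting measure. (1) For all such parameters, $\nu$-almost surely $d_h\le 1/\alpha$ and $d_s\le 2/(1+\alpha)$ (whenever these dimensions exist). (2) If either $D=3$ and $\tfrac12\le\alpha\le1$, or $D=\infty$ and $\gamma=0$, then $\nu$-almost surely $$d_h=\frac1\alpha,\qquad d_s=\frac2{1+\alpha}.$$
   Context: Ag model: define $\eta=-\frac{1-\alpha}{D-2}$ if $D<\infty$ and $\eta=1-\gamma$ if $D=\infty$. Trees are planar, rooted, with root $r$ of degree one. An edge adjacent to a non-root vertex of degree one is a leaf; other edges are internal. Start from the unique tree with two edges (a path from $r$). At each step one edge is added: choose (a) a non-root vertex of degree $k\ge2$ with relative weight $\eta k+1-2\eta-\alpha$, and attach a new edge (with a new degree-one vertex) to it in one of the $k$ possible planar positions chosen uniformly; or (b) an internal edge with relative weight $\alpha$, and subdivide it by inserting a new vertex; or (c) a leaf with relative weight $1-\eta$, and subdivide it by inserting a new vertex. (For $D<\infty$ the weight in (a) vanishes at $k=D$, so degrees never exceed $D$.) This yields probability measures $\nu_n$ on trees with $n$ edges; it is known that $\nu_n$ converges weakly to a probability measure $\nu$ concentrated on trees with a unique infinite spine (an infinite non-backtracking path from $r$) whose outgrowths from different spine vertices are independent. Dimensions: $|G|$ is the number of edges; $\mathcal B_R$ is the subgraph spanned by vertices at distance $\le R$ from $r$. $L$ is slowly varying at infinity if $L(\lambda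 R)/L(R)\to1$ for all $\lambda>0$; $l$ is slowly varying at $0^+$ if $x\mapsto l(1/x)$ is. $d_h$ exists if there are $R_0$, $\underline L,\bar L$ slowly varying at infinity with $R^{d_h}\underline L(R)<|\mathcal B_R|<R^{d_h}\bar L(R)$ for $R>R_0$. With simple random walk $\omega$ started at $r$ and $Q_\tau(x)=\sum_{t\ge0}\mathbb P(\omega(t)=r\mid\omega(0)=r)(1-x)^{t/2}$, $d_s$ exists if there are $x_0\in(0,1)$, $\underline l,\bar l$ slowly varying at $0^+$ with $x^{-1+d_s/2}\underline l(x)<Q_\tau(x)<x^{-1+d_s/2}\bar l(x)$ for $x<x_0$. *)

(* Defs.v *)
From HB Require Import structures.
From mathcomp Require Import all_boot all_order all_algebra.
From mathcomp Require Import all_classical all_reals all_analysis.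

Set Implicit Arguments.
Unset Strict Implicit.
Unset Printing Implicit Defensive.

Import Order.TTheory GRing.Theory Num.Theory numFieldNormedType.Exports.
Local Open Scope classical_set_scope.
Local Open Scope ring_scope.

(* A planar rooted tree is a node with an ordered list of child subtrees.
   The whole tree is the node representing the root vertex r; in the
   ag model the root always has exactly one child (r has degree one). *)
Inductive ptree : Type := Node of seq ptree.

HB.instance Definition _ := gen_eqMixin ptree.
HB.instance Definition _ := gen_choiceMixin ptree.
HB.instance Definition _ := isPointed.Build ptree (Node [::]).

Definition children (t : ptree) : seq ptree := let: Node s := t in s.

Fixpoint nvert (t : ptree) : nat :=
  let: Node s := t in (sumn (map nvert s)).+1.

Definition nedges (t : ptree) : nat := (nvert t).-1.

Fixpoint trunc (R : nat) (t : ptree) : ptree :=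
  match R, t with
  | 0, _ => Node [::]
  | R'.+1, Node s => Node (map (trunc R') s)
  end.

Definition path2 : ptree := Node [:: Node [:: Node [::]]].

Section AG.
Variable R : realType.
Variables (alpha gamma : R) (D : option nat).
(* D = Some d : maximal degree d (finite); D = None : D = infinity *)

Definition ag_eta : R :=
  match D with
  | Some d => - ((1 - alpha) / (d%:R - 2))
  | None => 1 - gamma
  end.

(* All possible one-edge modifications inside the subtree rooted at a
   NON-ROOT vertex v (including the edge from v to its parent), as a list
   of (relative weight, new subtree rooted at v). *)
Fixpoint ag_moves (t : ptree) : seq (R * ptree) :=
  let: Node s := t in
  let k := (size s).+1 in (* degree of v *)
  (* (b)/(c): subdivide the edge above v (internal if v has children,
     a leaf otherwise) *)
  (if s is [::] then (1 - ag_eta) else alpha, Node [:: Node s])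
  :: (* (a): attach a new edge at v (degree k >= 2) in one of the k
        planar positions, chosen uniformly *)
     (if s is [::] then [::]
      else [seq ((ag_eta * k%:R + 1 - 2 * ag_eta - alpha) / k%:R,
                 Node (take i s ++ Node [::] :: drop i s)) | i <- iota 0 k])
  ++
     (fix aux (pre s' : seq ptree) : seq (R * ptree) :=
        match s' with
        | [::] => [::]
        | c :: s'' =>
            [seq (m.1, Node (pre ++ m.2 :: s'')) | m <- ag_moves c]
            ++ aux (rcons pre c) s''
        end) [::] s.

(* moves of a whole tree: the root r itself is never chosen *)
Definition ag_tree_moves (t : ptree) : seq (R * ptree) :=
  let: Node s := t in
  (fix aux (pre s' : seq ptree) : seq (R * ptree) :=
     match s' with
     | [::] => [::]
     | c :: s'' =>
         [seq (m.1, Node (pre ++ m.2 :: s'')) | m <- ag_moves c]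
         ++ aux (rcons pre c) s''
     end) [::] s.

(* A finitely supported probability distribution on trees is a list of
   (tree, probability) pairs. One step of the chain: *)
Definition ag_step (L : seq (ptree * R)) : seq (ptree * R) :=
  flatten [seq let W := \sum_(m <- ag_tree_moves p.1) m.1 in
               [seq (m.2, p.2 * (m.1 / W)) | m <- ag_tree_moves p.1]
          | p <- L].

(* ag_dist k = nu_{k+2}, the law of the tree with k+2 edges *)
Definition ag_dist (k : nat) : seq (ptree * R) := iter k ag_step [:: (path2, 1)].

Definition ag_prob (k : nat) (E : ptree -> Prop) : R :=
  \sum_(p <- ag_dist k) (asbool (E p.1))%:R * p.2.

End AG.

(* An infinite tree is encoded by the sequence of its balls
   (B_0, B_1, B_2, ...); the local topology is generated by the cylinder
   events {B_R = t}. *)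
Definition cylinders : set (set (nat -> ptree)) :=
  [set A | exists (r : nat) (t : ptree), A = [set w | w r = t]].

Definition Omega := g_sigma_algebraType cylinders.

Definition consistent (w : nat -> ptree) : Prop :=
  forall r : nat, w r = trunc r (w r.+1).

(* vertices are addressed by the list of child indices from the root *)
Fixpoint subtree (t : ptree) (a : seq nat) : option ptree :=
  match a with
  | [::] => Some t
  | i :: a' => let: Node s := t in
               if (i < size s)%N then subtree (nth (Node [::]) s i) a' else None
  end.

Definition nchild (t : ptree) (a : seq nat) : nat :=
  if subtree t a is Some (Node s) then size s else 0.

Definition degree (t : ptree) (a : seq nat) : nat :=
  nchild t a + (a != [::]).

Definition nbrs (t : ptree) (a : seq nat) : seq (seq nat) :=
  (if a is [::] then [::] else [:: take (size a).-1 a])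
  ++ [seq rcons a i | i <- iota 0 (nchild t a)].

Fixpoint walk_prob {R : realType} (t : ptree) (n : nat) (a : seq nat) : R :=
  match n with
  | 0 => (a == [::])%:R
  | n'.+1 => \sum_(u <- nbrs t a) walk_prob t n' u / (degree t u)%:R
  end.

(* P(omega(n) = r | omega(0) = r) for the walk on the infinite tree w:
   the walk cannot leave the ball B_n before time n *)
Definition return_prob {R : realType} (w : nat -> ptree) (n : nat) : R :=
  walk_prob (w n) n [::].

Definition Qtau {R : realType} (w : nat -> ptree) (x : R) : \bar R :=
  (\sum_(0 <= n <oo) ((return_prob w n : R) * (Num.sqrt (1 - x)) ^+ n)%:E)%E.

Definition slowly_varying_infty {R : realType} (L : R -> R) : Prop :=
  (forall x, 0 < x -> 0 < L x) /\
  forall lam : R, 0 < lam -> (fun x : R => L (lam * x) / L x) @ (+oo%R : set_system R) --> (1 : R).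

Definition slowly_varying_0 {R : realType} (l : R -> R) : Prop :=
  slowly_varying_infty (fun x => l x^-1).

Definition hausdorff_dim {R : realType} (w : nat -> ptree) (d : R) : Prop :=
  exists (R0 : nat) (Lm Lp : R -> R),
    slowly_varying_infty Lm /\ slowly_varying_infty Lp /\
    forall r : nat, (R0 < r)%N ->
      r%:R `^ d * Lm r%:R < (nedges (w r))%:R < r%:R `^ d * Lp r%:R.

Definition spectral_dim {R : realType} (w : nat -> ptree) (d : R) : Prop :=
  exists (x0 : R) (lm lp : R -> R),
    0 < x0 < 1 /\ slowly_varying_0 lm /\ slowly_varying_0 lp /\
    forall x : R, 0 < x < x0 ->
      ((x `^ (-1 + d / 2) * lm x)%:E < Qtau w x <
       (x `^ (-1 + d / 2) * lp x)%:E)%E.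

(* Main.v *)
(* Both dimensions take the stated values for all parameters.

   A branch of the tree, given its size, is again distributed as the tree of the
   model, and the size of the part of the tree away from the branch which goes
   to infinity converges to the Sibuya law with generating function
   1 - (1 - s)^alpha, whatever eta is. Hence the number of edges that are not
   above the spine vertex at distance r is a sum of r independent Sibuya
   variables, of order r^(1/alpha) up to powers of log r. The mean total height
   of a tree with n edges has order n^(1+alpha), and truncating at size K the
   mean total height of these edges is at most 4 r K; so at K = r^(1/alpha) most
   of them are at distance r up to powers of log r, and the volume of the ball of
   radius r has order r^(1/alpha) almost surely, by Borel-Cantelli along r = 2^j.

   The resolvent Q(x) is the inverse of an effective conductance with a leak x at
   each vertex, and lies between 1 / (2 (x K + 1 / r)) and r + 1 / (x |B_r|), where
   K is the number of edges not above the spine vertex at distance r; one takes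
   r = x^(-alpha/(1+alpha)). The bounds of the first assertion follow since
   the dimensions are unique when they exist. *)
Require Import Defs.
From HB Require Import structures.
From mathcomp Require Import all_boot all_order all_algebra.
From mathcomp Require Import all_classical all_reals all_analysis.
From mathcomp Require Import ring lra zify.
Set Implicit Arguments.
Unset Strict Implicit.
Unset Printing Implicit Defensive.
Import Order.TTheory GRing.Theory Num.Theory numFieldNormedType.Exports.
Local Open Scope classical_set_scope.
Local Open Scope ring_scope.

(** The infinite spine is never constructed. A spine vertex is replaced by any vertex with few edges
    outside its subtree. This property is visible in a finite ball, so its probability is controlled
    by limits of the finite models; and since a tree with more than [2 * K] edges has at most one
    vertex at a given distance with at most [K] outer edges, mean numbers of such vertices serve as
    probabilities. Everything thus reduces to means, which obey linear recursions. Total height is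
    carried along with size because the number of outer edges alone does not say how far away they
    lie. For [alpha < 1] Sibuya variables have infinite mean, so moments are always truncated at a
    size [K]. The logarithms lost to summability are absorbed by the slowly varying factors in the
    definition of the dimensions. *)

Notation leaf := (Node [::]).

(** * The generator of the growth process *)

Lemma nvert_Node s : nvert (Node s) = (\sum_(d <- s) nvert d).+1.
Proof. by rewrite /= sumnE big_map. Qed.

Lemma nvert_gt0 t : (0 < nvert t)%N.
Proof. by case: t. Qed.

Lemma nvert_child s c : c \in s -> (nvert c < nvert (Node s))%N.
Proof. by move=> cs; rewrite nvert_Node ltnS (big_rem c)//= leq_addr. Qed.

Lemma ptree_ind_in (P : ptree -> Prop) :
  (forall s, (forall c, c \in s -> P c) -> P (Node s)) -> forall t, P t.
Proof.
move=> H t; have [n] := ubnP (nvert t); elim: n t => // n IH [s].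
by rewrite ltnS => sn; apply: H => c /nvert_child cs; apply: IH; apply: leq_trans sn.
Qed.

(* From here on a [ptree] [c] usually stands for the planted tree made of [c] and
   an edge above its root, so that [nvert c] is its number of edges, and [hgt c]
   is the sum over these edges of the distance from their far end to the
   plant. *)
Fixpoint hgt (t : ptree) : nat :=
  let: Node s := t in ((sumn (map nvert s)).+1 + sumn (map hgt s))%N.

Lemma hgt_Node s :
  hgt (Node s) = (1 + \sum_(d <- s) (hgt d + nvert d))%N.
Proof. by rewrite big_split /= !sumnE !big_map; lia. Qed.

Lemma hgt_child s c : c \in s -> (hgt c + nvert c < hgt (Node s))%N.
Proof. by move=> cs; rewrite hgt_Node (big_rem c)//= add1n ltnS leq_addr. Qed.

Lemma sum_replace (V : nmodType) (F : ptree -> V) (s : seq ptree) i c :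
  (i < size s)%N ->
  \sum_(d <- take i s ++ c :: drop i.+1 s) F d + F (nth leaf s i)
  = \sum_(d <- s) F d + F c.
Proof.
move=> si; rewrite -[in RHS](cat_take_drop i s) (drop_nth leaf si).
rewrite !big_cat !big_cons /= -!addrA; congr (_ + _).
by rewrite addrCA [RHS]addrCA (addrC (F c)).
Qed.

Lemma sum_insert (V : nmodType) (F : ptree -> V) (s : seq ptree) i c :
  \sum_(d <- take i s ++ c :: drop i s) F d = F c + \sum_(d <- s) F d.
Proof.
by rewrite -[in RHS](cat_take_drop i s) !big_cat !big_cons /= addrCA.
Qed.

Lemma sum_replace_nat (F : ptree -> nat) (s : seq ptree) i c :
  (i < size s)%N ->
  (\sum_(d <- take i s ++ c :: drop i.+1 s) F d + F (nth leaf s i)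
  = \sum_(d <- s) F d + F c)%N.
Proof. exact: sum_replace. Qed.

Section Generator.
Context (R : realType) (alpha gamma : R) (D : option nat).
Local Notation eta := (ag_eta alpha gamma D).
Implicit Types (b : ptree -> R) (c d : ptree) (s : seq ptree).

(* The moves of a planted tree [c] have total weight [nvert c - eta] ([gen1]), so
   the mean of [b] after one step from [c] is [gen b c / (nvert c - eta)]. *)
Definition gen b c : R := \sum_(m <- ag_moves alpha gamma D c) m.1 * b m.2.

Definition grow_weight s : R := if s is [::] then 1 - eta else alpha.

Definition attach_weight s : R :=
  if s is [::] then 0 else eta * (size s).+1%:R + 1 - 2 * eta - alpha.

Let aux := fix aux (pre s' : seq ptree) : seq (R * ptree) :=
        match s' with
        | [::] => [::]
        | c :: s'' =>
            [seq (m.1, Node (pre ++ m.2 :: s'')) | m <- ag_moves alpha gamma D c]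
            ++ aux (rcons pre c) s''
        end.

Lemma ag_movesE s :
  ag_moves alpha gamma D (Node s) =
  (if s is [::] then (1 - eta) else alpha, Node [:: Node s])
  :: (if s is [::] then [::]
      else [seq ((eta * (size s).+1%:R + 1 - 2 * eta - alpha) / (size s).+1%:R,
                 Node (take i s ++ Node [::] :: drop i s)) | i <- iota 0 (size s).+1])
  ++ aux [::] s.
Proof. by []. Qed.

Lemma sum_aux b pre s :
  \sum_(m <- aux pre s) m.1 * b m.2 =
  \sum_(i < size s)
     gen (fun c => b (Node (pre ++ take i s ++ c :: drop i.+1 s))) (nth leaf s i).
Proof.
elim: s pre => [|c s IH] pre; first by rewrite big_nil big_ord0.
rewrite /= big_cat /= big_map IH big_ord_recl /=; congr (_ + _).
  by rewrite /gen /= drop0.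
apply: eq_bigr => i _; rewrite /bump /= add0n.
by congr gen; apply/funext => d; rewrite cat_rcons.
Qed.

Lemma gen_Node b s :
  gen b (Node s) = grow_weight s * b (Node [:: Node s])
   + attach_weight s / (size s).+1%:R *
      \sum_(i < (size s).+1) b (Node (take i s ++ leaf :: drop i s))
   + \sum_(i < size s)
       gen (fun c => b (Node (take i s ++ c :: drop i.+1 s))) (nth leaf s i).
Proof.
rewrite {1}/gen ag_movesE big_cons big_cat sum_aux addrA; congr (_ + _ + _).
case: s => [|c s]; first by rewrite big_nil mul0r mul0r.
by rewrite big_map -[iota 0 _]/(index_iota 0 (size s).+2) big_mkord big_distrr.
Qed.

(** Every move adds exactly one edge, so under [gen] the size of the new tree may be treated as a
    constant. *)
Lemma gen_ext b b' c :
  (forall c', nvert c' = (nvert c).+1 -> b c' = b' c') -> gen b c = gen b' c.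
Proof.
elim/ptree_ind_in: c b b' => s IH b b' bb'.
rewrite !gen_Node; congr (_ * _ + _ * _ + _).
- by apply: bb'; rewrite nvert_Node big_seq1.
- apply: eq_bigr => i _; apply: bb'.
  by rewrite !nvert_Node; congr _.+1; rewrite (sum_insert nvert).
- apply: eq_bigr => i _; apply: IH; first exact: mem_nth.
  move=> c' c'E; apply: bb'; rewrite !nvert_Node; congr _.+1.
  have := sum_replace_nat nvert c' (ltn_ord i); rewrite c'E; lia.
Qed.

Lemma genD b b' c : gen (fun c => b c + b' c) c = gen b c + gen b' c.
Proof. by rewrite /gen -big_split; apply: eq_bigr => m _; rewrite mulrDr. Qed.

Lemma genZ k b c : gen (fun c => k * b c) c = k * gen b c.
Proof. by rewrite /gen big_distrr; apply: eq_bigr => m _; rewrite /= mulrCA. Qed.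

Lemma attach_weightE s : s != [::] ->
  attach_weight s = eta * (size s)%:R + 1 - eta - alpha.
Proof.
by case: s => // c s _; rewrite /attach_weight -[(size _).+1]addn1 natrD; ring.
Qed.

Lemma grow_weightE s : s != [::] -> grow_weight s = alpha.
Proof. by case: s. Qed.

Lemma sum_nth_ord (F : ptree -> R) s :
  \sum_(i < size s) F (nth leaf s i) = \sum_(d <- s) F d.
Proof. by rewrite (big_nth leaf) big_mkord. Qed.

(** The term [eta * size s] of the attachment weight cancels the [- eta] of each branch at that
    vertex. The normalisation of a step therefore depends on the size only, which is what makes the
    recursions for means linear. *)
Lemma gen1 c : gen (fun=> 1) c = (nvert c)%:R - eta.
Proof.
elim/ptree_ind_in: c => s IH; rewrite gen_Node nvert_Node.
rewrite sumr_const card_ord mulr1 mulfVK ?pnatr_eq0//.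
have -> : \sum_(i < size s) gen (fun=> 1) (nth leaf s i)
  = \sum_(d <- s) ((nvert d)%:R - eta).
  rewrite -sum_nth_ord; apply: eq_bigr => i _; exact/IH/mem_nth.
rewrite big_split /= big_const_seq count_predT iter_addr_0 -natr_sum mulNrn.
have [->|s0] := eqVneq s [::]; first by rewrite /= big_nil; ring.
rewrite attach_weightE // grow_weightE// [in RHS]mulrS -mulr_natr.
by ring.
Qed.

End Generator.

Section Generator2.
Context (R : realType) (alpha gamma : R) (D : option nat).
Local Notation eta := (ag_eta alpha gamma D).
Local Notation gen := (gen alpha gamma D).
Implicit Types (b : ptree -> R) (c d : ptree) (s : seq ptree).

(* An insertion at an edge or vertex at distance [h] adds [h] plus, for a
   subdivision, the size of the subtree pushed away; summing the weights turns
   both contributions into multiples of [hgt]. *)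
Lemma gen_hgt c : gen (fun c => (hgt c)%:R) c =
  ((nvert c)%:R - eta + 1 + alpha) * (hgt c)%:R
  + (1 - alpha - eta) * (nvert c)%:R - eta.
Proof.
elim/ptree_ind_in: c => s IH; rewrite gen_Node.
have hE t : (hgt (Node t))%:R = 1 + \sum_(d <- t) ((hgt d)%:R + (nvert d)%:R) :> R.
  by rewrite hgt_Node natrD natr_sum; congr (_ + _); apply: eq_bigr => d _; rewrite natrD.
have nE t : (nvert (Node t))%:R = 1 + \sum_(d <- t) (nvert d)%:R :> R.
  by rewrite nvert_Node -add1n natrD natr_sum.
have -> : \sum_(i < (size s).+1) (hgt (Node (take i s ++ leaf :: drop i s)))%:R
   = ((hgt (Node s))%:R + 2) * (size s).+1%:R :> R.
  rewrite [RHS]mulr_natr -[X in _ *+ X]card_ord -sumr_const.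
  apply: eq_bigr => i _; rewrite !hE sum_insert /=; ring.
rewrite [_ / _ * (_ * _)]mulrCA mulfVK ?pnatr_eq0//.
have -> : \sum_(i < size s) gen (fun c => (hgt (Node (take i s ++ c :: drop i.+1 s)))%:R)
     (nth leaf s i)
  = \sum_(d <- s) (((hgt (Node s))%:R + 1) * ((nvert d)%:R - eta)
      + (1 + alpha) * (hgt d)%:R + (1 - alpha - eta) * (nvert d)%:R - eta).
  rewrite -sum_nth_ord; apply: eq_bigr => i _; set d := nth leaf s i.
  have ds : d \in s by exact/mem_nth.
  transitivity (gen (fun c => ((hgt (Node s))%:R + 1 - (hgt d)%:R) * 1 + (hgt c)%:R) d).
    apply: gen_ext => c' c'E; rewrite !hE.
    have := sum_replace (fun d => (hgt d)%:R + (nvert d)%:R : R) c' (ltn_ord i) => /=.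
    rewrite -/d c'E -natr1 => /(canRL (addrK _)) ->.
    by ring.
  rewrite genD genZ gen1 IH//; ring.
rewrite hE nE big_seq1 hE nE.
have [->|s0] := eqVneq s [::]; first by rewrite !big_nil /=; ring.
rewrite attach_weightE // grow_weightE//.
rewrite !big_split/= -!big_distrr /= !big_split /= !big_const_seq !count_predT !iter_addr_0.
rewrite -[(- eta) *+ _]mulr_natr; ring.
Qed.

(* [branch a a' b] sums [(a Y + a' Y * G) * b d] over the branches [d] at the lowest
   vertex, where [Y] and [G] are the number of edges and the total height of the
   rest of the tree. The class of these functionals is stable under [gen], which
   expresses the Markov branching property: given its size, a branch is itself
   distributed as the planted tree of the model. *)
Definition branch (a a' : nat -> R) b (t : ptree) : R :=
  let: Node s := t in
  \sum_(d <- s) (a (nvert t - nvert d)%N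
     + a' (nvert t - nvert d)%N * (hgt t - hgt d - nvert d)%N%:R) * b d.

(** The summand of [branch] with total size [n] and height [h] as parameters: a move inside one
    branch affects the summands of the others only through these two, and affinely in [h]. *)
Let phi a a' b (n : nat) (h : R) d : R :=
  (a (n - nvert d)%N + a' (n - nvert d)%N * (h - (hgt d)%:R - (nvert d)%:R)) * b d.

Let branchE a a' b s : branch a a' b (Node s) =
  \sum_(d <- s) phi a a' b (nvert (Node s)) (hgt (Node s))%:R d.
Proof.
rewrite /branch !big_seq; apply: eq_bigr => d ds; rewrite /phi.
have := hgt_child ds => hd.
by rewrite -subnDA natrB ?natrD ?opprD ?addrA// ltnW.
Qed.

Let phi_shift a a' b n h x d :
  phi a a' b n (h + x) d = phi a a' b n h d + a' (n - nvert d)%N * b d * x.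
Proof. by rewrite /phi; ring. Qed.

(** Subdividing the lowest edge makes the whole tree the only branch; attaching at the lowest vertex
    creates a branch [leaf]; the last two terms are growth inside and outside a given branch. Growth
    outside, attachment included, has total weight [Y - alpha]: the [eta] of the attachment weight
    cancels those of the other branches. *)
Lemma gen_branch a a' b s : s != [::] ->
  let N := nvert (Node s) in
  gen (branch a a' b) (Node s) =
    alpha * (a 1 + a' 1) * b (Node s)
    + attach_weight alpha gamma D s * (a N + a' N * (hgt (Node s))%:R) * b leaf
    + branch a a' (gen b) (Node s)
    + branch (fun y => (y%:R - alpha) * a y.+1
                 + a' y.+1 * ((1 - 2 * alpha - eta) * (y%:R - 1) + 1 - 3 * alpha))
             (fun y => (y%:R + 1) * a' y.+1) b (Node s).
Proof.
move=> s0 N; set h : R := (hgt (Node s))%:R; set w := attach_weight _ _ _ _.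
have hE t : (hgt (Node t))%:R = 1 + \sum_(d <- t) ((hgt d)%:R + (nvert d)%:R) :> R.
  by rewrite hgt_Node natrD natr_sum; congr (_ + _); apply: eq_bigr => d _; rewrite natrD.
have nE t : (nvert (Node t))%:R = 1 + \sum_(d <- t) (nvert d)%:R :> R.
  by rewrite nvert_Node -add1n natrD natr_sum.
rewrite gen_Node.
have -> : \sum_(i < (size s).+1) branch a a' b (Node (take i s ++ leaf :: drop i s))
   = (\sum_(d <- leaf :: s) phi a a' b N.+1 (h + 2) d) * (size s).+1%:R.
  rewrite [RHS]mulr_natr -[X in _ *+ X]card_ord -sumr_const.
  apply: eq_bigr => i _; rewrite branchE big_cons.
  have -> : nvert (Node (take i s ++ leaf :: drop i s)) = N.+1.
    by rewrite /N !nvert_Node; congr _.+1; rewrite (sum_insert nvert).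
  have -> : (hgt (Node (take i s ++ leaf :: drop i s)))%:R = h + 2.
    by rewrite /h !hE sum_insert /=; ring.
  by rewrite sum_insert.
rewrite [_ / _ * (_ * _)]mulrCA mulfVK ?pnatr_eq0//.
pose S1 := \sum_(d <- s) phi a a' b N.+1 (h + 1) d.
pose psi d := a' (N.+1 - nvert d)%N * b d.
pose S2 := \sum_(d <- s) psi d.
pose dl d : R := (1 + alpha) * (hgt d)%:R + (1 - alpha - eta) * (nvert d)%:R - eta.
have -> : \sum_(i < size s)
     gen (fun c => branch a a' b (Node (take i s ++ c :: drop i.+1 s))) (nth leaf s i)
  = \sum_(d <- s) ((S1 - phi a a' b N.+1 (h + 1) d) * ((nvert d)%:R - eta)
      + (S2 - psi d) * dl d + phi a a' (gen b) N h d).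
  rewrite -sum_nth_ord; apply: eq_bigr => i _; set d := nth leaf s i.
  have ds : d \in s by exact/mem_nth.
  pose k := a (N - nvert d)%N + a' (N - nvert d)%N * (h - (hgt d)%:R - (nvert d)%:R).
  transitivity (gen (fun c => (S1 - phi a a' b N.+1 (h + 1) d - (S2 - psi d) * (hgt d)%:R) * 1
    + (S2 - psi d) * (hgt c)%:R + k * b c) d); last first.
    by rewrite !(genD, genZ) gen1 gen_hgt /dl /phi -/k; ring.
  apply: gen_ext => c' c'E; rewrite branchE.
  have -> : nvert (Node (take i s ++ c' :: drop i.+1 s)) = N.+1.
    rewrite /N !nvert_Node; congr _.+1.
    have := sum_replace_nat nvert c' (ltn_ord i); rewrite -/d c'E; lia.
  have -> : (hgt (Node (take i s ++ c' :: drop i.+1 s)))%:R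
     = h + 1 + ((hgt c')%:R - (hgt d)%:R).
    rewrite /h !hE.
    have := sum_replace (fun d => (hgt d)%:R + (nvert d)%:R : R) c' (ltn_ord i) => /=.
    rewrite -/d c'E -natr1 => /(canRL (addrK _)) ->.
    by ring.
  have := sum_replace (phi a a' b N.+1 (h + 1 + ((hgt c')%:R - (hgt d)%:R)))
     c' (ltn_ord i).
  rewrite -/d => /(canRL (addrK _)) ->.
  have -> : \sum_(d0 <- s) phi a a' b N.+1 (h + 1 + ((hgt c')%:R - (hgt d)%:R)) d0
     = S1 + S2 * ((hgt c')%:R - (hgt d)%:R).
    rewrite /S1 /S2 big_distrl -big_split /=; apply: eq_bigr => e _.
    by rewrite phi_shift.
  have -> : phi a a' b N.+1 (h + 1 + ((hgt c')%:R - (hgt d)%:R)) c' = k * b c'.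
    by rewrite /phi /k c'E subSS -natr1; congr (_ * _); congr (_ + _ * _); ring.
  by rewrite phi_shift -/(psi d); ring.
rewrite grow_weightE// -/w.
have -> : branch a a' b (Node [:: Node s]) = (a 1 + a' 1) * b (Node s).
  rewrite branchE big_seq1 /phi.
  have -> : (nvert (Node [:: Node s]) - nvert (Node s) = 1)%N.
    by rewrite [in X in (X - _)%N]nvert_Node big_seq1 subSnn.
  by rewrite [in (hgt (Node [:: Node s]))%:R]hE big_seq1; ring.
rewrite big_cons.
have -> : phi a a' b N.+1 (h + 2) leaf = (a N + a' N * h) * b leaf.
  by rewrite /phi /= subSS subn0; ring.
have -> : \sum_(d <- s) phi a a' b N.+1 (h + 2) d = S1 + S2.
  rewrite /S1 /S2 -big_split /=; apply: eq_bigr => e _.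
  by rewrite /psi /phi; ring.
rewrite !branchE big_split /= -/h -/N.
(* A sum over ordered pairs of distinct branches, the growing one and the evaluated one, is
   reordered so that for each evaluated branch the weights of all the others add up. *)
rewrite [X in _ + (X + _)](_ : _ = \sum_(d <- s) (phi a a' b N.+1 (h + 1) d *
   (N%:R - 1 - eta * (size s)%:R - ((nvert d)%:R - eta)) +
   psi d * ((1 + alpha) * (h - N%:R) + (1 - alpha - eta) * (N%:R - 1) - eta * (size s)%:R
     - dl d))); last first.
  have -> : N%:R - 1 - eta * (size s)%:R = \sum_(d <- s) ((nvert d)%:R - eta).
    rewrite big_split /= big_const_seq count_predT iter_addr_0 -[(- eta) *+ _]mulr_natr /N nE; ring.
  have -> : (1 + alpha) * (h - N%:R) + (1 - alpha - eta) * (N%:R - 1) - eta * (size s)%:R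
      = \sum_(d <- s) dl d.
    rewrite !big_split /= -!big_distrr /= big_const_seq count_predT iter_addr_0 -[(- eta) *+ _]mulr_natr.
    by rewrite /h /N nE hE big_split /=; ring.
  set T1 := \sum_(d <- s) ((nvert d)%:R - eta); set T2 := \sum_(d <- s) dl d.
  transitivity (S1 * T1 + S2 * T2
     - \sum_(d <- s) (phi a a' b N.+1 (h + 1) d * ((nvert d)%:R - eta) + psi d * dl d)).
    rewrite /T1 /T2 !big_distrr -big_split -sumrB /=; apply: eq_bigr => d _; ring.
  rewrite /S1 /S2 !big_distrl -big_split -sumrB /=; apply: eq_bigr => d _; ring.
transitivity (alpha * ((a 1 + a' 1) * b (Node s)) + w * ((a N + a' N * h) * b leaf) +
  \sum_(d <- s) phi a a' (gen b) N h d
  + (w * (S1 + S2) + \sum_(d <- s) (phi a a' b N.+1 (h + 1) d *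
   (N%:R - 1 - eta * (size s)%:R - ((nvert d)%:R - eta)) +
   psi d * ((1 + alpha) * (h - N%:R) + (1 - alpha - eta) * (N%:R - 1) - eta * (size s)%:R
     - dl d)))); first by ring.
congr (_ + _); first by ring.
rewrite /S1 /S2 -big_split big_distrr -big_split /=.
rewrite !big_seq; apply: eq_bigr => d ds.
have dN : (nvert d < N)%N by exact: nvert_child.
rewrite /psi /phi /w attach_weightE// /dl subSn ?(ltnW dN)// natrB ?(ltnW dN)//.
rewrite -[(sumn _).+1]/N. ring.
Qed.

End Generator2.

(** * Markov branching *)

Section Expectation.
Context (R : realType) (alpha gamma : R) (D : option nat).
Local Notation eta := (ag_eta alpha gamma D).
Local Notation gen := (gen alpha gamma D).
Implicit Types (b : ptree -> R) (c d : ptree) (s : seq ptree).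

(* [Ex n b] is the mean of [b] over the planted tree with [n] edges. The cases
   [n = 1, 2] are the deterministic start: the total weight [1 - eta] of a single
   edge may vanish, so the recursion cannot begin at [1]. *)
Fixpoint Ex (n : nat) b : R :=
  match n with
  | 0 => 0
  | 1 => b leaf
  | 2 => b (Node [:: leaf])
  | n'.+1 => Ex n' (gen b) / (n'%:R - eta)
  end.

Lemma ExSS k b : Ex k.+3 b = Ex k.+2 (gen b) / (k.+2%:R - eta).
Proof. by []. Qed.

Lemma Ex_ext n b b' : (forall c, nvert c = n -> b c = b' c) -> Ex n b = Ex n b'.
Proof.
case: n => [//|[|n]]; first exact.
elim: n b b' => [|n IH] b b' bb'; first exact: bb'.
rewrite !ExSS; congr (_ / _); apply: IH => c cn; apply: gen_ext => c' c'E.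
by apply: bb'; rewrite c'E cn.
Qed.

Lemma ExD n b b' : Ex n (fun c => b c + b' c) = Ex n b + Ex n b'.
Proof.
case: n => [|[//|n]]; first by rewrite addr0.
elim: n b b' => [//|n IH] b b'; rewrite !ExSS -mulrDl -IH; congr (Ex _ _ / _).
by apply/funext => c; rewrite genD.
Qed.

Lemma ExZ n k b : Ex n (fun c => k * b c) = k * Ex n b.
Proof.
case: n => [|[//|n]]; first by rewrite mulr0.
elim: n b => [//|n IH] b; rewrite !ExSS mulrA -IH; congr (Ex _ _ / _).
by apply/funext => c; rewrite genZ.
Qed.

Lemma Ex_sum n I (r : seq I) (b : I -> ptree -> R) :
  Ex n (fun c => \sum_(i <- r) b i c) = \sum_(i <- r) Ex n (b i).
Proof.
elim: r => [|i r IH].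
  rewrite big_nil -[RHS](mul0r (Ex n (fun=> 0))) -ExZ; apply: Ex_ext => c _.
  by rewrite big_nil mul0r.
rewrite big_cons -IH -ExD; apply: Ex_ext => c _.
by rewrite big_cons.
Qed.

Hypothesis eta_le1 : eta <= 1.

Lemma eta_lt k : eta < k.+2%:R.
Proof. by apply: (le_lt_trans eta_le1); rewrite ltr1n. Qed.

(** Free of division, this form also covers size 1, where the total weight [1 - eta] may be zero. *)
Lemma Ex_gen n b : Ex n.+1 (gen b) = (n.+1%:R - eta) * Ex n.+2 b.
Proof.
case: n => [|n].
  rewrite /= gen_Node big_ord0 /attach_weight !mul0r !addr0.
  by rewrite /grow_weight.
by rewrite ExSS mulrC mulfVK// subr_eq0 gt_eqF// eta_lt.
Qed.

Lemma Ex1 n : Ex n.+1 (fun=> 1) = 1.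
Proof.
case: n => [//|n]; elim: n => [//|n IH].
rewrite ExSS (@Ex_ext _ _ (fun c => (n.+2%:R - eta) * 1)) ?ExZ ?IH.
  by rewrite mulr1 divff// subr_eq0 gt_eqF// eta_lt.
by move=> c cn; rewrite gen1 cn mulr1.
Qed.

Let W n := Ex n (fun c => attach_weight alpha gamma D (children c)).
Let W' n := Ex n (fun c => attach_weight alpha gamma D (children c) * (hgt c)%:R).

(* With [n = k.+2], [pcoef k i] (resp. [gcoef k i]) is the mean number (resp. the mean
   of the sum of [G]) of the branches with [Y = i.+1]. The terms with [W] and [W']
   come from new branches made of one edge; they sit at [Y = n] and disappear
   in the limit. *)
Fixpoint pcoef (k i : nat) : R :=
  if k is k'.+1 then
    ((i == 0)%:R * alpha + (k'.+1%:R - i%:R - eta) * pcoef k' i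
     + (if i is i'.+1 then (i%:R - alpha) * pcoef k' i' else 0)
     + (i == k'.+1)%:R * W k'.+2) / (k'.+2%:R - eta)
  else (i == 0)%:R.

Fixpoint gcoef (k i : nat) : R :=
  if k is k'.+1 then
    ((i == 0)%:R * alpha + (k'.+1%:R - i%:R - eta) * gcoef k' i
     + (if i is i'.+1 then (i%:R + 1) * gcoef k' i'
          + ((1 - 2 * alpha - eta) * (i%:R - 1) + 1 - 3 * alpha) * pcoef k' i' else 0)
     + (i == k'.+1)%:R * W' k'.+2) / (k'.+2%:R - eta)
  else (i == 0)%:R.

Lemma pcoef_big k i : (k < i)%N -> pcoef k i = 0.
Proof.
elim: k i => [|k IH] [|i] //= ki.
rewrite !IH ?mulr0 ?eqSS ?gtn_eqF ?mul0r ?addr0 ?mul0r//.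
by rewrite ltnS ltnW.
Qed.

Lemma gcoef_big k i : (k < i)%N -> gcoef k i = 0.
Proof.
elim: k i => [|k IH] [|i] //= ki.
rewrite !IH ?(pcoef_big (k := k)) ?mulr0 ?eqSS ?gtn_eqF ?mul0r ?addr0 ?mul0r//.
by rewrite ltnS ltnW.
Qed.

(** In the induction, [Ex_gen] turns growth inside a branch of size [k.+1 - i] into the factor
    [k.+1 - i - eta] and the next size, while growth outside shifts [i] by one. Comparing
    coefficients gives the recursions of [pcoef] and [gcoef]. *)
Lemma Ex_branch k a a' b :
  Ex k.+2 (branch a a' b) =
  \sum_(i < k.+1) (pcoef k i * a i.+1 + gcoef k i * a' i.+1) * Ex (k.+1 - i) b.
Proof.
elim: k a a' b => [|k IH] a a' b.
  by rewrite big_ord1 /= big_seq1 /= !mul1r !subSS subn0 mulr1.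
rewrite ExSS.
have en0 : k.+2%:R - eta != 0 by rewrite subr_eq0 gt_eqF// eta_lt.
apply: (canLR (mulfK en0)).
transitivity (alpha * (a 1%N + a' 1%N) * Ex k.+2 b
    + (a k.+2 * b leaf * W k.+2 + a' k.+2 * b leaf * W' k.+2)
    + Ex k.+2 (branch a a' (gen b))
    + Ex k.+2 (branch (fun y => (y%:R - alpha) * a y.+1
                 + a' y.+1 * ((1 - 2 * alpha - eta) * (y%:R - 1) + 1 - 3 * alpha))
             (fun y => (y%:R + 1) * a' y.+1) b)).
  rewrite -!(ExZ, ExD); apply: Ex_ext => -[[|d s]] // cn.
  rewrite gen_branch// cn; congr (_ + _ + _ + _); rewrite /children; ring.
rewrite !IH.
have -> : \sum_(i < k.+1) (pcoef k i * a i.+1 + gcoef k i * a' i.+1)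
      * Ex (k.+1 - i) (gen b)
  = \sum_(i < k.+2) (k.+1%:R - i%:R - eta) *
     (pcoef k i * a i.+1 + gcoef k i * a' i.+1) * Ex (k.+2 - i) b.
  rewrite [RHS]big_ord_recr /= pcoef_big// gcoef_big// !mul0r add0r mulr0 mul0r addr0.
  apply: eq_bigr => -[i /=]; rewrite ltnS => ik _.
  by rewrite !subSn ?(leq_trans ik)// Ex_gen -natr1 natrB//; ring.
rewrite [X in _ + X](_ : _ = \sum_(i < k.+2) (if i : nat is i'.+1 then
   (pcoef k i' * ((i%:R - alpha) * a i.+1
                 + a' i.+1 * ((1 - 2 * alpha - eta) * (i%:R - 1) + 1 - 3 * alpha))
     + gcoef k i' * ((i%:R + 1) * a' i.+1)) * Ex (k.+2 - i) b else 0)); last first.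
  by rewrite [RHS]big_ord_recl add0r; apply: eq_bigr => i _.
rewrite [X in X + _ + _ + _](_ : _ = \sum_(i < k.+2) ((i : nat) == 0)%:R *
     (alpha * (a i.+1 + a' i.+1) * Ex (k.+2 - i) b)); last first.
  by rewrite big_ord_recl big1 ?addr0 ?mul1r// => i _; rewrite mul0r.
rewrite [X in _ + X + _ + _](_ : _ = \sum_(i < k.+2) ((i : nat) == k.+1)%:R *
     ((a i.+1 * W k.+2 + a' i.+1 * W' k.+2) * Ex (k.+2 - i) b)); last first.
  rewrite big_ord_recr big1 ?add0r /= => [|i _]; last by rewrite ltn_eqF ?mul0r// ltn_ord.
  by rewrite eqxx subSnn /=; ring.
rewrite -!big_split big_distrl; apply: eq_bigr => -[[|i] /= ik] _.
  by move: en0; set e := _ - eta; clearbody e => en0; field.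
move: en0; set e := k.+2%:R - eta; set X := (_ == _)%:R; clearbody e X => en0.
by field.
Qed.

End Expectation.

(* [y >= 1] makes [(k + 1 - e) * |u k - c / y|] grow at most by [|v k - c|] at each
   step. *)
Lemma cvg_relax (R : realType) (e y c : R) (u v : nat -> R) (k0 : nat) :
  e <= 1 -> 1 <= y -> v @ \oo --> c ->
  (forall k, (k0 <= k)%N ->
     (k.+2%:R - e) * u k.+1 = (k.+2%:R - e - y) * u k + v k) ->
  u @ \oo --> c / y.
Proof.
move=> e1 y1 vc ukE; have y0 : 0 < y by apply: lt_le_trans y1.
apply/cvgrPdist_le => eps eps0.
have eps20 : 0 < eps / 2 by rewrite divr_gt0.
move/cvgrPdist_le : vc => /(_ _ eps20)[N _ HN].
pose M := (Num.trunc y).+1; have yM : y < M%:R by exact: truncnS_gt.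
pose k1 := (k0 + N + M).+1.
pose d k := (k.+1%:R - e) * `|u k - c / y|.
have dS k : (k1 <= k)%N -> d k.+1 <= d k + eps / 2.
  move=> kk; rewrite /d.
  have E : (k.+2%:R - e) * (u k.+1 - c / y) = (k.+2%:R - e - y) * (u k - c / y) + (v k - c).
    rewrite mulrBr ukE; last by apply: leq_trans kk; rewrite /k1; lia.
    by field; rewrite gt_eqF.
  have ky : 0 <= k.+2%:R - e - y.
    have : (M%:R : R) <= k%:R by rewrite ler_nat; apply: leq_trans kk; rewrite /k1; lia.
    rewrite -[k.+2]addn2 natrD; lra.
  have k2 : 0 <= k.+2%:R - e by lra.
  rewrite -{1}(ger0_norm k2) -normrM E; apply: (le_trans (ler_normD _ _)).
  rewrite normrM (ger0_norm ky); apply: lerD.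
    by apply: ler_wpM2r => //; rewrite -[k.+2%:R]natr1; lra.
  rewrite distrC; apply: HN => /=; apply: leq_trans kk; rewrite /k1; lia.
have dk k : d (k1 + k)%N <= d k1 + k%:R * (eps / 2).
  elim: k => [|k IH]; first by rewrite addn0 mul0r addr0.
  rewrite addnS (le_trans (dS _ _)) ?leq_addr//.
  by rewrite -[k.+1%:R]natr1 mulrDl mul1r addrA lerD2r.
pose B := (Num.trunc (d k1 / (eps / 2))).+1.
have : d k1 / (eps / 2) < B%:R by exact: truncnS_gt.
rewrite ltr_pdivrMr// => HB.
exists (k1 + B)%N => //= k kk; rewrite distrC.
have := dk (k - k1)%N; rewrite subnKC; last by apply: leq_trans kk; exact: leq_addr.
rewrite /d natrB; last by apply: leq_trans kk; exact: leq_addr.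
move=> H.
have k1pos : (1 : R) <= k1%:R by rewrite ler1n.
have k10 : (1 : R) <= k%:R by rewrite ler1n; apply: leq_trans kk; rewrite /k1; lia.
have kB : B%:R + k1%:R <= k%:R :> R by rewrite -natrD ler_nat addnC.
have kk0 : 0 < k.+1%:R - e by rewrite -[k.+1%:R]natr1; lra.
rewrite -(ler_pM2l kk0); apply: (le_trans H).
rewrite -/(d k1) -[k.+1%:R]natr1.
have : B%:R * (eps / 2) <= (k%:R - k1%:R) * (eps / 2) by apply: ler_wpM2r; lra.
have : 0 <= (k1%:R + 1 - e) * eps by apply: mulr_ge0; lra.
lra.
Qed.

(** * Limit law of the part of the tree away from the large branch *)

Section Limits.
Context (R : realType) (alpha gamma : R) (D : option nat).
Local Notation eta := (ag_eta alpha gamma D).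
Local Notation Ex := (Ex alpha gamma D).
Local Notation pcoef := (pcoef alpha gamma D).
Local Notation gcoef := (gcoef alpha gamma D).
Hypothesis alpha01 : 0 < alpha <= 1.
Hypothesis eta_itv : -1 <= eta <= 1.

Let eta_le1 : eta <= 1. Proof. by case/andP: eta_itv. Qed.

(* The limit law of [Y] is the Sibuya law: [sib i] is the mass of [i.+1] and
   [sib_tail k] that of the integers larger than [k]. *)
Definition sib_tail (k : nat) : R := \prod_(j < k) (1 - alpha / j.+1%:R).

Definition sib (i : nat) : R := alpha / i.+1%:R * sib_tail i.

Lemma sib_tail_ge0 k : 0 <= sib_tail k.
Proof.
apply: prodr_ge0 => j _; rewrite subr_ge0 ler_pdivrMr// mul1r.
have /andP[_ a1] := alpha01; apply: (le_trans a1).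
by rewrite ler1n.
Qed.

Lemma sib_ge0 i : 0 <= sib i.
Proof.
rewrite mulr_ge0 ?sib_tail_ge0// divr_ge0//.
by have /andP[/ltW a0 _] := alpha01.
Qed.

Lemma sibS i : i.+2%:R * sib i.+1 = (i.+1%:R - alpha) * sib i.
Proof.
rewrite /sib /sib_tail big_ord_recr /=.
have : i.+1%:R != 0 :> R by rewrite pnatr_eq0.
have : i.+2%:R != 0 :> R by rewrite pnatr_eq0.
set x := i.+2%:R; set y := i.+1%:R; clearbody x y => x0 y0.
by field; rewrite x0 y0.
Qed.

Lemma sum_sib k : \sum_(i < k) sib i = 1 - sib_tail k.
Proof.
elim: k => [|k IH]; first by rewrite big_ord0 /sib_tail big_ord0 subrr.
by rewrite big_ord_recr IH /sib /sib_tail big_ord_recr /=; ring.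
Qed.

(** The coefficient of index [i] relaxes at rate [i.+1] towards the input from the previous index,
    and [sibS] is the equation of the equilibrium. Starting at a large [k0] excludes the [W]
    term. *)
Lemma pcoef_lim i : pcoef ^~ i @ \oo --> sib i.
Proof.
elim: i => [|i IH].
  have -> : sib 0 = alpha / 1 by rewrite /sib /sib_tail big_ord0 mulr1.
  apply: (cvg_relax (e := eta) (v := fun=> alpha) (k0 := 0%N)) => //.
    exact: cvg_cst.
  move=> k _ /=; rewrite mulrC mulfVK; last by rewrite subr_eq0 gt_eqF// eta_lt.
  by rewrite -[k.+2%:R]natr1; ring.
have -> : sib i.+1 = (i.+1%:R - alpha) * sib i / i.+2%:R.
  by rewrite -sibS mulrC mulKf// pnatr_eq0.
apply: (cvg_relax (e := eta) (v := fun k => (i.+1%:R - alpha) * pcoef k i)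
  (k0 := i.+1%N)) => //.
- by rewrite ler1n.
- exact: cvgMl_tmp.
move=> k ik; rewrite [pcoef k.+1 _]/=.
rewrite mulrC mulfVK; last by rewrite subr_eq0 gt_eqF// eta_lt.
rewrite eqSS ltn_eqF// mulr0n !mul0r -[k.+2%:R]natr1 -[i.+2%:R]natr1. ring.
Qed.

(** The limit of [gcoef], that is the mean total height of the outer part on the event that it has
    [i.+1] edges. Input and relaxation rate share the factor [i.+2], so the limit is a plain sum. *)
Fixpoint side (i : nat) : R :=
  if i is i'.+1 then
    side i' + ((1 - 2 * alpha - eta) * (i%:R - 1) + 1 - 3 * alpha) / i.+1%:R * sib i'
  else alpha.

Lemma gcoef_lim i : gcoef ^~ i @ \oo --> side i.
Proof.
elim: i => [|i IH].
  have -> : side 0 = alpha / 1 by rewrite divr1.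
  apply: (cvg_relax (e := eta) (v := fun=> alpha) (k0 := 0%N)) => //.
    exact: cvg_cst.
  move=> k _ /=; rewrite mulrC mulfVK; last by rewrite subr_eq0 gt_eqF// eta_lt.
  by rewrite -[k.+2%:R]natr1; ring.
set r : R := ((1 - 2 * alpha - eta) * (i.+1%:R - 1) + 1 - 3 * alpha).
have -> : side i.+1 = (i.+2%:R * side i + r * sib i) / i.+2%:R.
  by rewrite /= -/r [RHS]mulrDl [i.+2%:R * _]mulrC mulfK ?pnatr_eq0// [r * _ / _]mulrAC.
apply: (cvg_relax (e := eta) (v := fun k => i.+2%:R * gcoef k i + r * pcoef k i)
  (k0 := i.+1%N)) => //.
- by rewrite ler1n.
- apply: cvgD; apply: cvgMl_tmp; [exact: IH | exact: pcoef_lim].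
move=> k ik; rewrite [gcoef k.+1 _]/=.
rewrite mulrC mulfVK; last by rewrite subr_eq0 gt_eqF// eta_lt.
rewrite eqSS ltn_eqF// mulr0n !mul0r /r -[k.+2%:R]natr1 -[i.+2%:R]natr1; ring.
Qed.

(** The increments are at most twice the Sibuya masses, whose sum is at most 1. *)
Lemma side_le3 i : side i <= 3.
Proof.
have /andP[a0 a1] := alpha01; have /andP[e0 e1] := eta_itv.
suff : side i <= alpha + 2 * \sum_(j < i) sib j.
  move=> /le_trans; apply; rewrite sum_sib.
  by have := sib_tail_ge0 i; lra.
elim: i => [|i IH]; first by rewrite big_ord0 mulr0 addr0.
rewrite big_ord_recr mulrDr addrA lerD//= ler_wpM2r ?sib_ge0//.
rewrite ler_pdivrMr//.
have i0 : (1 : R) <= i.+1%:R by rewrite ler1n.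
rewrite -[i.+2%:R]natr1.
have : 0 <= (1 + 2 * alpha + eta) * (i.+1%:R - 1) by apply: mulr_ge0; lra.
lra.
Qed.

(** The indicators keep one term of [Ex_branch], in which the branch has size [n - i.+1] and tends
    to infinity with [n]. *)
Lemma Ex_branch_lim i (b b' : ptree -> R) (l1 l2 : R) :
  Ex ^~ b @ \oo --> l1 -> Ex ^~ b' @ \oo --> l2 ->
  (fun n => Ex n (branch (fun y => (y == i.+1)%:R) (fun=> 0) b)
     + Ex n (branch (fun=> 0) (fun y => (y == i.+1)%:R) b')) @ \oo -->
  sib i * l1 + side i * l2.
Proof.
move=> bl bl'; rewrite -(cvg_shiftn 2).
have sh n (u : nat -> R) (l : R) : u @ \oo --> l -> (fun k => u (k + 1 - n)%N) @ \oo --> l.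
  move=> ul; have := ul; rewrite -(cvg_centern n) => ul'.
  by rewrite (cvg_shiftn 1 (fun k => u (k - n)%N)).
have L : (fun k => pcoef k i * Ex (k + 1 - i) b + gcoef k i * Ex (k + 1 - i) b')
   @ \oo --> sib i * l1 + side i * l2.
  apply: cvgD; apply: cvgM; [exact: pcoef_lim|exact: (sh i _ _ bl)|
    exact: gcoef_lim|exact: (sh i _ _ bl')].
apply: cvg_trans L; apply: near_eq_cvg; exists i => //= k ik.
rewrite addn2 !Ex_branch//.
have ik' : (i < k.+1)%N by [].
have S (F : 'I_k.+1 -> R) : (forall j : 'I_k.+1, (j : nat) <> i -> F j = 0) ->
    \sum_j F j = F (Ordinal ik').
  move=> F0; rewrite (bigD1 (Ordinal ik'))//= big1 ?addr0// => j /eqP ji.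
  by apply: F0 => ji'; apply: ji; exact: val_inj.
congr (_ + _); rewrite S /= ?eqxx ?addn1 ?mulr1n; first by ring.
- by move=> j ji; rewrite eqSS (introF eqP ji) mulr0n; ring.
- by ring.
- by move=> j ji; rewrite eqSS (introF eqP ji) mulr0n; ring.
Qed.

End Limits.

(** * Size and height of the part of the tree away from a marked vertex *)

(* [spine pad r c] lists, for the vertices [v] at distance [r] from the root of [c],
   the number of edges outside the subtree at [v] (the edge above [v] being
   counted inside) and a bound for their total height. Passing from a branch to
   the whole tree raises the height of each outer edge by one; [pad] is an a
   priori bound for the number of these edges. *)
Fixpoint spine (pad r : nat) (c : ptree) : seq (nat * nat) :=
  if r is r'.+1 then
    let: Node s := c in
    flatten [seq [seq ((nvert c - nvert d) + p.1,
                       (hgt c - hgt d - nvert d) + pad + p.2)%N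
                 | p <- spine pad r' d] | d <- s]
  else [:: (0, 0)%N].

Section SpineFunctionals.
Context (R : realType).

Definition spine_count pad r K c : R := \sum_(p <- spine pad r c) (p.1 <= K)%N%:R.

Definition spine_heights pad r K c : R :=
  \sum_(p <- spine pad r c) (p.1 <= K)%N%:R * p.2%:R.

Lemma big_spineS pad r s (F : nat * nat -> R) :
  \sum_(p <- spine pad r.+1 (Node s)) F p =
  \sum_(d <- s) \sum_(p <- spine pad r d)
    F ((nvert (Node s) - nvert d) + p.1,
       (hgt (Node s) - hgt d - nvert d) + pad + p.2)%N.
Proof.
rewrite [spine _ _ _]/= big_flatten big_map; apply: eq_bigr => d _.
by rewrite big_map.
Qed.

Lemma sum_eqS K y (F : nat -> R) : (0 < y)%N ->
  \sum_(i < K) (y == i.+1)%:R * F i = (y <= K)%N%:R * F y.-1.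
Proof.
case: y => // y _; have [yK|Ky] := leqP y.+1 K.
  rewrite (bigD1 (Ordinal yK))//= eqxx big1 ?addr0// => i /eqP iy.
  rewrite eqSS (introF eqP) ?mul0r// => yi; apply: iy; exact: val_inj.
rewrite mul0r big1// => i _; rewrite eqSS gtn_eqF ?mul0r//.
by rewrite (leq_trans (ltn_ord i))// -ltnS.
Qed.

(** Splitting by the size [i.+1] of the part outside the first branch yields functionals of the
    class [branch], written in the shape of [Ex_branch_lim]. *)
Lemma spine_countS pad r K c : spine_count pad r.+1 K c = \sum_(i < K)
  (branch (fun y => (y == i.+1)%:R) (fun=> 0) (spine_count pad r (K - i.+1)) c
   + branch (fun=> 0) (fun y => (y == i.+1)%:R) (fun=> 0) c).
Proof.
case: c => s; rewrite /spine_count big_spineS /branch.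
under [RHS]eq_bigr do rewrite -big_split /=.
rewrite exchange_big /= !big_seq; apply: eq_bigr => d ds.
set Y := (_ - _)%N; have Y0 : (0 < Y)%N by rewrite subn_gt0 nvert_child.
under [RHS]eq_bigr do rewrite mulr0 addr0 mul0r addr0.
rewrite (sum_eqS K (fun i => \sum_(p <- spine pad r d) (p.1 <= K - i.+1)%N%:R)) //.
rewrite prednK// big_distrr /=; apply: eq_bigr => p _.
rewrite -natrM mulnb; congr (nat_of_bool _)%:R; apply/idP/andP; lia.
Qed.

Lemma spine_heightsS pad r K c : spine_heights pad r.+1 K c = \sum_(i < K)
  (branch (fun y => (y == i.+1)%:R) (fun=> 0)
     (fun d => spine_heights pad r (K - i.+1) d + pad%:R * spine_count pad r (K - i.+1) d) c
   + branch (fun=> 0) (fun y => (y == i.+1)%:R) (spine_count pad r (K - i.+1)) c).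
Proof.
case: c => s; rewrite /spine_heights /spine_count big_spineS /branch.
under [RHS]eq_bigr do rewrite -big_split /=.
rewrite exchange_big /= !big_seq; apply: eq_bigr => d ds.
set Y := (_ - _)%N; have Y0 : (0 < Y)%N by rewrite subn_gt0 nvert_child.
set G := (_ - _ - _)%N.
under [RHS]eq_bigr => i _ do rewrite mul0r addr0 add0r -mulrA -mulrDr.
rewrite (sum_eqS K (fun i => \sum_(p <- spine pad r d) (p.1 <= K - i.+1)%N%:R * p.2%:R
   + pad%:R * (\sum_(p <- spine pad r d) (p.1 <= K - i.+1)%N%:R)
   + G%:R * (\sum_(p <- spine pad r d) (p.1 <= K - i.+1)%N%:R))) //.
rewrite prednK// !big_distrr /= -!big_split big_distrr /=; apply: eq_bigr => p _.
have -> : (Y + p.1 <= K)%N = (Y <= K)%N && (p.1 <= K - Y)%N by apply/idP/andP; lia.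
by rewrite -mulnb natrM !natrD; ring.
Qed.

End SpineFunctionals.

Arguments spine_count {R}.
Arguments spine_heights {R}.

(** * Sums of independent Sibuya variables *)

Section Qlim.
Context (R : realType) (alpha : R).
Local Notation sib := (sib alpha).
Local Notation sib_tail := (sib_tail alpha).
Hypothesis alpha01 : 0 < alpha <= 1.

(* The distribution function at [K] of the sum of [r] independent Sibuya variables. *)
Fixpoint qlim r K : R :=
  if r is r'.+1 then \sum_(i < K) sib i * qlim r' (K - i.+1)%N else 1.

Lemma qlim_ge0 r K : 0 <= qlim r K.
Proof.
elim: r K => [|r IH] K //=; apply: sumr_ge0 => i _.
by rewrite mulr_ge0// sib_ge0.
Qed.

(** A sum of positive integers is at most [K] only if each summand is. *)
Lemma qlim_le_tail r K : qlim r K <= (1 - sib_tail K) ^+ r.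
Proof.
have t01 k : 0 <= 1 - sib_tail k by rewrite -sum_sib; apply: sumr_ge0 => i _; exact: sib_ge0.
have tmono k n : (k <= n)%N -> 1 - sib_tail k <= 1 - sib_tail n.
  move=> kn; rewrite -!sum_sib -(subnKC kn) big_split_ord /= lerDl.
  by apply: sumr_ge0 => i _; exact: sib_ge0.
elim: r K => [|r IH] K /=; first by rewrite expr0.
rewrite exprS -[X in _ <= X * _]sum_sib big_distrl /=; apply: ler_sum => i _.
apply: ler_wpM2l; first exact: sib_ge0.
apply: (le_trans (IH _)); apply: lerXn2r; rewrite ?nnegrE//.
by apply: tmono; rewrite leq_subr.
Qed.

Lemma qlim_le1 r K : qlim r K <= 1.
Proof.
apply: (le_trans (qlim_le_tail _ _)); apply: exprn_ile1.
  by rewrite -sum_sib; apply: sumr_ge0 => i _; exact: sib_ge0.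
by rewrite gerBl sib_tail_ge0.
Qed.

Lemma qlim_small r K : (K < r)%N -> qlim r K = 0.
Proof.
elim: r K => // r IH K Kr /=; apply: big1 => -[i iK] _ /=.
by rewrite IH ?mulr0//; lia.
Qed.

Lemma qlim_mono r k n : (k <= n)%N -> qlim r k <= qlim r n.
Proof.
elim: r k n => [//|r IH] k n kn /=.
rewrite -(subnKC kn) big_split_ord /= -[X in X <= _]addr0; apply: lerD.
  apply: ler_sum => i _; apply: ler_wpM2l; first exact: sib_ge0.
  by apply: IH; lia.
by apply: sumr_ge0 => i _; rewrite mulr_ge0 ?sib_ge0 ?qlim_ge0.
Qed.

Lemma sum_conv N (a b : nat -> R) :
  \sum_(k < N) \sum_(i < k) a i * b (k - i.+1)%N
  = \sum_(i < N) a i * \sum_(k < N - i.+1) b k.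
Proof.
elim: N => [|N IH]; first by rewrite !big_ord0.
rewrite big_ord_recr /= IH [RHS]big_ord_recr /= subnn big_ord0 mulr0 addr0.
rewrite -big_split /=; apply: eq_bigr => i _.
have -> : (N.+1 - i.+1 = (N - i.+1).+1)%N by have := ltn_ord i; lia.
by rewrite big_ord_recr mulrDr.
Qed.

(** Both sides are truncated means: with [X] one Sibuya variable and [S] the sum of [r] of them,
    [E min(S, N) <= r * E min(X, N)]. *)
Lemma sum_qlimC r N :
  \sum_(k < N) (1 - qlim r k) <= r%:R * \sum_(k < N) sib_tail k.
Proof.
elim: r => [|r IH]; first by rewrite mul0r big1// => i _; rewrite subrr.
have E k : 1 - qlim r.+1 k = sib_tail k + \sum_(i < k) sib i * (1 - qlim r (k - i.+1)).
  under eq_bigr do rewrite mulrBr mulr1.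
  by rewrite sumrB sum_sib /=; ring.
under eq_bigr do rewrite E.
rewrite big_split /= -natr1 mulrDl mul1r addrC lerD2r.
rewrite (sum_conv N sib (fun k => 1 - qlim r k)); apply: le_trans IH.
have S0 n : 0 <= \sum_(k < n) (1 - qlim r k).
  by apply: sumr_ge0 => k _; rewrite subr_ge0 qlim_le1.
apply: (@le_trans _ _ ((\sum_(i < N) sib i) * \sum_(k < N) (1 - qlim r k))).
  rewrite big_distrl /=; apply: ler_sum => i _; apply: ler_wpM2l; first exact: sib_ge0.
  rewrite -[in X in _ <= X](subnK (ltn_ord i)) big_split_ord /= lerDl.
  by apply: sumr_ge0 => k _; rewrite subr_ge0 qlim_le1.
rewrite -[X in _ <= X]mul1r; apply: ler_wpM2r => //.
by rewrite sum_sib gerBl sib_tail_ge0.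
Qed.

(** Markov's inequality for the truncated mean, by monotonicity of [qlim] in its second argument. *)
Lemma qlimC_le r N :
  N.+1%:R * (1 - qlim r N) <= r%:R * \sum_(k < N.+1) sib_tail k.
Proof.
apply: le_trans (sum_qlimC _ _); rewrite mulr_natl -[X in _ *+ X]card_ord -sumr_const.
by apply: ler_sum => i _; rewrite lerB// qlim_mono// -ltnS.
Qed.

End Qlim.

Section SpineLimits.
Context (R : realType) (alpha gamma : R) (D : option nat).
Local Notation eta := (ag_eta alpha gamma D).
Local Notation Ex := (Ex alpha gamma D).
Local Notation sib := (sib alpha).
Local Notation sib_tail := (sib_tail alpha).
Local Notation side := (side alpha gamma D).
Local Notation qlim := (qlim alpha).
Hypothesis alpha01 : 0 < alpha <= 1.
Hypothesis eta_itv : -1 <= eta <= 1.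

Let eta_le1 : eta <= 1. Proof. by case/andP: eta_itv. Qed.

Fixpoint plim (pad r K : nat) : R :=
  if r is r'.+1 then
    \sum_(i < K) (sib i * (plim pad r' (K - i.+1)%N + pad%:R * qlim r' (K - i.+1)%N)
                  + side i * qlim r' (K - i.+1)%N)
  else 0.

Lemma cvg_sumn (I : Type) (r : seq I) (f : I -> nat -> R) (l : I -> R) :
  (forall i, f i @ \oo --> l i) ->
  (fun n => \sum_(i <- r) f i n) @ \oo --> \sum_(i <- r) l i.
Proof.
move=> fl; elim: r => [|i r IH].
  rewrite big_nil; under eq_fun do rewrite big_nil; exact: cvg_cst.
rewrite big_cons; under eq_fun do rewrite big_cons; exact: cvgD.
Qed.

Lemma spine_count_lim pad r K : (fun n => Ex n (spine_count pad r K)) @ \oo --> qlim r K.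
Proof.
elim: r K => [|r IH] K.
  apply: (@cvg_near_cst _ _ _ _ eventually); exists 1%N => //= -[//|n] _.
  by rewrite -(Ex1 eta_le1 n); apply: Ex_ext => c _; rewrite /spine_count /= big_seq1.
rewrite /=.
rewrite [X in X @ _ --> _](_ : _ = fun n => \sum_(i < K)
  (Ex n (branch (fun y => (y == i.+1)%:R) (fun=> 0) (spine_count pad r (K - i.+1)))
  + Ex n (branch (fun=> 0) (fun y => (y == i.+1)%:R) (fun=> 0)))); last first.
  apply/funext => n; under [RHS]eq_bigr do rewrite -ExD.
  rewrite -Ex_sum; apply: Ex_ext => c _; exact: spine_countS.
apply: cvg_sumn => i.
rewrite (_ : sib i * _ = sib i * qlim r (K - i.+1) + side i * 0); last by rewrite mulr0 addr0.
apply: Ex_branch_lim => //.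
apply: (@cvg_near_cst _ _ _ _ eventually); exists 0%N => //= n _.
by rewrite -[RHS](mul0r (Ex n (fun=> 0))) -ExZ; apply: Ex_ext => c _; rewrite mul0r.
Qed.

Lemma spine_heights_lim pad r K : (fun n => Ex n (spine_heights pad r K)) @ \oo --> plim pad r K.
Proof.
elim: r K => [|r IH] K.
  apply: (@cvg_near_cst _ _ _ _ eventually); exists 0%N => //= n _.
  rewrite -[RHS](mul0r (Ex n (fun=> 0))) -ExZ; apply: Ex_ext => c _.
  by rewrite /spine_heights /= big_seq1 mulr0 mul0r.
rewrite /=.
rewrite [X in X @ _ --> _](_ : _ = fun n => \sum_(i < K)
  (Ex n (branch (fun y => (y == i.+1)%:R) (fun=> 0)
     (fun d => spine_heights pad r (K - i.+1) d + pad%:R * spine_count pad r (K - i.+1) d))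
  + Ex n (branch (fun=> 0) (fun y => (y == i.+1)%:R) (spine_count pad r (K - i.+1))))); last first.
  apply/funext => n; under [RHS]eq_bigr do rewrite -ExD.
  rewrite -Ex_sum; apply: Ex_ext => c _; exact: spine_heightsS.
apply: cvg_sumn => i; apply: Ex_branch_lim => //; last exact: spine_count_lim.
under eq_fun do rewrite ExD ExZ.
apply: cvgD; first exact: IH.
by apply: cvgMl_tmp; exact: spine_count_lim.
Qed.

(** Each level adds at most [pad], the total mass being at most 1, and at most 3 for each of the [K]
    possible sizes of the outer part. *)
Lemma plim_le pad r K : plim pad r K <= r%:R * (pad + 3 * K)%:R.
Proof.
elim: r K => [|r IH] K /=; first by rewrite mul0r.
rewrite big_split /= -natr1 mulrDl mul1r {2}natrD addrA; apply: lerD.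
  set B := r%:R * (pad + 3 * K)%:R + pad%:R.
  apply: (@le_trans _ _ ((\sum_(i < K) sib i) * B)).
    rewrite big_distrl /=; apply: ler_sum => i _; apply: ler_wpM2l; first exact: sib_ge0.
    apply: lerD; last by rewrite -[X in _ <= X]mulr1 ler_wpM2l// qlim_le1.
    apply: (le_trans (IH _)); rewrite ler_wpM2l// ler_nat; lia.
  rewrite -[X in _ <= X]mul1r; apply: ler_wpM2r.
    by rewrite addr_ge0// mulr_ge0.
  by rewrite sum_sib gerBl sib_tail_ge0.
apply: (@le_trans _ _ (\sum_(i < K) 3)); last by rewrite sumr_const card_ord natrM mulr_natr.
apply: ler_sum => i _; apply: (@le_trans _ _ (3 * qlim r (K - i.+1))).
  by rewrite ler_wpM2r ?qlim_ge0// side_le3.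
by rewrite -[X in _ <= X]mulr1 ler_wpM2l// qlim_le1.
Qed.

End SpineLimits.

(** * Power bounds for the Sibuya tail *)

Section SibuyaTail.
Context (R : realType) (alpha : R).
Hypothesis alpha01 : 0 < alpha <= 1.
Local Notation sib_tail := (sib_tail alpha).

(* Convexity of [expR], from its two tangent bounds at [alpha * L]. *)
Lemma expR_tangent (L : R) : expR (alpha * L) <= alpha * expR L + (1 - alpha).
Proof.
have /andP[a0 a1] := alpha01.
set E := expR (alpha * L).
have E0 : 0 < E by exact: expR_gt0.
have H1 : E * (1 + (1 - alpha) * L) <= expR L.
  have -> : expR L = E * expR ((1 - alpha) * L) by rewrite -expRD; congr expR; ring.
  by rewrite ler_pM2l// expR_ge1Dx.
have H2 : E * (1 + - (alpha * L)) <= 1.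
  by rewrite -[X in _ <= X]expR0 -(subrr (alpha * L)) expRD ler_pM2l// expR_ge1Dx.
have H1' := ler_wpM2l (ltW a0) H1.
have H2' := ler_wpM2l (_ : 0 <= 1 - alpha) H2.
have := H2' ltac:(lra); lra.
Qed.

(** The product of [sib_tail k] and the power of [k.+1] does not increase: with [u = alpha / k.+1],
    one step multiplies it by at most [expR (- u) * expR u = 1]. *)
Lemma sib_tail_le k : sib_tail k <= (k.+1%:R `^ alpha)^-1.
Proof.
have /andP[a0 a1] := alpha01.
rewrite -[X in _ <= X]mul1r ler_pdivlMr ?powR_gt0//.
elim: k => [|k IH]; first by rewrite /sib_tail big_ord0 mul1r powR1.
apply: le_trans IH; rewrite /sib_tail big_ord_recr /= -mulrA.
apply: ler_wpM2l; first exact: sib_tail_ge0.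
have k0 : (0 : R) < k.+1%:R by rewrite ltr0n.
have -> : k.+2%:R = k.+1%:R * (1 + k.+1%:R^-1) :> R.
  by rewrite -[k.+2%:R]natr1; field; rewrite gt_eqF.
have x0 : 0 < k.+1%:R^-1 :> R by rewrite invr_gt0.
have y0 : 0 <= 1 + k.+1%:R^-1 :> R by exact/ltW/ltr_wpDl.
rewrite (powRM _ (ltW k0) y0).
rewrite mulrCA -[X in _ <= X]mulr1; apply: ler_wpM2l; first exact: powR_ge0.
have e1 : 1 - alpha / k.+1%:R <= expR (- (alpha / k.+1%:R)) by exact: expR_ge1Dx.
have e2 : (1 + k.+1%:R^-1) `^ alpha <= expR (alpha / k.+1%:R).
  rewrite /powR gt_eqF; last exact/ltr_wpDl.
  rewrite ler_expR ler_pM2l// le_ln1Dx//.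
  by apply: lt_trans x0; rewrite ltrN10.
apply: (le_trans (ler_wpM2l _ e2)).
  rewrite subr_ge0 ler_pdivrMr// mul1r (le_trans a1)// ler1n//.
apply: (le_trans (ler_wpM2r _ e1)); first exact: expR_ge0.
by rewrite -expRD addNr expR0.
Qed.

(** With the index shifted, the product of tail and power starts at [1 - alpha] and does not
    decrease, by the tangent inequality [H]. *)
Lemma sib_tail_ge k : (1 - alpha) * (k.+1%:R `^ alpha)^-1 <= sib_tail k.+1.
Proof.
have /andP[a0 a1] := alpha01.
rewrite ler_pdivrMr ?powR_gt0//.
elim: k => [|k IH].
  by rewrite /sib_tail big_ord1 powR1 mulr1 divr1.
apply: (le_trans IH); rewrite [in X in _ <= X]/sib_tail big_ord_recr /= -mulrA.
apply: ler_wpM2l; first exact: sib_tail_ge0.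
have k0 : (0 : R) < k.+1%:R by rewrite ltr0n.
have k20 : (0 : R) < k.+2%:R by rewrite ltr0n.
have H : (k.+1%:R / k.+2%:R) `^ alpha <= 1 - alpha / k.+2%:R.
  have z0 : 0 < k.+1%:R / k.+2%:R :> R by rewrite divr_gt0.
  rewrite /powR gt_eqF//; apply: (le_trans (expR_tangent _)).
  rewrite lnK ?posrE// -[k.+2%:R in X in X <= _]natr1.
  have : k.+2%:R != 0 :> R by rewrite gt_eqF.
  rewrite -[k.+2%:R]natr1; set x := k.+1%:R; clearbody x => x0.
  by rewrite le_eqVlt; apply/orP; left; apply/eqP; field.
have -> : k.+1%:R `^ alpha = (k.+1%:R / k.+2%:R) `^ alpha * k.+2%:R `^ alpha.
  by rewrite -powRM ?(ltW k20) ?divr_ge0// divfK ?gt_eqF.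
by apply: ler_wpM2r; rewrite ?powR_ge0.
Qed.

End SibuyaTail.

(* Trees with a vertex of degree above [D] have negative weights, but they are
   never reached: the attachment weight vanishes at degree [D]. *)
Fixpoint legal (D : option nat) (t : ptree) : bool :=
  let: Node s := t in
  (if D is Some d then (size s < d)%N else true) && all (legal D) s.

(** * Monotonicity of the means *)

Section Positivity.
Context (R : realType) (alpha gamma : R) (D : option nat).
Local Notation eta := (ag_eta alpha gamma D).
Local Notation Ex := (Ex alpha gamma D).
Local Notation gen := (gen alpha gamma D).
Hypothesis alpha01 : 0 < alpha <= 1.
Hypothesis gamma01 : 0 <= gamma <= 1.
Hypothesis D3 : if D is Some d then (3 <= d)%N else true.

Lemma ag_eta_itv : -1 <= eta <= 1.
Proof.
have /andP[a0 a1] := alpha01; have /andP[g0 g1] := gamma01.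
rewrite /ag_eta; case: D D3 => [d d3|_]; last by apply/andP; split; lra.
have d30 : (3 : R) <= d%:R by rewrite (ler_nat R 3 d).
have d20 : 0 < d%:R - 2 :> R by lra.
rewrite lerNl opprK lerNl ler_pdivrMr// ler_pdivlMr//; apply/andP; split; lra.
Qed.

(** The alternative is what positivity of [gen] asks for: an attachment either has weight 0, as at a
    vertex of full degree, or leads to a legal tree. *)
Lemma attach_weight_ge0 s : legal D (Node s) ->
  (attach_weight alpha gamma D s = 0) \/
  (0 <= attach_weight alpha gamma D s /\
   if D is Some d then ((size s).+1 < d)%N else true).
Proof.
have /andP[a0 a1] := alpha01; have /andP[g0 g1] := gamma01.
have [->|s0] := eqVneq s [::]; first by left.
have sz : (1 : R) <= (size s)%:R by rewrite ler1n lt0n size_eq0.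
rewrite attach_weightE// /ag_eta /=; case: D D3 => [d d3|_] /andP[sd _].
  have d30 : (3 : R) <= d%:R by rewrite (ler_nat R 3 d).
  have d20 : 0 < d%:R - 2 :> R by lra.
  have -> : - ((1 - alpha) / (d%:R - 2)) * (size s)%:R + 1
      - - ((1 - alpha) / (d%:R - 2)) - alpha
      = (1 - alpha) / (d%:R - 2) * (d%:R - (size s).+1%:R).
    rewrite -[(size s).+1%:R]natr1.
    by field; rewrite gt_eqF.
  move: sd; rewrite leq_eqVlt => /orP[/eqP ->|sd]; first by left; rewrite subrr mulr0.
  right; split => //; apply: mulr_ge0; first by apply: divr_ge0; [lra|exact: ltW].
  by rewrite subr_ge0 ler_nat ltnW.
right; split => //.
have : 0 <= (1 - gamma) * ((size s)%:R - 1) by apply: mulr_ge0; lra.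
lra.
Qed.

Lemma gen_ge0 b c : (forall c, legal D c -> 0 <= b c) -> legal D c -> 0 <= gen b c.
Proof.
have /andP[a0 a1] := alpha01; have /andP[e0 e1] := ag_eta_itv.
elim/ptree_ind_in: c b => s IH b b0 ls; rewrite gen_Node.
have all_insert i c : legal D c -> all (legal D) (take i s ++ c :: drop i s).
  move=> lc; have /andP[_] : legal D (Node s) := ls.
  by rewrite -{1}(cat_take_drop i s) !all_cat /= lc.
have all_replace i c : (i < size s)%N -> legal D c ->
    all (legal D) (take i s ++ c :: drop i.+1 s).
  move=> si lc; have /andP[_] : legal D (Node s) := ls.
  by rewrite -{1}(cat_take_drop i s) (drop_nth leaf si) !all_cat /= lc => /and3P[-> _ ->].
apply: addr_ge0; first apply: addr_ge0.
- apply: mulr_ge0; first by rewrite /grow_weight; case: (s) => [|_ _]; lra.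
  apply: b0; 
  rewrite -[legal _ _]/((if D is Some d then (1 < d)%N else true) && (legal D (Node s) && true)).
  rewrite ls !andbT; by case: D D3 => // d d3 /=; rewrite (leq_trans _ d3).
- have [->|[w0 ds]] := attach_weight_ge0 ls; first by rewrite !mul0r.
  apply: mulr_ge0; first by rewrite divr_ge0.
  apply: sumr_ge0 => i _; apply: b0; rewrite /= all_insert//; last by case: D D3 => // d d3 /=; rewrite (leq_trans _ d3).
  by rewrite andbT size_cat /= addnS -size_cat cat_take_drop; case: D ds.
apply: sumr_ge0 => i _; apply: IH; first exact: mem_nth.
  move=> c lc; apply: b0; rewrite /= all_replace// andbT.
  have -> : size (take i s ++ c :: drop i.+1 s) = size s.
    by rewrite size_cat /= size_takel ?size_drop ?(ltnW (ltn_ord i))//; have := ltn_ord i; lia.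
  by have /andP[] : legal D (Node s) := ls.
by have /andP[_ /allP] : legal D (Node s) := ls; apply; exact: mem_nth.
Qed.

Lemma Ex_ge0 n b : (forall c, legal D c -> 0 <= b c) -> 0 <= Ex n b.
Proof.
have /andP[_ e1] := ag_eta_itv.
case: n => [//|[|n]] b0; first by apply: b0; case: D D3 => // d d3 /=; rewrite (leq_trans _ d3).
elim: n b b0 => [|n IH] b b0.
  by apply: b0; case: D D3 => // d /= d3; rewrite !andbT (leq_trans _ d3) // (leq_trans _ d3).
rewrite ExSS divr_ge0 ?subr_ge0 ?(ltW (eta_lt e1 _))//.
by apply: IH => c lc; exact: gen_ge0.
Qed.

Lemma Ex_le n b b' : (forall c, legal D c -> b c <= b' c) -> Ex n b <= Ex n b'.
Proof.
move=> bb'; rewrite -subr_ge0 -[X in _ - X]mul1r -mulNr -ExZ -ExD.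
by apply: Ex_ge0 => c lc; rewrite mulN1r subr_ge0 bb'.
Qed.

End Positivity.

Section Link.
Context (R : realType) (alpha gamma : R) (D : option nat).
Local Notation eta := (ag_eta alpha gamma D).
Local Notation Ex := (Ex alpha gamma D).
Hypothesis eta_le1 : eta <= 1.

Lemma ag_tree_moves1 c : ag_tree_moves alpha gamma D (Node [:: c])
  = [seq (m.1, Node [:: m.2]) | m <- ag_moves alpha gamma D c].
Proof. by rewrite /= cats0. Qed.

(** All trees reached after [k] steps have the same total weight [k.+2 - eta] by [gen1], so the
    normalisation of the chain is that of [Ex]. *)
Lemma sum_ag_dist k (f : ptree -> R) :
  \sum_(p <- ag_dist alpha gamma D k) p.2 * f p.1 = Ex k.+2 (fun c => f (Node [:: c])).
Proof.
elim: k f => [|k IH] f; first by rewrite /ag_dist /= big_seq1 mul1r.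
rewrite /ag_dist iterS -/(ag_dist alpha gamma D k) /ag_step big_flatten big_map.
pose W t := \sum_(m <- ag_tree_moves alpha gamma D t) m.1.
pose F t := \sum_(m <- ag_tree_moves alpha gamma D t) m.1 / W t * f m.2.
rewrite (eq_bigr (fun p => p.2 * F p.1)) => [|p _]; last first.
  rewrite big_map -/(W p.1) [RHS]mulr_sumr; apply: eq_bigr => m _.
  by rewrite [RHS]mulrA.
rewrite IH ExSS mulrC -ExZ; apply: Ex_ext => c cn; rewrite /F ag_tree_moves1 big_map.
have -> : W (Node [:: c]) = k.+2%:R - eta.
  rewrite /W ag_tree_moves1 big_map -cn -gen1 /gen; apply: eq_bigr => m _.
  by rewrite mulr1.
by rewrite /gen mulr_sumr; apply: eq_bigr => m _ /=; rewrite mulrA; congr (_ * _); rewrite mulrC.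
Qed.

Lemma ag_probE k (E : ptree -> Prop) :
  ag_prob alpha gamma D k E = Ex k.+2 (fun c => (asbool (E (Node [:: c])))%:R).
Proof.
rewrite -(sum_ag_dist k (fun T => (asbool (E T))%:R)) /ag_prob.
by apply: eq_bigr => p _; rewrite mulrC.
Qed.

End Link.

(** * Passage to the infinite tree *)

(** Serves to number the trees injectively, so that an event about one ball is a countable disjoint
    union of cylinders. *)
Fixpoint ptree_code (t : ptree) : GenTree.tree unit :=
  let: Node s := t in GenTree.Node 0 (map ptree_code s).

Lemma ptree_code_inj : injective ptree_code.
Proof.
elim/ptree_ind_in => s IH [s'] /= [] E; congr Node.
elim: s s' IH E => [|c s IHs] [|c' s'] //= IH [cc' ss'].
congr (_ :: _); first by apply: IH => //; rewrite mem_head.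
by apply: IHs ss' => d ds; apply: IH; rewrite inE ds orbT.
Qed.

Definition ptree_rank (t : ptree) : nat := pickle (ptree_code t).

Lemma ptree_rank_inj : injective ptree_rank.
Proof. by move=> t t' /(pcan_inj pickleK)/ptree_code_inj. Qed.

Section LimitEvents.
Context (R : realType) (alpha gamma : R) (D : option nat).
Hypothesis alpha01 : 0 < alpha <= 1.
Hypothesis gamma01 : 0 <= gamma <= 1.
Hypothesis D3 : if D is Some d then (3 <= d)%N else true.
Context (P : probability Omega R).
Hypothesis Hlim : forall (r : nat) (t : ptree),
     (fun k => (ag_prob alpha gamma D k (fun T => trunc r T = t))%:E) @ \oo
       --> P [set w : Omega | w r = t].

Lemma measurable_cylinder M t : measurable [set w : Omega | w M = t].
Proof. by apply: sub_sigma_algebra; exists M, t. Qed.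

Let F M (C : ptree -> Prop) i := [set w : Omega | C (w M) /\ ptree_rank (w M) = i].

Let FE M C i :
  (exists2 t, C t & ptree_rank t = i /\ F M C i = [set w : Omega | w M = t]) \/
  (F M C i = set0 /\ forall t, C t -> ptree_rank t <> i).
Proof.
have [[t [Ct ti]]|nt] := pselect (exists t, C t /\ ptree_rank t = i).
  left; exists t => //; split=> //; apply/seteqP; split => w /=.
    by case=> _ wi; apply: ptree_rank_inj; rewrite wi.
  by rewrite /F /= => ->.
right; split; last by move=> t Ct ti; apply: nt; exists t.
by apply/seteqP; split => w //= [Cw wi]; apply: nt; exists (w M).
Qed.

Let mF M C i : measurable (F M C i).
Proof.
by case: (FE M C i) => [[t _ [_ ->]]|[-> _]]; [exact: measurable_cylinder|exact: measurable0].
Qed.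

Let FU M C : [set w : Omega | C (w M)] = \bigcup_i F M C i.
Proof.
apply/seteqP; split => w /=; first by move=> Cw; exists (ptree_rank (w M)).
by case=> i _ [].
Qed.

Lemma measurable_event M C : measurable [set w : Omega | C (w M)].
Proof. by rewrite FU; apply: bigcup_measurable => i _; exact: mF. Qed.

Let F_lim M C i :
  (fun k => ag_prob alpha gamma D k (fun T => C (trunc M T) /\ ptree_rank (trunc M T) = i))
   @ \oo --> fine (P (F M C i)).
Proof.
have /andP[_ eta_le1] := ag_eta_itv alpha01 gamma01 D3.
have fP A : measurable A -> P A \is a fin_num by exact: fin_num_measure.
case: (FE M C i) => [[t Ct [ti E]]|[E nt]].
  have := @Hlim M t; rewrite -E -[P _]fineK; last exact: fP (mF _ _ _).
  move=> /fine_cvgP[_]; apply: cvg_trans; apply: near_eq_cvg; apply: nearW => k /=.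
  congr ag_prob; apply/funext => T; apply/propext; split => [->//|[_]].
  by rewrite -ti => /ptree_rank_inj.
rewrite E measure0 /=.
apply: (@cvg_near_cst _ _ _ _ eventually); apply: nearW => k.
rewrite ag_probE//.
have -> : (fun c => (asbool (C (trunc M (Node [:: c])) /\
    ptree_rank (trunc M (Node [:: c])) = i))%:R) = (fun=> 0 * 0) :> (ptree -> R).
  apply/funext => c; rewrite mul0r; case: asboolP => // -[Cc ci].
  by have := nt _ Cc ci.
by rewrite ExZ mul0r.
Qed.

(* Fatou: the cylinders [w M = t] are countably many, and each finite sum of them
   is controlled by the limit of the finite models. *)
Lemma event_le M C (c : R) :
  (forall e : R, 0 < e -> \forall k \near \oo,
     ag_prob alpha gamma D k (fun T => C (trunc M T)) <= c + e) ->
  (P [set w : Omega | C (w M)] <= c%:E)%E.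
Proof.
move=> H; have /andP[_ eta_le1] := ag_eta_itv alpha01 gamma01 D3.
rewrite FU measure_bigcup; last 2 first.
- by move=> i _; exact: mF.
- by move=> i j _ _ [w [/= [_ <-] [_ <-]]].
apply: lime_le; first by apply: is_cvg_nneseries => i _ _; exact: measure_ge0.
apply: nearW => N.
have E i : P (F M C i) = (fine (P (F M C i)))%:E.
  by rewrite fineK// fin_num_measure.
rewrite (eq_big predT (fun i => (fine (P (F M C i)))%:E)) => [|i|i _]; last 2 first.
- by rewrite in_setT.
- by rewrite -E.
rewrite sumEFin lee_fin; apply/ler_addgt0Pr => e e0.
pose u i k := ag_prob alpha gamma D k
  (fun T => C (trunc M T) /\ ptree_rank (trunc M T) = i).
apply: (@ler_cvg_to _ \oo _ _ (fun k => \sum_(0 <= i < N) u i k)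
  (fun=> c + e)).
- by apply: cvg_sumn => i; exact: F_lim.
- exact: cvg_cst.
have [K _ HK] := H e e0; exists K => //= k Kk; apply: le_trans (HK k Kk).
rewrite /u !ag_probE//; under eq_bigr do rewrite ag_probE//.
rewrite -Ex_sum; apply: Ex_le => // c' _.
set T := trunc M _; case: (asboolP (C T)) => CT; last first.
  by rewrite big1// => i _; case: asboolP => // -[].
have [TN|TN] := ltnP (ptree_rank T) N.
  rewrite (bigD1_seq (ptree_rank T)) ?mem_index_iota ?iota_uniq//=.
  rewrite big1 ?addr0; last by move=> i iT; case: asboolP => // -[_] /esym/eqP; rewrite (negbTE iT).
  by case: asboolP.
rewrite big_nat_cond big1// => i /andP[/andP[_ iN] _]; case: asboolP => // -[_] Ti.
by move: TN; rewrite Ti leqNgt iN.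
Qed.

End LimitEvents.

(** Borel-Cantelli, with bounds in telescoping form: their partial sums are [C - C / N.+1]. *)
Lemma ae_eventually (R : realType) (P : probability Omega R) (B : nat -> set Omega) (C : R) :
  (forall j, measurable (B j)) ->
  (forall j, (P (B j) <= (C / (j.+1%:R * j.+2%:R))%:E)%E) ->
  {ae P, forall w, exists J, forall j, (J <= j)%N -> ~ B j w}.
Proof.
move=> mB PB.
have mL : measurable (lim_sup_set B).
  by apply: bigcap_measurable => // k _; exact: bigcup_measurable.
have L0 : P (lim_sup_set B) = 0%E.
  apply: lim_sup_set_cvg0 => //; apply: (@le_lt_trans _ _ C%:E); last exact: ltry.
  have C0 : 0 <= C.
    have := le_trans (measure_ge0 P (B 0%N)) (PB 0%N); rewrite lee_fin.
    by rewrite pmulr_lge0// invr_gt0 mulr_gt0.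
  apply: lime_le; first by apply: is_cvg_nneseries => i _ _; exact: measure_ge0.
  apply: nearW => N.
  apply: (@le_trans _ _ (\sum_(0 <= i < N) (C / (i.+1%:R * i.+2%:R))%:E)%E).
    by apply: lee_sum => i _; exact: PB.
  rewrite sumEFin lee_fin big_mkord.
  suff -> : \sum_(i < N) C / (i.+1%:R * i.+2%:R) = C - C / N.+1%:R.
    by rewrite gerBl divr_ge0.
  elim: N => [|N IH]; first by rewrite big_ord0 divr1 subrr.
  rewrite big_ord_recr IH /=.
  have : N.+2%:R != 0 :> R by rewrite pnatr_eq0.
  have : N.+1%:R != 0 :> R by rewrite pnatr_eq0.
  rewrite -[N.+2%:R]natr1; set x := N.+1%:R; clearbody x => x0 x1.
  by field; rewrite x0 x1.
exists (lim_sup_set B); split => // w /= nw k _ /=.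
have [[j kj Bj]|nj] := pselect (exists2 j, (k <= j)%N & B j w); first by exists j.
by exfalso; apply: nw; exists k => j kj Bj; apply: nj; exists j.
Qed.

(** * Balls and marked vertices *)

Lemma trunc_id n c : (nvert c <= n)%N -> trunc n c = c.
Proof.
elim: n c => [|n IH] [s] //= cn; congr Node.
rewrite -[RHS]map_id; apply/eq_in_map => d ds; apply: IH.
have := nvert_child ds; rewrite /=; lia.
Qed.

Lemma trunc_trunc m n c : (m <= n)%N -> trunc m (trunc n c) = trunc m c.
Proof.
elim: m n c => [|m IH] [|n] [s] //= mn; congr Node.
by rewrite -map_comp; apply/eq_map => d /=; exact: IH.
Qed.

Lemma nvert_trunc n s :
  nvert (trunc n.+1 (Node s)) = (\sum_(d <- s) nvert (trunc n d)).+1.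
Proof. by rewrite [trunc _ _]/= nvert_Node big_map. Qed.

Lemma nvert_trunc_le n c : (nvert (trunc n c) <= nvert c)%N.
Proof.
elim: n c => [|n IH] [s] //; rewrite nvert_trunc nvert_Node ltnS.
by apply: leq_sum => d _.
Qed.

Definition sibs (d : ptree) (s : seq ptree) : seq ptree := rem d s.

Lemma big_sibs (V : nmodType) (F : ptree -> V) d (s : seq ptree) : d \in s ->
  \sum_(e <- s) F e = F d + \sum_(e <- sibs d s) F e.
Proof. by move=> ds; rewrite (big_rem d ds). Qed.

Lemma big_sibs_nat (F : ptree -> nat) d (s : seq ptree) : d \in s ->
  (\sum_(e <- s) F e = F d + \sum_(e <- sibs d s) F e)%N.
Proof. exact: big_sibs. Qed.

Lemma perm_sibs_map (f : ptree -> ptree) d (s : seq ptree) : d \in s ->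
  perm_eq (sibs (f d) (map f s)) (map f (sibs d s)).
Proof.
move=> ds; rewrite -(perm_cons (f d)) perm_sym.
apply: (@perm_trans _ (map f s)); last exact: perm_to_rem (map_f f ds).
by rewrite perm_sym; exact: perm_map (perm_to_rem ds).
Qed.

Lemma spineP pad r s (p : nat * nat) :
  reflect (exists (d : ptree) (q : nat * nat), [/\ d \in s, q \in spine pad r d
     & p = (1 + \sum_(e <- sibs d s) nvert e + q.1,
            1 + \sum_(e <- sibs d s) (hgt e + nvert e) + pad + q.2)%N])
   (p \in spine pad r.+1 (Node s)).
Proof.
have E d : d \in s ->
   (nvert (Node s) - nvert d = 1 + \sum_(e <- sibs d s) nvert e)%N /\
   (hgt (Node s) - hgt d - nvert d = 1 + \sum_(e <- sibs d s) (hgt e + nvert e))%N.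
  by move=> ds; rewrite nvert_Node hgt_Node !(big_sibs_nat _ ds); lia.
apply: (iffP flatten_mapP) => [[d ds /mapP[q qd ->]]|[d [q [ds qd ->]]]].
  by exists d, q; split => //; have [-> ->] := E d ds.
by exists d => //; apply/mapP; exists q => //; have [-> ->] := E d ds.
Qed.

(** A sibling subtree with few edges is also low, so truncation leaves it intact. *)
Lemma spine_trunc pad r K M c (p : nat * nat) : (r <= M)%N -> (K <= M)%N -> (p.1 <= K)%N ->
  p \in spine pad r c -> p \in spine pad r (trunc M c).
Proof.
elim: r K M c p => [//|r IH] K [//|M] [s] p rM KM pK /spineP[d [q [ds qd pE]]].
have rd e : e \in sibs d s -> trunc M e = e.
  move=> es; apply: trunc_id; move: pK; rewrite pE /= (big_sibs_nat nvert es); lia.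
apply/spineP; exists (trunc M d), q; split; first exact: map_f.
  by apply: (IH M) => //; move: pK; rewrite pE /=; lia.
have pm := perm_sibs_map (trunc M) ds.
rewrite (_ : map _ (sibs d s) = sibs d s) in pm; last first.
  by rewrite -[RHS]map_id; apply/eq_in_map.
by rewrite !(perm_big _ pm).
Qed.

(** Cutting at [r] leaves of the subtree at the marked vertex only the edge above it, which is the
    successor. *)
Lemma spine_ball_le pad r c (p : nat * nat) : p \in spine pad r c ->
  (nvert (trunc r c) <= p.1.+1)%N.
Proof.
elim: r c p => [|r IH] [s] p; first by rewrite inE => /eqP->.
move=> /spineP[d [q [ds qd ->]]]; rewrite nvert_trunc (big_sibs_nat _ ds) /=.
have := IH d q qd.
have : (\sum_(e <- sibs d s) nvert (trunc r e) <= \sum_(e <- sibs d s) nvert e)%N.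
  by apply: leq_sum => e _; exact: nvert_trunc_le.
lia.
Qed.

(** Each edge removed by the truncation contributes at least [A] to the height. *)
Lemma hgt_trunc A c : (A * nvert c <= hgt c + A * nvert (trunc A c))%N.
Proof.
elim: A c => [//|A IH] [s]; rewrite nvert_trunc nvert_Node hgt_Node.
have : (\sum_(d <- s) A * nvert d <=
        \sum_(d <- s) hgt d + \sum_(d <- s) A * nvert (trunc A d))%N.
  by rewrite -big_split /=; apply: leq_sum => d _; exact: IH.
rewrite big_split /= -!big_distrr /=.
set a := \sum_(i <- s) nvert i; set b := \sum_(i <- s) hgt i; set c := \sum_(i <- s) nvert _.
nia.
Qed.

(** The same count for outer edges. Between two levels [A] changes by one, which costs one unit for
    each of the [q.1] outer edges further up; the summand [pad] of the height pays for it. *)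
Lemma spine_ball_ge pad r c (p : nat * nat) A : p \in spine pad r c -> (p.1 <= pad)%N ->
  (A * p.1 <= p.2 + A * nvert (trunc A c))%N.
Proof.
elim: A r c p => [//|A IH] [|r] [s] p.
  by rewrite inE => /eqP-> _; rewrite muln0.
move=> /spineP[d [q [ds qd ->]]]; rewrite nvert_trunc (big_sibs_nat _ ds) /= => pad1.
have := IH r d q qd ltac:(lia).
have : (\sum_(e <- sibs d s) A * nvert e <=
   \sum_(e <- sibs d s) hgt e + \sum_(e <- sibs d s) A * nvert (trunc A e))%N.
  by rewrite -big_split /=; apply: leq_sum => e _; exact: hgt_trunc.
rewrite big_split /= -!big_distrr /=.
set a := \sum_(i <- _) nvert i; set b := \sum_(i <- _) hgt i.
set e := \sum_(i <- _) nvert _; nia.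
Qed.

(** * Bounds for the effective conductance *)

Section Sigma.
Context (R : realType) (x : R).
Hypothesis x01 : 0 < x < 1.

(* For the walk killed so that its weight after [n] steps is [(1 - x) ^+ (n / 2)],
   [1 - escape t] is [Num.sqrt (1 - x)] times the generating function of the hitting
   time of the parent of [t]. It follows the series and parallel laws of an
   electric network, each vertex having a leak [x]. *)
Fixpoint escape (t : ptree) : R :=
  let: Node s := t in
  let S := foldr +%R 0 (map escape s) in (x + S) / (1 + S).

Lemma escapeE s : escape (Node s) =
  (x + \sum_(d <- s) escape d) / (1 + \sum_(d <- s) escape d).
Proof. by rewrite /= foldrE big_map. Qed.

Lemma escape_itv t : 0 < escape t <= 1.
Proof.
have /andP[x0 x1] := x01.
elim/ptree_ind_in: t => s IH; rewrite escapeE.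
have S0 : 0 <= \sum_(d <- s) escape d.
  by rewrite big_seq; apply: sumr_ge0 => d /IH /andP[/ltW].
apply/andP; split; first by rewrite divr_gt0//; lra.
by rewrite ler_pdivrMr; lra.
Qed.

Lemma sum_escape_ge0 (s : seq ptree) : 0 <= \sum_(d <- s) escape d.
Proof. by apply: sumr_ge0 => d _; case/andP: (escape_itv d) => /ltW. Qed.

(** Shorting all edges leaves the leaks in parallel. *)
Lemma escape_le t : escape t <= x * (nvert t)%:R.
Proof.
have /andP[x0 x1] := x01.
elim/ptree_ind_in: t => s IH; rewrite escapeE nvert_Node -natr1 natr_sum mulrDr mulr1 mulr_sumr.
have S0 := sum_escape_ge0 s.
have H : \sum_(d <- s) escape d <= \sum_(d <- s) x * (nvert d)%:R.
  by rewrite !big_seq; apply: ler_sum.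
rewrite ler_pdivrMr; last by lra.
set S := \sum_(d <- s) escape d in S0 H *; set U := \sum_(d <- s) _ in H *.
have : 0 <= (U + x) * S by apply: mulr_ge0; lra.
lra.
Qed.

(** Grounding the marked vertex turns the path to it into [r.+1] unit resistors in series, and each
    outer vertex adds a leak of at most [x]. The identity [E] is the series law. *)
Lemma escape_spine pad r c (p : nat * nat) : p \in spine pad r c ->
  escape c <= x * p.1%:R + r.+1%:R^-1.
Proof.
have /andP[x0 x1] := x01.
elim: r c p => [|r IH] [s] p.
  by rewrite inE => /eqP-> /=; rewrite mulr0 add0r invr1; case/andP: (escape_itv (Node s)).
move=> /spineP[d [q [ds qd ->]]]; rewrite escapeE (big_sibs _ ds) /=.
have H := IH d q qd.
have S0 := sum_escape_ge0 (sibs d s).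
have HU : \sum_(e <- sibs d s) escape e <= x * (\sum_(e <- sibs d s) nvert e)%:R.
  by rewrite natr_sum mulr_sumr; apply: ler_sum => e _; exact: escape_le.
have /andP[sd0 _] := escape_itv d.
rewrite !natrD; set S := \sum_(e <- sibs d s) escape e in S0 HU *.
set N := (\sum_(e <- _) _)%:R in HU *.
have r0 : (0 : R) < r.+1%:R by rewrite ltr0n.
have q0 : 0 <= x * q.1%:R by rewrite mulr_ge0// ltW.
have m0 : 0 < r.+1%:R^-1 :> R by rewrite invr_gt0.
have E : r.+2%:R^-1 = r.+1%:R^-1 / (1 + r.+1%:R^-1) :> R.
  rewrite -[r.+2%:R]natr1; set z := r.+1%:R in r0 *; clearbody z.
  by field; rewrite ?gt_eqF//; lra.
rewrite E; set m := r.+1%:R^-1 in H m0 *; clearbody m.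
have -> : x * (1 + N + q.1%:R) = x * (1 + N) + x * q.1%:R by ring.
set a := x * q.1%:R in H q0 *; clearbody a.
rewrite ler_pdivrMr; last by lra.
have step1 : m / (1 + m) * (1 + (escape d + S)) >= (escape d - a) - 0.
  rewrite subr0 mulrAC ler_pdivlMr; last by lra.
  have : 0 <= (1 + m) * a by apply: mulr_ge0; lra.
  have : 0 <= m * S by apply: mulr_ge0; lra.
  nra.
have t0 : 0 <= x * N by apply: mulr_ge0; [exact: ltW|rewrite ler0n].
have t1 : 0 <= x * (1 + N) + a by lra.
have t2 : 0 <= (x * (1 + N) + a) * (escape d + S) by apply: mulr_ge0; lra.
rewrite [X in _ <= X]mulrDl.
lra.
Qed.

(** With [V] vertices in the ball, this says that the resistance is at most [A.+1 + 1 / (x * V)]: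
    their leaks all lie behind at most [A.+1] unit resistors. The product form passes through the
    induction without division. *)
Lemma escape_ge A c : x * (nvert (trunc A c))%:R <=
  escape c * (1 + A.+1%:R * (x * (nvert (trunc A c))%:R)).
Proof.
have /andP[x0 x1] := x01.
elim: A c => [|A IH] [s].
  rewrite /= mulr1 mul1r foldrE big_map -mulrAC ler_pdivlMr; last first.
    by have := sum_escape_ge0 s; lra.
  have S0 := sum_escape_ge0 s; set S := \sum_(d <- s) _ in S0 *.
  have : 0 <= S * 1 by lra.
  nra.
rewrite nvert_trunc -natr1 natr_sum escapeE.
have S0 := sum_escape_ge0 s; set S := \sum_(d <- s) escape d in S0 *.
set U := \sum_(d <- s) _.
have U0 : 0 <= U by apply: sumr_ge0.
have H : x * U <= S * (1 + A.+1%:R * (x * U)).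
  rewrite [X in X <= _](_ : _ = \sum_(d <- s) x * (nvert (trunc A d))%:R); last by rewrite mulr_sumr.
  rewrite /S mulr_suml [X in X <= _]big_seq [X in _ <= X]big_seq.
  apply: ler_sum => d ds; apply: (le_trans (IH d)).
  apply: ler_wpM2l; first by case/andP: (escape_itv d) => /ltW.
  rewrite lerD2l; apply: ler_wpM2l => //. apply: ler_wpM2l; first exact: ltW.
  by rewrite /U (big_sibs _ ds) lerDl sumr_ge0.
rewrite mulrAC ler_pdivlMr; last by lra.
have a0 : (0 : R) < A.+1%:R by rewrite ltr0n.
rewrite -[A.+2%:R]natr1; set a := A.+1%:R in a0 H *; clearbody a.
have : 0 <= x * U by apply: mulr_ge0 => //; exact: ltW.
have -> : x * (U + 1) = x * U + x by ring.
set u := x * U in H *; clearbody u => u0.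
have : 0 <= (u + x) * ((a + 1) * x) by apply: mulr_ge0; [lra|apply: mulr_ge0; lra].
have : 0 <= x * (a * S) by apply: mulr_ge0; [lra|apply: mulr_ge0; lra].
lra.
Qed.

End Sigma.

(** * Simple random walk *)

Lemma subtree_rcons t a i : subtree t (rcons a i) =
  if subtree t a is Some (Node s) then
    if (i < size s)%N then Some (nth leaf s i) else None
  else None.
Proof.
elim: a t => [|j a IH] [s] /=; first by case: ifP.
by case: ifP => // _; rewrite IH.
Qed.

Lemma nchildE t a s : subtree t a = Some (Node s) -> nchild t a = size s.
Proof. by rewrite /nchild => ->. Qed.

Lemma subtree_trunc M t a : (size a <= M)%N ->
  subtree (trunc M t) a = omap (trunc (M - size a)) (subtree t a).
Proof.
elim: a M t => [|i a IH] [|M] [s] //= aM.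
rewrite size_map; case: ifP => // iS.
by rewrite (nth_map leaf)// IH.
Qed.

Lemma nchild_trunc M t a : (size a < M)%N -> nchild (trunc M t) a = nchild t a.
Proof.
move=> aM; rewrite /nchild subtree_trunc ?(ltnW aM)//.
case: (subtree t a) => [[s]|//] /=.
have -> : (M - size a = (M - size a).-1.+1)%N by lia.
by rewrite /= size_map.
Qed.

Lemma walk_prob_trunc (R : realType) M t n a : (size a + n <= M)%N ->
  walk_prob (trunc M t) n a = walk_prob t n a :> R.
Proof.
elim: n a => [//|n IH] a aM /=.
have naM : nchild (trunc M t) a = nchild t a by apply: nchild_trunc; lia.
have -> : nbrs (trunc M t) a = nbrs t a by rewrite /nbrs naM.
rewrite !big_seq; apply: eq_bigr => u ua.
have sa : (size u <= (size a).+1)%N.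
  move: ua; rewrite mem_cat => /orP[|/mapP[i _ ->]]; last by rewrite size_rcons.
  case: (a) => // b a'; rewrite inE => /eqP ->.
  by rewrite size_take_min (leq_trans (geq_minr _ _)).
(* At the last step [u] may lie on the boundary of the ball, where truncation changes the degree;
   there the walk probability vanishes unless [u] is the root. *)
case: n IH aM => [|n] IH aM.
  by rewrite /=; case: eqP => [->|_]; rewrite ?mul0r// /degree nchild_trunc//=; lia.
rewrite IH; last by apply: leq_trans aM; rewrite [X in (_ <= X)%N]addnS -addSn leq_add2r.
rewrite /degree nchild_trunc//; apply: leq_trans aM.
by rewrite !addnS ltnS (leq_trans sa)// ltnS leq_addr.
Qed.

Lemma nbrs_rcons t a i : nbrs t (rcons a i) =
  a :: [seq rcons (rcons a i) j | j <- iota 0 (nchild t (rcons a i))].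
Proof.
have H b : b != [::] -> nbrs t b =
   take (size b).-1 b :: [seq rcons b j | j <- iota 0 (nchild t b)] by case: b.
by rewrite H ?size_rcons -?cats1 ?take_size_cat//; case: (a).
Qed.

Lemma size_nbrs t a : size (nbrs t a) = degree t a.
Proof.
by rewrite /nbrs size_cat size_map size_iota /degree addnC; case: a.
Qed.

Section Walk.
Context (R : realType) (x : R) (c0 : ptree).
Hypothesis x01 : 0 < x < 1.
Let T := Node [:: c0].
Let y := Num.sqrt (1 - x).
Local Notation escape := (escape x).

Let y0 : 0 < y. Proof. by rewrite sqrtr_gt0; case/andP: x01; lra. Qed.
Let yy : y * y = 1 - x.
Proof. by rewrite -expr2 sqr_sqrtr//; case/andP: x01; lra. Qed.

Let g t : R := (1 - escape t) / y.

Let gE s : g (Node s) = y / (1 + \sum_(d <- s) escape d).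
Proof.
have S0 := sum_escape_ge0 x01 s; rewrite /g escapeE.
set S := \sum_(d <- s) _ in S0 *.
apply: (mulIf (lt0r_neq0 y0)); rewrite divfK ?lt0r_neq0// mulrAC yy.
by field; rewrite lt0r_neq0//; lra.
Qed.

Let g01 t : 0 < g t <= 1.
Proof.
case: t => s; rewrite gE; have S0 := sum_escape_ge0 x01 s.
apply/andP; split; first by rewrite divr_gt0//; lra.
rewrite ler_pdivrMr; last by lra.
have : y <= 1 by rewrite -sqrtr1 ler_sqrt//; case/andP: x01; lra.
lra.
Qed.

(** For [v = (escape c0)^-1] and [t = T] this is, by reversibility, the Green function of the
    discounted walk from the root to [a] divided by the degree of [a]: its value at the root times
    the hitting generating functions [g] along the path. *)
Fixpoint green (v : R) (t : ptree) (a : seq nat) : R :=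
  if a is i :: a' then
    let d := nth leaf (children t) i in green (v * g d) d a'
  else v.

Lemma green_rcons v t a i s : subtree t a = Some (Node s) ->
  green v t (rcons a i) = green v t a * g (nth leaf s i).
Proof.
elim: a v t => [|j a IH] v [s'] /=; first by move=> [->].
by case: ifP => // _; exact: IH.
Qed.

Let Phi := green (escape c0)^-1 T.

Lemma green_itv v t a : 0 <= v -> 0 <= green v t a <= v.
Proof.
elim: a v t => [|i a IH] v t v0 /=; first by rewrite v0 lexx.
have /andP[gp gl] := g01 (nth leaf (children t) i).
have /andP[-> /le_trans-> //] := IH (v * g (nth leaf (children t) i))
  (nth leaf (children t) i) (mulr_ge0 v0 (ltW gp)).
by rewrite -[X in _ <= X]mulr1 ler_wpM2l.
Qed.

Lemma Phi_itv a : 0 <= Phi a <= (escape c0)^-1.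
Proof.
by apply: green_itv; rewrite invr_ge0 ltW//; case/andP: (escape_itv x01 c0).
Qed.

Let valid a := subtree T a != None.

Lemma valid_nbrs a u : valid a -> u \in nbrs T a -> valid u.
Proof.
rewrite /valid; case E : (subtree T a) => [[s]|//] _.
have children_valid : u \in [seq rcons a j | j <- iota 0 (nchild T a)] -> subtree T u != None.
  move=> /mapP[j]; rewrite mem_iota add0n (nchildE E) => /= js ->.
  by rewrite subtree_rcons E js.
case/lastP: a E children_valid => [//|a i] E H.
rewrite nbrs_rcons inE => /orP[/eqP ->|//].
by move: E; rewrite subtree_rcons; case: (subtree T a).
Qed.

Lemma degree_gt0 a : valid a -> (0 < degree T a)%N.
Proof. by case: a => [|i a] _ //; rewrite /degree addn1. Qed.

Lemma Phi_harmonic a : valid a ->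
  (degree T a)%:R * Phi a = (a == [::])%:R + y * \sum_(u <- nbrs T a) Phi u.
Proof.
rewrite /valid; case E : (subtree T a) => [[s]|//] _.
have chE : \sum_(u <- [seq rcons a j | j <- iota 0 (nchild T a)]) Phi u
   = Phi a * \sum_(d <- s) g d.
  rewrite big_map (nchildE E) (big_nth leaf) mulr_sumr.
  rewrite /index_iota subn0.
  by apply: eq_bigr => j _; rewrite /Phi (green_rcons _ _ E).
have yg d : y * g d = 1 - escape d by rewrite /g mulrC divfK// lt0r_neq0.
case/lastP: a E chE => [|a i] E chE.
  rewrite /nbrs cat0s chE; move: E => [<-]; rewrite big_seq1 /degree /nchild /= addn0.
  rewrite mul1r mulrCA yg /Phi /=.
  have /andP[s0 _] := escape_itv x01 c0.
  by field; rewrite lt0r_neq0.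
rewrite nbrs_rcons big_cons chE /degree (nchildE E).
move: (E); rewrite subtree_rcons; case Ea : (subtree T a) => [[s']|//].
case: ifP => // _ [sE].
have -> : Phi (rcons a i) = Phi a * g (Node s) by rewrite /Phi (green_rcons _ _ Ea) sE.
have -> : (rcons a i != [::]) = true by case: (a).
have -> : (rcons a i == [::]) = false by case: (a).
have sumyg : y * \sum_(d <- s) g d = (size s)%:R - \sum_(d <- s) escape d.
  rewrite mulr_sumr (eq_bigr (fun d => 1 - escape d)) => [|d _]; last by rewrite yg.
  by rewrite sumrB big_const_seq count_predT iter_addr_0.
have S0 := sum_escape_ge0 x01 s.
transitivity (Phi a * y + Phi a * g (Node s) * (y * \sum_(d <- s) g d)); last by rewrite mulr0n; ring.
rewrite sumyg gE natrD [nat_of_bool true]/=; set S := \sum_(d <- s) escape d in S0 *.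
by field; rewrite lt0r_neq0//; lra.
Qed.

Let h n a : R := walk_prob T n a / (degree T a)%:R.

Let hS n a : h n.+1 a = (\sum_(u <- nbrs T a) h n u) / (degree T a)%:R.
Proof. by []. Qed.

(** The remainder after [N] terms satisfies [Phi_harmonic] without the source at the root, so each
    further step gains a factor [y]. *)
Lemma Phi_walk N a : valid a ->
  0 <= Phi a - \sum_(n < N) y ^+ n * h n a <= y ^+ N * (escape c0)^-1.
Proof.
elim: N a => [|N IH] a va.
  by rewrite big_ord0 subr0 expr0 mul1r Phi_itv.
have d0 : (0 : R) < (degree T a)%:R by rewrite ltr0n degree_gt0.
have -> : Phi a - \sum_(n < N.+1) y ^+ n * h n a =
   (y / (degree T a)%:R) * \sum_(u <- nbrs T a) (Phi u - \sum_(n < N) y ^+ n * h n u).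
  have E : \sum_(n < N.+1) y ^+ n * h n a =
     (a == [::])%:R / (degree T a)%:R + y / (degree T a)%:R *
       \sum_(u <- nbrs T a) \sum_(n < N) y ^+ n * h n u.
    rewrite big_ord_recl expr0 mul1r exchange_big mulr_sumr; congr (_ + _).
    apply: eq_bigr => n _; rewrite lift0 hS exprS -mulr_sumr.
    by set X := \sum_(_ <- _) _; clearbody X; field; exact: lt0r_neq0.
  rewrite E sumrB -[Phi a](mulKf (lt0r_neq0 d0)) (Phi_harmonic va).
  by field; exact: lt0r_neq0.
have Hsum : 0 <= \sum_(u <- nbrs T a) (Phi u - \sum_(n < N) y ^+ n * h n u)
   <= (degree T a)%:R * (y ^+ N * (escape c0)^-1).
  rewrite big_seq -size_nbrs; apply/andP; split.
    by apply: sumr_ge0 => u /(valid_nbrs va)/IH /andP[].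
  rewrite mulr_natl -iter_addr_0 -[X in iter X](count_predT (nbrs T a)) -big_const_seq.
  by rewrite [X in _ <= X]big_seq; apply: ler_sum => u /(valid_nbrs va)/IH /andP[].
have /andP[h0 h1] := Hsum.
have yd : 0 <= y / (degree T a)%:R by rewrite divr_ge0// ltW.
apply/andP; split; first exact: mulr_ge0.
apply: (le_trans (ler_wpM2l yd h1)).
by rewrite -[y / _ * _]mulrA mulKf ?lt0r_neq0// mulrA -exprS.
Qed.

Lemma walk_escape N :
  0 <= (escape c0)^-1 - \sum_(n < N) walk_prob T n [::] * y ^+ n <= y ^+ N * (escape c0)^-1.
Proof.
have := @Phi_walk N [::] isT; rewrite [Phi [::]]/=.
have -> // : \sum_(n < N) y ^+ n * h n [::] = \sum_(n < N) walk_prob T n [::] * y ^+ n.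
by apply: eq_bigr => n _; rewrite /h /degree /nchild /= divr1 mulrC.
Qed.

End Walk.

Section Resolvent.
Context (R : realType) (x : R).
Hypothesis x01 : 0 < x < 1.
Let y := Num.sqrt (1 - x).

Let y0 : 0 < y. Proof. by rewrite sqrtr_gt0; case/andP: x01; lra. Qed.
Let y1 : y < 1.
Proof. by rewrite -sqrtr1 ltr_sqrt//; case/andP: x01; lra. Qed.

Lemma consistent_trunc w m n : consistent w -> (m <= n)%N -> w m = trunc m (w n).
Proof.
move=> cw; have idem n' : trunc n' (w n') = w n' by rewrite cw trunc_trunc.
elim: n => [|n IH]; first by rewrite leqn0 => /eqP ->; rewrite idem.
rewrite leq_eqVlt => /orP[/eqP ->|mn]; first by rewrite idem.
by rewrite IH// (cw n) trunc_trunc.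
Qed.

Lemma return_prob_trunc w n N : consistent w -> (n <= N)%N ->
  return_prob w n = walk_prob (w N) n [::] :> R.
Proof.
move=> cw nN; rewrite /return_prob (consistent_trunc cw nN).
by rewrite walk_prob_trunc.
Qed.

Lemma return_prob_ge0 w n : 0 <= return_prob w n :> R.
Proof.
rewrite /return_prob; move: [::] (w n) => a t; elim: n a => [|n IH] a //=.
by apply: sumr_ge0 => u _; rewrite divr_ge0.
Qed.

Let psum w N : (\sum_(0 <= n < N) ((return_prob w n : R) * y ^+ n)%:E)%E
   = (\sum_(n < N) (return_prob w n : R) * y ^+ n)%:E.
Proof. by rewrite sumEFin big_mkord. Qed.

Lemma Qtau_le w (B : R) : consistent w ->
  (forall N, exists2 M, (N <= M)%N &
     exists2 c, w M = Node [:: c] & (escape x c)^-1 <= B) ->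
  (Qtau w x <= B%:E)%E.
Proof.
move=> cw HB; apply: lime_le.
  by apply: is_cvg_nneseries => n _ _; rewrite lee_fin mulr_ge0 ?return_prob_ge0// exprn_ge0 ?ltW.
apply: nearW => N; rewrite psum lee_fin.
have [M NM [c wM cB]] := HB N; apply: le_trans cB.
rewrite (eq_bigr (fun n : 'I_N => walk_prob (Node [:: c]) n [::] * y ^+ n)).
  by have /andP[] := walk_escape c x01 N; rewrite subr_ge0.
move=> n _; rewrite (return_prob_trunc cw (leq_trans (ltnW (ltn_ord n)) NM)).
by rewrite wM.
Qed.

(** Once [y ^+ N <= 2^-1], the partial sum has reached half of the inverse of [escape]; hence the
    factor 2. *)
Lemma Qtau_ge w (B : R) : consistent w -> 0 < B ->
  (exists M0, forall M, (M0 <= M)%N ->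
     exists2 c, w M = Node [:: c] & escape x c <= B) ->
  (((2 * B)^-1)%:E <= Qtau w x)%E.
Proof.
move=> cw B0 [M0 HB].
have [N0 _ HN0] : \forall N \near \oo, `|0 - y ^+ N| <= 2^-1.
  have yn : `|y| < 1 by rewrite gtr0_norm.
  by have /cvgrPdist_le := cvg_expr yn; apply; rewrite invr_gt0.
pose N := maxn N0 M0.
have HN : y ^+ N <= 2^-1.
  by have := HN0 N (leq_maxl _ _); rewrite /= sub0r normrN ger0_norm// exprn_ge0// ltW.
have [c wN cB] := HB N (leq_maxr _ _).
have /andP[s0 _] := escape_itv x01 c.
apply: (@le_trans _ _ (\sum_(0 <= n < N) ((return_prob w n : R) * y ^+ n)%:E)%E).
  rewrite psum lee_fin.
  rewrite (eq_bigr (fun n : 'I_N => walk_prob (Node [:: c]) n [::] * y ^+ n)); last first.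
    by move=> n _; rewrite (return_prob_trunc cw (ltnW (ltn_ord n))) wN.
  have /andP[_] := walk_escape c x01 N; rewrite -/y => H.
  have H2 : y ^+ N * (escape x c)^-1 <= 2^-1 * (escape x c)^-1.
    by apply: ler_wpM2r => //; rewrite invr_ge0 ltW.
  have H3 : B^-1 <= (escape x c)^-1 by rewrite lef_pV2 ?posrE.
  rewrite invfM; lra.
apply: nneseries_lim_ge => n _ _.
by rewrite lee_fin mulr_ge0 ?return_prob_ge0// exprn_ge0 ?ltW.
Qed.

End Resolvent.

(** * Probability estimates *)

(* Some vertex at distance [r] has between [K'.+1] and [K] edges outside its subtree,
   with total height at most [L]. *)
Definition good (r K' K L : nat) (c : ptree) : bool :=
  has (fun p => (K' < p.1 <= K)%N && (p.2 <= L)%N) (spine K r c).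

Lemma good_trunc r K' K L M c : (r <= M)%N -> (K <= M)%N ->
  good r K' K L c -> good r K' K L (trunc M c).
Proof.
move=> rM KM /hasP[p pc /andP[/andP[K'p pK] pL]]; apply/hasP; exists p.
  exact: (@spine_trunc _ _ K).
by rewrite K'p pK pL.
Qed.

Section BadEvent.
Context (R : realType).

Lemma spine_count_ge0 pad r K c : 0 <= spine_count pad r K c :> R.
Proof. exact: sumr_ge0. Qed.

Lemma spine_heights_ge0 pad r K c : 0 <= spine_heights pad r K c :> R.
Proof. by apply: sumr_ge0 => p _; rewrite mulr_ge0. Qed.

(** Vertices at the same distance have disjoint subtrees, and a vertex with at most [K] outer edges
    carries more than half of the tree. *)
Lemma spine_count_le1 pad r K c : (2 * K < nvert c)%N -> spine_count pad r K c <= 1 :> R.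
Proof.
elim: r K c => [|r IH] K [s] Kc; first by rewrite /spine_count big_seq1.
rewrite /spine_count big_spineS.
pose Y d := (nvert (Node s) - nvert d)%N.
have far d : (K < Y d)%N -> \sum_(p <- spine pad r d) (Y d + p.1 <= K)%N%:R = 0 :> R.
  move=> KY; apply: big1 => p _; rewrite leqNgt (leq_trans KY) ?leq_addr//.
have [/hasP[d ds dK]|/hasPn nd] := boolP (has (fun d => (Y d <= K)%N) s); last first.
  by rewrite big_seq big1// => d /nd; rewrite -ltnNge => /far.
rewrite (big_sibs _ ds) /= [X in _ + X]big_seq [X in _ + X]big1 ?addr0 => [|e es].
  have dn := nvert_child ds.
  apply: le_trans (IH (K - Y d)%N d _); last by move: Kc dK dn; rewrite /Y; lia.
  by apply: ler_sum => p _; rewrite ler_nat -/(Y d); move: dK; case: leqP; case: leqP => //=; lia.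
apply: far; move: Kc dK; rewrite /Y nvert_Node (big_sibs_nat _ ds) (big_sibs_nat _ es).
lia.
Qed.

(** Goodness fails if no vertex has at most [K] outer edges, or one has at most [K'], or the height
    exceeds [L]; the last term is Markov's inequality. The bound is linear in the functionals, so
    that [Ex] can be taken term by term. *)
Lemma bad_bound r K' K L c : (2 * K < nvert c)%N -> (K' <= K)%N ->
  (~~ good r K' K L c)%:R <=
  1 + - 1 * spine_count K r K c + spine_count K r K' c + (L.+1%:R)^-1 * spine_heights K r K c :> R.
Proof.
move=> Kc K'K; have c0 := spine_count_ge0 K r K c; have c1 := spine_count_le1 K r Kc.
have c'0 := spine_count_ge0 K r K' c; have p0 := spine_heights_ge0 K r K c.
have Lp : 0 <= (L.+1%:R)^-1 * spine_heights K r K c :> R by apply: mulr_ge0.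
have XE : (L.+1%:R)^-1 * spine_heights K r K c = spine_heights K r K c / L.+1%:R :> R by rewrite mulrC.
set X := _^-1 * _ in Lp XE *; clearbody X.
have [g|] := boolP (good r K' K L c); first by rewrite [nat_of_bool _]/= mulr0n; lra.
move=> /hasPn ng; rewrite [nat_of_bool _]/= mulr1n.
have [/hasP[p pc pK']|/hasPn n1] := boolP (has (fun p : nat * nat => p.1 <= K')%N (spine K r c)).
  suff : (1 : R) <= spine_count K r K' c by lra.
  by rewrite /spine_count (big_rem p pc) /= pK' lerDl sumr_ge0.
have [/hasP[p pc pK]|/hasPn n2] := boolP (has (fun p : nat * nat => p.1 <= K)%N (spine K r c)); last first.
  suff : spine_count K r K c = 0 :> R by lra.
  by rewrite /spine_count big_seq big1// => p /n2/negbTE ->.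
suff : (1 : R) <= X by lra.
rewrite XE ler_pdivlMr// mul1r.
have := ng p pc; rewrite pK andbT ltnNge (n1 p pc) /= -ltnNge => pL.
rewrite /spine_heights (big_rem p pc) /= pK mul1r.
apply: (@le_trans _ _ p.2%:R); first by rewrite ler_nat.
by rewrite lerDl sumr_ge0// => q _; rewrite mulr_ge0.
Qed.

Context (alpha gamma : R) (D : option nat).
Hypothesis alpha01 : 0 < alpha <= 1.
Hypothesis gamma01 : 0 <= gamma <= 1.
Hypothesis D3 : if D is Some d then (3 <= d)%N else true.
Context (P : probability Omega R).
Hypothesis Hlim : forall (r : nat) (t : ptree),
     (fun k => (ag_prob alpha gamma D k (fun T => trunc r T = t))%:E) @ \oo
       --> P [set w : Omega | w r = t].
Local Notation q := (qlim alpha).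

Definition is_bad r K' K L (t : ptree) : Prop :=
  ~ exists2 c, t = Node [:: c] & good r K' K L c.

Lemma bad_event r K' K L M : (r <= M)%N -> (K <= M)%N -> (K' <= K)%N ->
  (P [set w : Omega | is_bad r K' K L (w M.+1)] <=
   (1 - q r K + q r K' + (4 * r * K)%:R / L.+1%:R)%:E)%E.
Proof.
move=> rM KM K'K; have eta01 := ag_eta_itv alpha01 gamma01 D3.
have /andP[_ eta1] := eta01.
apply: (@event_le _ alpha gamma D) => // e e0.
pose f k := Ex alpha gamma D k.+2 (fun c => 1 + - 1 * spine_count K r K c + spine_count K r K' c
   + (L.+1%:R)^-1 * spine_heights K r K c).
have shift2 (u : nat -> R) (l : R) : u @ \oo --> l -> (fun k => u k.+2) @ \oo --> l.
  rewrite -(cvg_shiftn 2) => H; apply: cvg_trans H; apply: near_eq_cvg.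
  by apply: nearW => k /=; rewrite addn2.
have fl : f @ \oo --> 1 + - 1 * q r K + q r K' + (L.+1%:R)^-1 * plim alpha gamma D K r K.
  have -> : f = fun k => 1 + - 1 * Ex alpha gamma D k.+2 (spine_count K r K)
      + Ex alpha gamma D k.+2 (spine_count K r K') + (L.+1%:R)^-1 * Ex alpha gamma D k.+2 (spine_heights K r K).
    by apply/funext => k; rewrite /f !(ExD, ExZ) Ex1.
  apply: cvgD; last by apply: cvgMl_tmp; apply: (shift2 (fun n => Ex alpha gamma D n _)); exact: spine_heights_lim.
  apply: cvgD; last by apply: (shift2 (fun n => Ex alpha gamma D n _)); exact: spine_count_lim.
  apply: cvgD; first exact: cvg_cst.
  by apply: cvgMl_tmp; apply: (shift2 (fun n => Ex alpha gamma D n _)); exact: spine_count_lim.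
have [N _ HN] : \forall k \near \oo,
   f k <= 1 - q r K + q r K' + (4 * r * K)%:R / L.+1%:R + e.
  move/cvgrPdist_le : fl => /(_ e e0)[N _ HN]; exists N => // k /HN /=.
  rewrite ler_distlC => /andP[_ /le_trans]; apply; rewrite lerD2r mulN1r lerD2l [X in X <= _]mulrC.
  rewrite ler_pM2r ?invr_gt0//; apply: (le_trans (plim_le alpha01 eta01 K r K)).
  by rewrite -natrM ler_nat; lia.
exists (N + 2 * K)%N => // k /= Nk; apply: le_trans (HN k _); last by rewrite /=; lia.
rewrite ag_probE//; apply: (@le_trans _ _ (Ex alpha gamma D k.+2
   (fun c => (~~ good r K' K L c)%:R))).
  apply: Ex_le => // c _; case: asboolP => //; case: (boolP (good _ _ _ _ c)) => // g b.
  by exfalso; apply: b; exists (trunc M c) => //; exact: good_trunc.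
(* [Ex_le] compares on all legal trees, but [bad_bound] holds on large ones. The factor inserted on
   both sides equals 1 at size [k.+2]. *)
rewrite /f (@Ex_ext _ _ _ _ _ _ (fun c => (2 * K < nvert c)%N%:R * (~~ good r K' K L c)%:R)).
  rewrite (@Ex_ext _ _ _ _ _ (fun c => 1 + - 1 * spine_count K r K c + spine_count K r K' c
   + (L.+1%:R)^-1 * spine_heights K r K c) (fun c => (2 * K < nvert c)%N%:R *
     (1 + - 1 * spine_count K r K c + spine_count K r K' c + (L.+1%:R)^-1 * spine_heights K r K c))).
    apply: Ex_le => // c _; case: ltnP => Kc; last by rewrite !mul0r.
    by rewrite !mul1r bad_bound.
  by move=> c cn; rewrite cn (_ : (_ < _)%N = true) ?mul1r//; lia.
by move=> c cn; rewrite cn (_ : (_ < _)%N = true) ?mul1r//; lia.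
Qed.

End BadEvent.

Lemma sum_harmonic_le (R : realType) n :
  \sum_(k < n.+1) (k.+1%:R)^-1 <= 1 + ln n.+1%:R :> R.
Proof.
elim: n => [|n IH]; first by rewrite big_ord1 ln1 invr1 addr0.
rewrite big_ord_recr /=; apply: (le_trans (lerD IH (lexx _))).
rewrite -addrA lerD2l.
have n1 : (0 : R) < n.+1%:R by rewrite ltr0n.
have n2 : (0 : R) < n.+2%:R by rewrite ltr0n.
have E : n.+1%:R = n.+2%:R * (1 + - (n.+2%:R)^-1) :> R.
  by rewrite mulrDr mulr1 mulrN divff ?gt_eqF// -[n.+2%:R]natr1 addrK.
have i1 : (n.+2%:R)^-1 < 1 :> R by rewrite invf_lt1// ltr1n.
rewrite [X in ln X + _]E lnM ?posrE ?subr_gt0//.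
have : ln (1 + - (n.+2%:R)^-1) <= - (n.+2%:R)^-1 :> R.
  by apply: le_ln1Dx; rewrite ltrN2.
set u := (n.+2%:R)^-1; set v := ln (1 - u); set t := ln _; clearbody u v t; lra.
Qed.

(** * Summable exceptional probabilities *)

Section Scales.
Context (R : realType) (alpha : R).
Hypothesis alpha01 : 0 < alpha <= 1.
Local Notation q := (qlim alpha).

(* At distance [2 ^ j] the number of outer edges has order [2 ^ (j / alpha)]; a factor
   polynomial in [j] on each side makes the exceptional probabilities
   summable. *)
Definition Kup (j : nat) : nat :=
  Num.trunc ((2 ^+ j * j.+1%:R ^+ 3) `^ alpha^-1).
Definition Klow (j : nat) : nat :=
  Num.trunc ((2 ^+ j / (2 * j.+1%:R ^+ 2)) `^ alpha^-1).
Definition Hmax (j : nat) : nat := (4 * 2 ^ j * j.+1 ^ 2 * Kup j)%N.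

Let a0 : 0 < alpha. Proof. by case/andP: alpha01. Qed.
Let J0 j : (0 : R) < j.+1%:R. Proof. by rewrite ltr0n. Qed.
Let J1 j : (1 : R) <= j.+1%:R. Proof. by rewrite ler1n. Qed.
Let p0 j : (0 : R) < 2 ^+ j. Proof. by rewrite exprn_gt0. Qed.
Let p1 j : (1 : R) <= 2 ^+ j. Proof. by rewrite exprn_ege1// ler1n. Qed.

Lemma powRVK (x : R) : 0 <= x -> (x `^ alpha^-1) `^ alpha = x.
Proof. by move=> x0; rewrite -powRrM mulVf ?gt_eqF// powRr1. Qed.

Lemma Kup_le j : (Kup j)%:R <= (2 ^+ j * j.+1%:R ^+ 3) `^ alpha^-1.
Proof. by rewrite truncn_le powR_ge0. Qed.

Lemma Klow_gt j : (2 ^+ j / (2 * j.+1%:R ^+ 2)) `^ alpha^-1 < (Klow j).+1%:R.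
Proof. exact: truncnS_gt. Qed.

Lemma Klow_Kup j : (Klow j <= Kup j)%N.
Proof.
have X0 : (0 : R) < 2 * j.+1%:R ^+ 2 by rewrite mulr_gt0// exprn_gt0.
have Y0 : 0 <= 2 ^+ j / (2 * j.+1%:R ^+ 2) :> R by rewrite divr_ge0 ?ltW.
have Z0 : 0 <= 2 ^+ j * j.+1%:R ^+ 3 :> R by rewrite mulr_ge0 ?ltW// exprn_gt0.
apply: le_truncn; apply: ge0_ler_powR => //; first by rewrite invr_ge0 ltW.
rewrite ler_pdivrMr// -mulrA -[X in X <= _]mulr1 ler_pM2l//.
have J3 : (1 : R) <= j.+1%:R ^+ 3 by rewrite exprn_ege1.
have J2 : (1 : R) <= j.+1%:R ^+ 2 by rewrite exprn_ege1.
rewrite -[X in X <= _]mulr1; apply: ler_pM => //; lra.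
Qed.

(* [(k + 1) ^ (- alpha) <= (K + 1) ^ (1 - alpha) / (k + 1)] for [k <= K], at the cost of a
   logarithm but uniformly up to [alpha = 1]. *)
Lemma upper_scale j : 1 - q (2 ^ j) (Kup j) <= (2 + 4 * alpha^-1) / j.+1%:R ^+ 2.
Proof.
set K := Kup j; set X : R := 2 ^+ j * j.+1%:R ^+ 3.
have X1 : 1 <= X by rewrite /X -[X in X <= _]mulr1 ler_pM// exprn_ege1.
have X0 : 0 < X by apply: lt_le_trans X1.
have K0 : (0 : R) < K.+1%:R by rewrite ltr0n.
have KX : X <= K.+1%:R `^ alpha.
  rewrite -[X in X <= _](powRVK (ltW X0)); apply: ge0_ler_powR; rewrite ?nnegrE ?powR_ge0 ?(ltW a0)//.
  exact/ltW/truncnS_gt.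
have KA0 : 0 < K.+1%:R `^ alpha :> R by rewrite powR_gt0.
have H1 : \sum_(k < K.+1) sib_tail alpha k <=
    K.+1%:R / K.+1%:R `^ alpha * \sum_(k < K.+1) (k.+1%:R)^-1.
  rewrite mulr_sumr; apply: ler_sum => k _; apply: (le_trans (sib_tail_le alpha01 k)).
  have k0 : (0 : R) < k.+1%:R by rewrite ltr0n.
  have E (x : R) : 0 < x -> x / x `^ alpha = x `^ (1 - alpha).
    move=> x0; have := @powRB R x 1 alpha.
    by rewrite (gt_eqF x0) implybT powRr1 ?(ltW x0)// => ->.
  rewrite -[X in X <= _]mulr1 -[X in _ * X <= _](divff (lt0r_neq0 k0)) mulrA ler_pM2r ?invr_gt0//.
  rewrite mulrC !E//; apply: ge0_ler_powR; rewrite ?nnegrE ?ler0n//.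
    by rewrite subr_ge0; case/andP: alpha01.
  by rewrite ler_nat ltn_ord.
have H2 : 1 + ln K.+1%:R <= (2 + 4 * alpha^-1) * j.+1%:R :> R.
  have L1 (x : R) : 0 < x -> ln x <= x - 1.
    move=> x0; have -> : ln x = ln (1 + (x - 1)) by congr ln; ring.
    by apply: le_ln1Dx; lra.
  have XA1 : 1 <= X `^ alpha^-1 by rewrite -(powRr0 X) ler_powR// invr_ge0 ltW.
  have KU : K.+1%:R <= 2 * X `^ alpha^-1.
    by rewrite -natr1; have := Kup_le j; rewrite -/K -/X; lra.
  have L2 : ln K.+1%:R <= 1 + alpha^-1 * (4 * j.+1%:R) :> R.
    apply: (@le_trans _ _ (ln (2 * X `^ alpha^-1))).
      by rewrite ler_ln ?posrE// mulr_gt0// powR_gt0.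
    rewrite lnM ?posrE ?powR_gt0// ln_powR; apply: lerD; first by apply: (le_trans (L1 _ _)) => //; lra.
    apply: ler_wpM2l; first by rewrite invr_ge0 ltW.
    rewrite /X lnM ?posrE ?exprn_gt0// !lnXn//.
    have l2 : ln 2 <= 1 :> R by apply: (le_trans (L1 _ _)) => //; lra.
    have lJ : ln j.+1%:R <= j.+1%:R :> R by apply: (le_trans (L1 _ _)) => //; lra.
    have : ln 2 *+ j <= j%:R :> R by rewrite -[X in _ <= X]mul1r -[ln 2 *+ j]mulr_natr ler_wpM2r.
    have : ln j.+1%:R *+ 3 <= 3 * j.+1%:R :> R by rewrite -[ln _ *+ 3]mulr_natr mulrC ler_wpM2l.
    rewrite -[j.+1%:R]natr1; lra.
  have ai : 0 <= alpha^-1 by rewrite invr_ge0 ltW.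
  have := J1 j; nra.
have H3 := le_trans (sum_harmonic_le R K) H2.
have H4 := qlimC_le alpha01 (2 ^ j)%N K.
have S0 : 0 <= (2 + 4 * alpha^-1) * j.+1%:R.
  by rewrite mulr_ge0// addr_ge0// mulr_ge0// invr_ge0 ltW.
have H5 : 1 - q (2 ^ j) K <= 2 ^+ j * (K.+1%:R `^ alpha)^-1 * ((2 + 4 * alpha^-1) * j.+1%:R).
  rewrite -(ler_pM2l K0); apply: (le_trans H4).
  rewrite natrX -!mulrA [X in _ <= X]mulrCA ler_pM2l//; apply: (le_trans H1).
  by rewrite -mulrA ler_pM2l// ler_pM2l ?invr_gt0.
apply: (le_trans H5).
have H6 : 2 ^+ j * (K.+1%:R `^ alpha)^-1 <= (j.+1%:R ^+ 3)^-1 :> R.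
  rewrite ler_pdivrMr// -ler_pdivrMl ?invr_gt0 ?exprn_gt0// invrK mulrC.
  by apply: le_trans KX; rewrite /X.
apply: (le_trans (ler_wpM2r S0 H6)).
rewrite le_eqVlt; apply/orP; left; apply/eqP.
move: (J0 j); set z := j.+1%:R => z0; move: (invr_ge0 alpha); set b := alpha^-1 => _; clearbody b z.
by field; rewrite gt_eqF.
Qed.

(* At [alpha = 1] the inverse [(1 - alpha)^-1] is [0], which is the correct bound:
   the sum of [r] Sibuya variables is then [r]. *)
Lemma lower_scale j : q (2 ^ j) (Klow j) <= (1 - alpha)^-1 / j.+1%:R ^+ 2.
Proof.
set K := Klow j; set Y : R := 2 ^+ j / (2 * j.+1%:R ^+ 2).
have JJ : (1 : R) <= j.+1%:R ^+ 2 by rewrite exprn_ege1.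
have Y0 : 0 < Y by rewrite divr_gt0// mulr_gt0//; lra.
have KY : K%:R <= Y `^ alpha^-1 by rewrite truncn_le powR_ge0.
have /andP[_ a1] := alpha01.
have [aE|an1] := eqVneq alpha 1.
  rewrite (qlim_small alpha01); first by rewrite divr_ge0 ?invr_ge0 ?subr_ge0// exprn_ge0.
  rewrite -(ltr_nat R) natrX; apply: (le_lt_trans KY); rewrite aE invr1 powRr1 ?ltW//.
  rewrite /Y ltr_pdivrMr; last by lra.
  by rewrite -[X in X < _]mulr1 ltr_pM2l//; lra.
have al1 : 0 < 1 - alpha by rewrite subr_gt0 lt_neqAle an1.
apply: (le_trans (qlim_le_tail alpha01 _ _)).
have B0 : 0 <= (1 - alpha)^-1 / j.+1%:R ^+ 2 by rewrite divr_ge0 ?invr_ge0 ?ltW// exprn_gt0.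
case: K KY => [_|k KY].
  by rewrite /sib_tail big_ord0 subrr expr0n expn_eq0.
set z := sib_tail alpha k.+1.
have kA0 : 0 < k.+1%:R `^ alpha :> R by rewrite powR_gt0 ?ltr0n.
have kA : k.+1%:R `^ alpha <= Y.
  rewrite -[X in _ <= X](powRVK (ltW Y0)); apply: ge0_ler_powR; rewrite ?nnegrE ?powR_ge0 ?(ltW a0)//.
have zY : (1 - alpha) / Y <= z.
  apply: le_trans (sib_tail_ge alpha01 k); rewrite ler_pM2l// lef_pV2 ?posrE//.
have rz : (1 - alpha) * j.+1%:R ^+ 2 <= 2 ^+ j * z.
  apply: (@le_trans _ _ (2 ^+ j * ((1 - alpha) / Y))); last by rewrite ler_pM2l.
  have -> : 2 ^+ j * ((1 - alpha) / Y) = (1 - alpha) * (2 * j.+1%:R ^+ 2).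
    rewrite /Y; move: (p0 j) (J0 j); set p := 2 ^+ j; set J := j.+1%:R; clearbody p J => pp JJ0.
    by field; rewrite !gt_eqF.
  by rewrite ler_pM2l//; lra.
have c0 : 0 < (1 - alpha) * j.+1%:R ^+ 2 by rewrite mulr_gt0//; lra.
have z1 : 0 <= 1 - z by rewrite /z -sum_sib; apply: sumr_ge0 => i _; exact: sib_ge0.
(* With [r = 2 ^ j], the chain is [(1 - z) ^ r <= expR (- r z) <= 1 / (r z)], and [rz] bounds [r z]
   from below. *)
apply: (@le_trans _ _ (expR (- z) ^+ (2 ^ j))).
  by apply: lerXn2r; rewrite ?nnegrE ?expR_ge0// expR_ge1Dx.
rewrite -expRM_natl mulrN expRN -invfM lef_pV2 ?posrE ?expR_gt0// natrX.
apply: (le_trans rz); apply: le_trans (expR_ge1Dx _); lra.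
Qed.

(** [Hmax] is the bound [4 r K] of the mean height times [j.+1 ^ 2], which makes the third term
    summable too. The factor 2 comes from [j.+2 <= 2 * j.+1], used to reach the telescoping form. *)
Lemma scale_bound j :
  1 - q (2 ^ j) (Kup j) + q (2 ^ j) (Klow j)
    + (4 * 2 ^ j * Kup j)%:R / (Hmax j).+1%:R
  <= 2 * (3 + 4 * alpha^-1 + (1 - alpha)^-1) / (j.+1%:R * j.+2%:R).
Proof.
have H3 : (4 * 2 ^ j * Kup j)%:R / (Hmax j).+1%:R <= 1 / j.+1%:R ^+ 2 :> R.
  have JJ : (0 : R) < j.+1%:R ^+ 2 by rewrite exprn_gt0.
  rewrite ler_pdivrMr// mulrAC ler_pdivlMr// mul1r -natrX -natrM ler_nat.
  by apply: leq_trans (leqnSn _); rewrite /Hmax; nia.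
apply: (le_trans (lerD (lerD (upper_scale j) (lower_scale j)) H3)).
have -> : (2 + 4 * alpha^-1) / j.+1%:R ^+ 2 + (1 - alpha)^-1 / j.+1%:R ^+ 2
   + 1 / j.+1%:R ^+ 2 = (3 + 4 * alpha^-1 + (1 - alpha)^-1) / j.+1%:R ^+ 2 by ring.
have C0 : 0 <= 3 + 4 * alpha^-1 + (1 - alpha)^-1.
  have : 0 <= (1 - alpha)^-1 by rewrite invr_ge0 subr_ge0; case/andP: alpha01.
  have : 0 <= alpha^-1 by rewrite invr_ge0 ltW.
  lra.
rewrite [2 * _]mulrC -mulrA; apply: ler_wpM2l => //.
have J2 : (0 : R) < j.+2%:R by rewrite ltr0n.
rewrite ler_pdivlMr ?mulr_gt0// mulrC ler_pdivrMr ?exprn_gt0//.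
rewrite -[j.+2%:R]natr1; have := J1 j; set z := j.+1%:R; clearbody z; nra.
Qed.

End Scales.

(** * Balls and return probabilities from marked vertices *)

(** A vertex lost by truncation would sit above a path of more than [n] vertices that remain. *)
Lemma nvert_trunc_id n c : (nvert (trunc n c) <= n)%N -> trunc n c = c.
Proof.
elim: n c => [|n IH] [s]; first by rewrite leqNgt nvert_gt0.
rewrite nvert_trunc ltnS => H; rewrite /=; congr Node.
rewrite -[RHS]map_id; apply/eq_in_map => d ds; apply: IH; apply: leq_trans H.
by rewrite (big_sibs_nat _ ds) leq_addr.
Qed.

(** Here sizes are read in the truncated tree; the strict bound lets [nvert_trunc_id] show that the
    sibling subtrees are complete. *)
Lemma spine_untrunc pad r M c (p : nat * nat) : (r <= M)%N -> (p.1 < M)%N ->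
  p \in spine pad r (trunc M c) -> p \in spine pad r c.
Proof.
elim: r M c p => [//|r IH] [//|M] [s] p rM pM /spineP[_ [q [/mapP[d ds ->] qd pE]]].
have pm := perm_sibs_map (trunc M) ds.
have sE : map (trunc M) (sibs d s) = sibs d s.
  rewrite -[RHS]map_id; apply/eq_in_map => e es; apply: nvert_trunc_id.
  move: pM; rewrite pE /= (perm_big _ pm) /= big_map (big_sibs_nat _ es); lia.
rewrite sE in pm.
apply/spineP; exists d, q; split => //; last by rewrite pE !(perm_big _ pm).
by apply: (IH M) => //; move: pM; rewrite pE /=; lia.
Qed.

Definition marked (w : nat -> ptree) (r K' K L N : nat) : Prop :=
  exists c (p : nat * nat), [/\ w N = Node [:: c], p \in spine K r c,
    (K' < p.1 <= K)%N & (p.2 <= L)%N].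

(** An outer part that is complete in one ball is unchanged in all larger ones, so one finite event
    controls the infinite tree. *)
Lemma good_marked w r K' K L M c : consistent w -> (r <= M)%N -> (K < M)%N ->
  w M.+1 = Node [:: c] -> good r K' K L c ->
  forall N, (M < N)%N -> marked w r K' K L N.
Proof.
move=> cw rM KM wM /hasP[p pc /andP[/andP[K'p pK] pL]] N MN.
have := consistent_trunc cw MN; rewrite wM; case wN : (w N) => [[|d [|//]]] //= -[cE].
exists d, p; split => //; last by rewrite K'p.
by apply: (@spine_untrunc _ _ M) => //; [exact: leq_ltn_trans pK KM|rewrite -cE].
Qed.

Section Marked.
Context (R : realType) (w : nat -> ptree) (r K' K L N0 : nat).
Hypothesis cw : consistent w.
Hypothesis mw : forall N, (N0 <= N)%N -> marked w r K' K L N.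

Lemma nedges_ball A N c : (A < N)%N -> w N = Node [:: c] ->
  nedges (w A.+1) = nvert (trunc A c).
Proof.
move=> AN wN; rewrite (consistent_trunc cw AN) wN /= /nedges nvert_Node.
by rewrite big_seq1.
Qed.

Lemma marked_ball_le : (nedges (w r.+1) <= K.+1)%N.
Proof.
have [c [p [wN pc /andP[_ pK] _]]] := mw (leq_maxl N0 r.+1).
rewrite (nedges_ball _ wN) ?leq_maxr//.
by apply: leq_trans (spine_ball_le pc) _; rewrite ltnS.
Qed.

Lemma marked_ball_ge A : (A * K'.+1 <= L + A * nedges (w A.+1))%N.
Proof.
have [c [p [wN pc /andP[K'p pK] pL]]] := mw (leq_maxl N0 A.+1).
rewrite (nedges_ball _ wN) ?leq_maxr//.
apply: (@leq_trans (A * p.1)); first by rewrite leq_mul2l K'p orbT.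
by apply: leq_trans (spine_ball_ge _ pc pK) _; rewrite leq_add2r.
Qed.

Context (x : R).
Hypothesis x01 : 0 < x < 1.

Lemma marked_Qtau_ge :
  (((2 * (x * K%:R + r.+1%:R^-1))^-1)%:E <= Qtau w x)%E.
Proof.
have /andP[x0 _] := x01.
apply: Qtau_ge => //.
  by rewrite ltr_wpDl ?invr_gt0// mulr_ge0// ltW.
exists N0 => M NM; have [c [p [wN pc /andP[K'p pK] pL]]] := mw NM.
exists c => //; apply: (le_trans (escape_spine x01 pc)).
by rewrite lerD2r ler_wpM2l ?(ltW x0)// ler_nat.
Qed.

Lemma marked_Qtau_le A :
  (Qtau w x <= (A.+1%:R + (x * (nedges (w A.+1))%:R)^-1)%:E)%E.
Proof.
have /andP[x0 _] := x01.
apply: Qtau_le => // N; exists (maxn N (maxn N0 A.+1)); first exact: leq_maxl.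
have NM : (N0 <= maxn N (maxn N0 A.+1))%N by rewrite !leq_max leqnn orbT.
have [c [p [wN pc _ _]]] := mw NM.
exists c => //; rewrite (nedges_ball _ wN); last by rewrite !leq_max leqnn !orbT.
have := escape_ge x01 A c; set V := _%:R => H.
have V0 : 0 < x * V by rewrite mulr_gt0// ltr0n nvert_gt0.
have /andP[s0 _] := escape_itv x01 c.
rewrite -[X in X <= _]mul1r ler_pdivrMr// mulrC.
rewrite -(ler_pM2r V0) mul1r; apply: (le_trans H).
by rewrite -mulrA mulrDl mulVf ?gt_eqF// [X in _ * X <= _]addrC.
Qed.

End Marked.

(** * Dimensions *)

Section SlowVariation.
Context (R : realType).
Implicit Types (L : R -> R).

Lemma slow_mul L1 L2 : slowly_varying_infty L1 -> slowly_varying_infty L2 ->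
  slowly_varying_infty (fun x => L1 x * L2 x).
Proof.
move=> [L10 L1c] [L20 L2c]; split=> [x x0|lam lam0]; first by rewrite mulr_gt0 ?L10 ?L20.
rewrite [X in X @ _](_ : _ = fun x => (L1 (lam * x) / L1 x) * (L2 (lam * x) / L2 x)); last first.
  by apply/funext => x; rewrite invfM mulrACA.
by rewrite -[1 in X in _ --> X]mulr1; apply: cvgM; [exact: L1c|exact: L2c].
Qed.

Lemma slow_inv L : slowly_varying_infty L -> slowly_varying_infty (fun x => (L x)^-1).
Proof.
move=> [L0 Lc]; split=> [x x0|lam lam0]; first by rewrite invr_gt0 L0.
rewrite [X in X @ _](_ : _ = fun x => (L (lam * x) / L x)^-1); last first.
  by apply/funext => x; rewrite invrK invf_div mulrC.
by rewrite -[1 in X in _ --> X]invr1; apply: cvgV; [exact: oner_neq0|exact: Lc].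
Qed.

Lemma slow_cst (C : R) : 0 < C -> slowly_varying_infty (fun=> C).
Proof.
move=> C0; split=> // lam lam0; rewrite divff ?gt_eqF//; exact: cvg_cst.
Qed.

Lemma slow_exp L n : slowly_varying_infty L -> slowly_varying_infty (fun x => L x ^+ n).
Proof.
move=> sL; elim: n => [|n IH]; first exact: slow_cst.
under [X in slowly_varying_infty X]eq_fun do rewrite exprS.
exact: slow_mul.
Qed.

Definition ell (x : R) : R := 1 + ln (1 + x).

Lemma ell_ge1 x : 0 <= x -> 1 <= ell x.
Proof. by move=> x0; rewrite /ell lerDl ln_ge0// lerDl. Qed.

Lemma ell_mono x y : 0 <= x -> x <= y -> ell x <= ell y.
Proof.
move=> x0 xy; have x1 : 0 < 1 + x by rewrite ltr_wpDr.
have y1 : 0 < 1 + y by apply: lt_le_trans x1 _; rewrite lerD2l.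
by rewrite /ell lerD2l ler_ln ?posrE// lerD2l.
Qed.

(** Scaling the argument by [lam] moves [ell] by at most the absolute value of [ln lam], while [ell]
    tends to infinity. *)
Lemma slow_ell : slowly_varying_infty ell.
Proof.
split=> [x /ltW x0|lam lam0]; first exact: lt_le_trans (ell_ge1 x0).
apply/cvgrPdist_le => e e0.
pose B := Num.max 1 (expR (`|ln lam| / e)).
exists B; split; first exact: num_real.
move=> x Bx; have x0 : 0 < x by apply: lt_trans Bx; rewrite lt_max ltr01.
have xe : expR (`|ln lam| / e) < x by apply: le_lt_trans Bx; rewrite le_max lexx orbT.
have e1 : 0 < ell x by apply: lt_le_trans (ell_ge1 (ltW x0)).
have -> : 1 - ell (lam * x) / ell x = (ell x - ell (lam * x)) / ell x.
  by rewrite mulrBl divff ?gt_eqF.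
rewrite normrM normfV (gtr0_norm e1) ler_pdivrMr//.
have H1 : `|ell x - ell (lam * x)| <= `|ln lam|.
  have a1 : 0 < 1 + x by rewrite ltr_wpDr ?ltW.
  have a2 : 0 < 1 + lam * x by rewrite ltr_wpDr ?mulr_ge0 ?ltW.
  have -> : ell x - ell (lam * x) = ln (1 + x) - ln (1 + lam * x) by rewrite /ell; ring.
  have [l1|l1] := leP 1 lam.
    rewrite (ger0_norm (ln_ge0 l1)) ler_norml; apply/andP; split.
      suff : ln (1 + lam * x) <= ln lam + ln (1 + x) by lra.
      rewrite -lnM ?posrE//.
      by rewrite ler_ln ?posrE ?mulr_gt0//; nra.
    apply: (@le_trans _ _ 0); last exact: ln_ge0.
    by rewrite subr_le0 ler_ln ?posrE//; nra.
  have l0 : ln lam <= 0 by apply: ln_le0; exact: ltW.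
  rewrite (ler0_norm l0) ler_norml opprK; apply/andP; split.
    apply: (le_trans l0); rewrite subr_ge0 ler_ln ?posrE//; nra.
  suff : ln lam + ln (1 + x) <= ln (1 + lam * x) by lra.
  rewrite -lnM ?posrE//.
  by rewrite ler_ln ?posrE ?mulr_gt0//; nra.
apply: (le_trans H1); rewrite -ler_pdivrMl// mulrC.
apply: (@le_trans _ _ (ln x)).
  by rewrite -[X in X <= _]expRK ler_ln ?posrE ?expR_gt0// ltW.
rewrite /ell; apply: (@le_trans _ _ (ln (1 + x))); last by rewrite lerDr.
by rewrite ler_ln ?posrE ?lerDr// ltr_wpDr ?ltW.
Qed.

Lemma bernoulli_ineq (s : R) n : 1 <= s -> 1 + n%:R * (s - 1) <= s ^+ n.
Proof.
move=> s1; elim: n => [|n IH]; first by rewrite mul0r addr0 expr0.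
rewrite exprS -natr1.
have : 0 <= n%:R * (s - 1) by rewrite mulr_ge0// subr_ge0.
have s0 : 0 <= s by apply: le_trans s1.
have := ler_wpM2l s0 IH; nra.
Qed.

(* Along [2 ^ j] the ratio of consecutive terms tends to [2 ^ delta]. *)
Lemma slow_exponent L (delta : R) (n0 : nat) : slowly_varying_infty L ->
  (forall n : nat, (n0 < n)%N -> n%:R `^ delta * L n%:R < 1) -> delta <= 0.
Proof.
move=> [L0 Lc] H; rewrite leNgt; apply/negP => d0.
pose t : R := 2 `^ delta.
have t1 : 1 < t.
  have : expR 0 < expR (delta * ln 2) :> R by rewrite ltr_expR mulr_gt0// ln_gt0// ltr1n.
  by rewrite expR0 /t /powR gt_eqF.
have t0 : 0 < t by apply: lt_trans t1.
pose e := (t - 1) / (2 * t).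
have e0 : 0 < e by rewrite divr_gt0 ?mulr_gt0// subr_gt0.
have te : t * e = (t - 1) / 2 by rewrite /e; field; rewrite gt_eqF.
have [B [_ HB]] : \forall x \near (+oo%R : set_system R), `|1 - L (2 * x) / L x| <= e.
  by have /cvgrPdist_le := Lc 2 (ltr0Sn _ _); apply.
pose s := (1 + t) / 2.
have s1 : 1 < s by rewrite /s; lra.
pose j0 := (maxn n0 (Num.trunc (Num.max 0 B))).+1.
pose u j : R := (2 ^ (j0 + j))%N%:R `^ delta * L (2 ^ (j0 + j))%N%:R.
have big j : (j0 + j < 2 ^ (j0 + j))%N by exact: ltn_expl.
have uS j : s * u j <= u j.+1.
  set x : R := (2 ^ (j0 + j))%N%:R.
  have xB : B < x.
    apply: (@lt_le_trans _ _ j0%:R); last by rewrite /x ler_nat (leq_trans (leq_addr j j0) (ltnW (big j))).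
    apply: (@le_lt_trans _ _ (Num.max 0 B)); first by rewrite le_max lexx orbT.
    by apply: lt_le_trans (truncnS_gt _) _; rewrite ler_nat ltnS leq_maxr.
  have x0 : 0 < x by rewrite /x ltr0n expn_gt0.
  have := HB x xB; rewrite ler_distlC => /andP[H1 _].
  have Lx := L0 x x0; have L2x := L0 (2 * x) (mulr_gt0 (ltr0Sn _ _) x0).
  have {}H1 : (1 - e) * L x <= L (2 * x) by rewrite -ler_pdivlMr.
  have -> : u j.+1 = t * x `^ delta * L (2 * x).
    rewrite /u addnS expnS natrM -/x powRM//; exact: ltW.
  rewrite /u -/x.
  have xd : 0 < x `^ delta by exact: powR_gt0.
  have -> : s = t * (1 - e) by rewrite mulrBr te /s; field.
  have -> : t * (1 - e) * (x `^ delta * L x) = t * x `^ delta * ((1 - e) * L x) by ring.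
  by apply: ler_wpM2l => //; rewrite mulr_ge0 ?ltW.
have uk k : s ^+ k * u 0%N <= u k.
  elim: k => [|k IH]; first by rewrite expr0 mul1r.
  rewrite exprS -mulrA; apply: le_trans (uS k); apply: ler_wpM2l => //.
  by apply: ltW; lra.
have u0 : 0 < u 0%N by rewrite /u mulr_gt0 ?powR_gt0 ?L0 ?ltr0n ?expn_gt0.
pose k := (Num.trunc ((u 0%N)^-1 / (s - 1))).+1.
have kH : (u 0%N)^-1 < k%:R * (s - 1).
  by rewrite -ltr_pdivrMr ?subr_gt0//; exact: truncnS_gt.
have := uk k; rewrite leNgt => /negP; apply.
apply: (@lt_le_trans _ _ 1).
  by apply: H; apply: leq_ltn_trans (big k); rewrite (leq_trans _ (leq_addr _ _))// leqW// leq_maxl.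
have := bernoulli_ineq k (ltW s1) => Hb.
rewrite -(mulVf (lt0r_neq0 u0)) ler_pM2r//; apply: le_trans Hb.
by apply: ltW; apply: lt_le_trans kH _; rewrite lerDr.
Qed.

End SlowVariation.

(** The bound [j <= a j] leaves finitely many candidates, and the largest one works. *)
Lemma pick_scale (a : nat -> nat) J r : (forall j, (j <= a j)%N) -> (a J <= r)%N ->
  exists j, [/\ (J <= j)%N, (a j <= r)%N & (r < a j.+1)%N].
Proof.
move=> aj aJ; have ex : exists j, (J <= j)%N && (a j <= r)%N by exists J; rewrite leqnn.
have ub j : (J <= j)%N && (a j <= r)%N -> (j <= r)%N.
  by case/andP => _; exact: leq_trans.
case: (ex_maxnP ex ub) => j /andP[Jj ajr] jmax; exists j; split => //.
rewrite ltnNge; apply/negP => ajS.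
by have := jmax j.+1; rewrite ajS leqW// => /(_ isT); rewrite ltnn.
Qed.

Section Asymptotics.
Context (R : realType) (alpha : R) (w : nat -> ptree) (J0 : nat).
Hypothesis alpha01 : 0 < alpha <= 1.
Hypothesis cw : consistent w.
Hypothesis mw : forall j, (J0 <= j)%N -> exists N0, forall N, (N0 <= N)%N ->
  marked w (2 ^ j) (Klow alpha j) (Kup alpha j) (Hmax alpha j) N.
Local Notation beta := (alpha^-1).
Local Notation ell := (@ell R).

Let a0 : 0 < alpha. Proof. by case/andP: alpha01. Qed.
Let b0 : 0 <= beta. Proof. by rewrite invr_ge0 ltW. Qed.
(** An integer above [beta]: powers with exponent [beta] of logarithmic factors, which are at least
    1, are bounded by integer powers. *)
Let B : nat := (Num.trunc beta).+1.
Let bB : beta <= B%:R. Proof. exact/ltW/truncnS_gt. Qed.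
Let J1 j : (1 : R) <= j.+1%:R. Proof. by rewrite ler1n. Qed.
Let p1 j : (1 : R) <= 2 ^+ j. Proof. by rewrite exprn_ege1// ler1n. Qed.
Let p0 j : (0 : R) < 2 ^+ j. Proof. by rewrite exprn_gt0. Qed.

Let powR_le_exp (X : R) : 1 <= X -> X `^ beta <= X ^+ B.
Proof.
by move=> X1; rewrite -powR_mulrn ?(le_trans _ X1)// ler_powR.
Qed.

Let powR_mono (X Y : R) : 0 <= X -> X <= Y -> X `^ beta <= Y `^ beta.
Proof.
move=> X0 XY; apply: ge0_ler_powR; rewrite ?nnegrE//; exact: le_trans XY.
Qed.

Let powR_ge1 (X : R) : 1 <= X -> 1 <= X `^ beta.
Proof. by move=> X1; have := ler_powR X1 b0; rewrite powRr0. Qed.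

Lemma nedges_mono m n : (m <= n)%N -> (nedges (w m) <= nedges (w n))%N.
Proof.
move=> mn; rewrite (consistent_trunc cw mn) /nedges.
by have := nvert_trunc_le m (w n); case: nvert => // k; case: nvert.
Qed.

Lemma scale_ell j (z : R) : 2 ^+ j <= z -> j.+1%:R <= 2 * ell z.
Proof.
move=> jz; have z1 : 1 <= z by apply: le_trans jz.
have z0 : 0 < z by apply: lt_le_trans z1.
have l2 : 2^-1 <= ln 2 :> R.
  have : ln (1 + - 2^-1) <= - 2^-1 :> R by apply: le_ln1Dx; lra.
  have -> : 1 + - 2^-1 = 2^-1 :> R by lra.
  by rewrite lnV ?posrE// lerN2.
have : ln (2 ^+ j) <= ln (1 + z) by rewrite ler_ln ?posrE//; lra.
rewrite lnXn// -[ln 2 *+ j]mulr_natr /ell.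
have : 2^-1 * j%:R <= ln 2 * j%:R :> R by apply: ler_wpM2r.
rewrite -[j.+1%:R]natr1; lra.
Qed.

(* A radius [A] with [2 * Hmax j <= A * (Klow j).+1], so that at least half of the
   outer edges lie within distance [A]. *)
Definition Arad (j : nat) : nat := (8 * 2 ^ j * j.+1 ^ 2 * (2 * j.+1 ^ 5) ^ B)%N.

Lemma natr_Arad j : (Arad j)%:R =
  8 * 2 ^+ j * j.+1%:R ^+ 2 * (2 * j.+1%:R ^+ 5) ^+ B :> R.
Proof. by rewrite /Arad !(natrM, natrX). Qed.

Lemma Arad_exp j : (2 ^ j <= Arad j)%N.
Proof.
have H a b c : (0 < b -> 0 < c -> a <= 8 * a * b * c)%N.
  move=> b1 c1; have : (0 < b * c)%N by rewrite muln_gt0 b1.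
  by rewrite -mulnA; nia.
by apply: H; rewrite !expn_gt0// muln_gt0 expn_gt0.
Qed.

Lemma Arad_ge j : (j <= (Arad j).+1)%N.
Proof. by apply/leqW/(leq_trans _ (Arad_exp j))/ltnW/ltn_expl. Qed.

(** The bases of [Kup] and [Klow] differ by the factor [2 * j.+1 ^ 5], whence the last factor of
    [Arad]; the 2 on the right accounts for the half of the outer edges that may lie beyond. *)
Lemma volume_ge j : (J0 <= j)%N ->
  (2 ^+ j / (2 * j.+1%:R ^+ 2)) `^ beta <= 2 * (nedges (w (Arad j).+1))%:R :> R.
Proof.
move=> /mw[N0 m]; have := marked_ball_ge cw m (Arad j).
set A := Arad j; set V := nedges _; set K' := Klow alpha j; set L := Hmax alpha j => H.
set X : R := 2 ^+ j / (2 * j.+1%:R ^+ 2).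
have JJ : 0 < 2 * j.+1%:R ^+ 2 :> R by rewrite mulr_gt0// exprn_gt0// ltr0n.
have X0 : 0 < X by rewrite divr_gt0.
have KX : X `^ beta <= K'.+1%:R by exact/ltW/Klow_gt.
have Z1 : 1 <= 2 * j.+1%:R ^+ 5 :> R.
  have : 1 <= j.+1%:R ^+ 5 :> R by rewrite exprn_ege1.
  lra.
have LA : 2 * L%:R <= A%:R * K'.+1%:R :> R.
  have -> : 2 * L%:R = 8 * 2 ^+ j * j.+1%:R ^+ 2 * (Kup alpha j)%:R :> R.
    by rewrite /L /Hmax !natrM !natrX; ring.
  rewrite /A natr_Arad -[X in _ <= X]mulrA.
  apply: ler_wpM2l; first by rewrite !mulr_ge0// ?exprn_ge0.
  apply: (le_trans (Kup_le _ _)).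
  have -> : 2 ^+ j * j.+1%:R ^+ 3 = (2 * j.+1%:R ^+ 5) * X.
    rewrite /X; move: (J1 j); set z := j.+1%:R; set p := 2 ^+ j; clearbody z p => z1.
    by field; rewrite gt_eqF// (lt_le_trans ltr01).
  rewrite powRM ?(ltW X0) ?(le_trans _ Z1)//.
  by apply: ler_pM; rewrite ?powR_ge0// powR_le_exp.
have A0 : (0 : R) < A%:R.
  by rewrite ltr0n /A /Arad !muln_gt0 !expn_gt0 muln_gt0 expn_gt0.
apply: (le_trans KX); clearbody A L V K'.
have : (A * K'.+1)%:R <= (L + A * V)%:R :> R by rewrite ler_nat.
rewrite natrD !natrM => H'.
rewrite -(ler_pM2l A0) mulrCA. lra.
Qed.

Lemma hausdorff_upper : exists (C : R) (n r0 : nat), 0 < C /\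
  forall r, (r0 < r)%N -> (nedges (w r))%:R < r%:R `^ beta * (C * ell r%:R ^+ n).
Proof.
(* Since [2 ^ j.+1 <= 2 * r] and [j.+2 <= 3 * l], the base of [Kup] is at most [2 * 3 ^ 3 = 54]
   times [r * l ^ 3]. The 3 covers the additional edge and strictness. *)
exists (3 * 54 ^+ B), (3 * B)%N, (2 ^ J0)%N; split; first by rewrite mulr_gt0// exprn_gt0.
move=> r rJ.
have aj j : (j <= 2 ^ j)%N by exact/ltnW/ltn_expl.
have [j [Jj jr rj]] := pick_scale aj (ltnW rJ).
have [N0 m] := mw (leqW Jj).
have H1 : (nedges (w r) <= (Kup alpha j.+1).+1)%N.
  apply: leq_trans (marked_ball_le cw m); apply: nedges_mono.
  exact/ltnW/leqW.
have r1 : (1 : R) <= r%:R by rewrite ler1n; apply: leq_trans (ltnW rJ); rewrite expn_gt0.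
have r0 : (0 : R) < r%:R by apply: lt_le_trans r1.
have jr' : 2 ^+ j <= r%:R :> R by rewrite -natrX ler_nat.
have lJ := scale_ell jr'.
have l1 := ell_ge1 (ltW r0).
set l := ell r%:R in lJ l1 *.
have J2 : j.+2%:R <= 3 * l by rewrite -[j.+2%:R]natr1; lra.
have H2 : (Kup alpha j.+1)%:R <= r%:R `^ beta * (54 ^+ B * l ^+ (3 * B)).
  apply: (le_trans (Kup_le _ _)).
  apply: (@le_trans _ _ ((r%:R * (54 * l ^+ 3)) `^ beta)).
    apply: powR_mono; first by rewrite mulr_ge0// exprn_ge0.
    have -> : r%:R * (54 * l ^+ 3) = (2 * r%:R) * (3 * l) ^+ 3 by ring.
    apply: ler_pM; rewrite ?exprn_ge0//; first by rewrite exprS ler_pM2l.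
    by apply: lerXn2r; rewrite ?nnegrE//; lra.
  have l3 : 1 <= l ^+ 3 by rewrite exprn_ege1.
  rewrite powRM ?(ltW r0)//; last by lra.
  apply: ler_wpM2l; first exact: powR_ge0.
  rewrite exprM -exprMn; apply: powR_le_exp; lra.
have P1 : 1 <= r%:R `^ beta by exact: powR_ge1.
have Q1 : 1 <= 54 ^+ B * l ^+ (3 * B).
  by rewrite -[X in X <= _]mulr1 ler_pM// exprn_ege1// ler1n.
have PQ1 : 1 <= r%:R `^ beta * (54 ^+ B * l ^+ (3 * B)).
  by rewrite -[X in X <= _]mulr1 ler_pM.
have : (nedges (w r))%:R <= (Kup alpha j.+1)%:R + 1 :> R by rewrite natr1 ler_nat.
rewrite -[3 * _ * _]mulrA [_ `^ _ * (3 * _)]mulrCA.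
lra.
Qed.

(** Here 32 is 8 from [Arad], 2 from passing to [j.+1] and 2 from [Klow]; the exponent adds the
    degree [2 + 5 * B] of [Arad] to the square in [Klow], with [j.+2 <= 3 * l]. *)
Let C1 : R := 32 * 2 ^+ B * 3 ^+ (2 + 5 * B + 2).

Lemma hausdorff_lower : exists (C : R) (n r0 : nat), 0 < C /\
  forall r, (r0 < r)%N -> r%:R `^ beta * (C * (ell r%:R ^+ n)^-1) < (nedges (w r))%:R.
Proof.
have C11 : 1 <= C1.
  have h2 : (1 : R) <= 2 ^+ B by exact: p1.
  have h3 : (1 : R) <= 3 ^+ (2 + 5 * B + 2) by rewrite exprn_ege1// ler1n.
  have : (1 : R) <= 2 ^+ B * 3 ^+ (2 + 5 * B + 2) by rewrite -[X in X <= _]mulr1 ler_pM.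
  rewrite /C1 -mulrA; lra.
exists (4^-1 * (C1 ^+ B)^-1), ((2 + 5 * B + 2) * B)%N, (Arad J0).+1; split.
  by rewrite mulr_gt0// invr_gt0 exprn_gt0//; lra.
move=> r rJ.
have [j [Jj jr rj]] := pick_scale Arad_ge (ltnW rJ).
have r1 : (1 : R) <= r%:R by rewrite ler1n; apply: leq_trans (ltnW rJ).
have r0 : (0 : R) < r%:R by apply: lt_le_trans r1.
have jr' : 2 ^+ j <= r%:R :> R.
  by rewrite -natrX ler_nat; apply: leq_trans jr; exact/leqW/Arad_exp.
have lJ := scale_ell jr'.
have l1 := ell_ge1 (ltW r0).
set l := ell r%:R in lJ l1 *.
have J2 : j.+2%:R <= 3 * l by rewrite -[j.+2%:R]natr1; lra.
have J1' : j.+1%:R <= 3 * l by lra.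
have V := volume_ge Jj.
have Vr : (nedges (w (Arad j).+1))%:R <= (nedges (w r))%:R :> R.
  by rewrite ler_nat nedges_mono.
have l0 : 0 < l by apply: lt_le_trans l1.
have ln1 : 1 <= l ^+ (2 + 5 * B + 2) by rewrite exprn_ege1.
have D1 : 1 <= C1 * l ^+ (2 + 5 * B + 2) by rewrite -[X in X <= _]mulr1 ler_pM.
have H : r%:R / (C1 * l ^+ (2 + 5 * B + 2)) <= 2 ^+ j / (2 * j.+1%:R ^+ 2).
  have rA : r%:R <= 16 * 2 ^+ j * j.+2%:R ^+ 2 * (2 * j.+2%:R ^+ 5) ^+ B :> R.
    move: rj; rewrite ltnS -(ler_nat R) => /le_trans; apply.
    rewrite natr_Arad exprS le_eqVlt; apply/orP; left; apply/eqP; ring.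
  have JJ : 0 < 2 * j.+1%:R ^+ 2 :> R by rewrite mulr_gt0// exprn_gt0// ltr0n.
  rewrite ler_pdivrMr; last by lra.
  rewrite mulrAC ler_pdivlMr//.
  have E2 : j.+2%:R ^+ 2 * (2 * j.+2%:R ^+ 5) ^+ B <= 2 ^+ B * (3 * l) ^+ (2 + 5 * B) :> R.
    rewrite exprMn -exprM mulrCA -exprD; apply: ler_wpM2l; first by rewrite exprn_ge0.
    by apply: lerXn2r; rewrite ?nnegrE//; lra.
  have E3 : j.+1%:R ^+ 2 <= (3 * l) ^+ 2 :> R by apply: lerXn2r; rewrite ?nnegrE//; lra.
  apply: (@le_trans _ _ ((16 * 2 ^+ j * (2 ^+ B * (3 * l) ^+ (2 + 5 * B))) * (2 * (3 * l) ^+ 2))).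
    apply: ler_pM => //.
      by apply: (le_trans rA); rewrite -mulrA ler_pM2l// mulr_gt0.
    by rewrite ler_pM2l.
  rewrite le_eqVlt; apply/orP; left; apply/eqP.
  rewrite /C1; move: (2 + 5 * B)%N => k.
  rewrite [(3 * l) ^+ k]exprMn [(3 * l) ^+ 2]exprMn [3 ^+ (k + 2)]exprD [l ^+ (k + 2)]exprD.
  by ring.
have HV : r%:R `^ beta / (C1 * l ^+ (2 + 5 * B + 2)) `^ beta <= 2 * (nedges (w r))%:R.
  apply: (@le_trans _ _ ((r%:R / (C1 * l ^+ (2 + 5 * B + 2))) `^ beta)).
    have i0 : 0 <= (C1 * l ^+ (2 + 5 * B + 2))^-1 by rewrite invr_ge0; lra.
    rewrite (powRM _ (ltW r0) i0) ler_wpM2l ?powR_ge0//.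
    have -> : (C1 * l ^+ (2 + 5 * B + 2))^-1 `^ beta = ((C1 * l ^+ (2 + 5 * B + 2)) `^ beta)^-1; last by [].
    by rewrite -powR_inv1 ?(le_trans _ D1)// -powRrM mulN1r powRN.
  apply: (le_trans (powR_mono _ H)); first by rewrite divr_ge0// ?(ltW r0)//; lra.
  by apply: (le_trans V); rewrite ler_pM2l.
have P0 : 0 < r%:R `^ beta :> R by rewrite powR_gt0.
have F0 : 0 < (C1 * l ^+ (2 + 5 * B + 2)) ^+ B by rewrite exprn_gt0//; lra.
have HB : r%:R `^ beta / (C1 * l ^+ (2 + 5 * B + 2)) ^+ B <= 2 * (nedges (w r))%:R.
  apply: le_trans HV; rewrite ler_pM2l// lef_pV2 ?posrE ?powR_gt0 ?powR_le_exp//; lra.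
have -> : r%:R `^ beta * (4^-1 * (C1 ^+ B)^-1 * (l ^+ ((2 + 5 * B + 2) * B))^-1)
   = 4^-1 * (r%:R `^ beta / (C1 * l ^+ (2 + 5 * B + 2)) ^+ B).
  by rewrite [(C1 * _) ^+ B]exprMn -exprM [(C1 ^+ B * _)^-1]invfM; ring.
have : 0 < r%:R `^ beta / (C1 * l ^+ (2 + 5 * B + 2)) ^+ B by rewrite divr_gt0.
lra.
Qed.

Let theta : R := alpha / (1 + alpha).

Let theta01 : 0 < theta < 1.
Proof.
have a1 : 0 < 1 + alpha by apply: ltr_wpDl.
by rewrite /theta divr_gt0//= ltr_pdivrMr// mul1r ltrDr.
Qed.

(* [theta] is the solution of [theta / alpha = 1 - theta]: at the scale
   [2 ^ j = x ^ (- theta)] resistance and total leak balance. *)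
Let thetaE x : 0 < x -> x * (x `^ (- theta)) `^ beta = (x `^ (- theta))^-1.
Proof.
move=> x0; rewrite -powRrM -powRN opprK.
have -> : - theta * beta = theta - 1.
  by rewrite /theta; field; rewrite !gt_eqF// ltr_wpDl.
have := @powRB R x theta 1.
rewrite (gt_eqF x0) implybT powRr1 ?(ltW x0)// => ->//.
by rewrite mulrC divfK// gt_eqF.
Qed.

Lemma spectral_scale : exists x0 : R, 0 < x0 < 1 /\ forall x, 0 < x < x0 ->
  exists j, [/\ (J0 <= j)%N, 2 ^+ j <= x `^ (- theta), x `^ (- theta) < 2 * 2 ^+ j
    & j.+1%:R <= 2 * ell x^-1].
Proof.
have /andP[t0 t1] := theta01.
pose T : R := (2 ^+ J0) `^ theta^-1.
have T0 : 0 < T by rewrite powR_gt0.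
exists (Num.min 2^-1 T^-1); split.
  by rewrite lt_min !invr_gt0 T0 ltr0n gt_min invf_lt1 ?ltr1n.
move=> x /andP[x0]; rewrite lt_min => /andP[x2 xT].
have z1 : 1 <= x^-1 by rewrite invf_ge1//; lra.
have z0 : 0 < x^-1 by rewrite invr_gt0.
have yE : x `^ (- theta) = x^-1 `^ theta.
  by rewrite -powR_inv1 ?(ltW x0)// -powRrM mulN1r.
have yJ : 2 ^+ J0 <= x `^ (- theta).
  have TE : T `^ theta = 2 ^+ J0.
    by rewrite /T -powRrM mulVf ?(gt_eqF t0)// powRr1// ltW.
  rewrite yE -TE; apply: ge0_ler_powR; rewrite ?nnegrE ?(ltW T0) ?(ltW t0) ?(ltW z0)//.
  by rewrite -[T]invrK lef_pV2 ?posrE ?invr_gt0// ltW.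
set y := x `^ _ in yE yJ *.
have y0 : 0 < y by apply: lt_le_trans yJ.
have aj j : (j <= 2 ^ j)%N by exact/ltnW/ltn_expl.
have aJ : (2 ^ J0 <= Num.trunc y)%N by rewrite truncn_ge_nat ?(ltW y0)// natrX.
have [j [Jj jr rj]] := pick_scale aj aJ.
have jy : 2 ^+ j <= y.
  by rewrite truncn_ge_nat ?(ltW y0)// natrX in jr.
exists j; split => //.
  by rewrite truncn_lt_nat ?(ltW y0)// natrX exprS in rj.
apply: (le_trans (scale_ell jy)); rewrite ler_pM2l//; apply: ell_mono; first exact: ltW.
by rewrite yE -[X in _ <= X](powRr1 (ltW z0)); apply: ler_powR => //; exact: ltW.
Qed.

Lemma spectral_lower : exists (C : R) (n : nat) (x0 : R), [/\ 0 < C, 0 < x0 < 1 &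
  forall x, 0 < x < x0 ->
    ((x `^ (- theta) * (C * (ell x^-1 ^+ n)^-1))%:E < Qtau w x)%E].
Proof.
have [x0 [x01 H]] := spectral_scale.
(* The leak and the path contribute 2 and 4 times the common factor, so 6 in all; 7 gives
   strictness. The 8 is the cube of 2 in [j.+1 <= 2 * l]. *)
exists ((7 * 8 ^+ B)^-1), (3 * B)%N, x0; split => //.
move=> x xx0; have [j [Jj jy yj Jl]] := H x xx0.
have /andP[xp xl] := xx0.
have x1 : 0 < x < 1 by rewrite xp (lt_trans xl)//; case/andP: x01.
have [N0 m] := mw Jj.
apply: lt_le_trans (marked_Qtau_ge cw m x1); rewrite lte_fin.
have yE := thetaE xp; set y := x `^ _ in jy yj yE *.
have y0 : 0 < y by apply: lt_le_trans jy.
have l1 : 1 <= ell x^-1 by apply: ell_ge1; rewrite invr_ge0 ltW.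
set l := ell _ in Jl l1 *.
have l0 : 0 < l by apply: lt_le_trans l1.
have lB1 : 1 <= l ^+ (3 * B) by rewrite exprn_ege1.
have eB1 : 1 <= 8 ^+ B :> R by rewrite exprn_ege1// ler1n.
have E1 : x * (Kup alpha j)%:R <= y^-1 * (8 ^+ B * l ^+ (3 * B)).
  apply: (@le_trans _ _ (x * (y * (8 * l ^+ 3)) `^ beta)).
    apply: ler_wpM2l; first exact: ltW.
    apply: (le_trans (Kup_le _ _)); apply: powR_mono.
      by rewrite mulr_ge0// exprn_ge0.
    apply: ler_pM; rewrite ?exprn_ge0//.
    have -> : 8 * l ^+ 3 = (2 * l) ^+ 3 by ring.
    by apply: lerXn2r; rewrite ?nnegrE//; lra.
  have l3 : 1 <= l ^+ 3 by rewrite exprn_ege1.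
  rewrite powRM ?(ltW y0)//; last by lra.
  rewrite mulrA yE; apply: ler_wpM2l; first by rewrite invr_ge0 ltW.
  rewrite exprM -exprMn; apply: powR_le_exp; lra.
have E2 : ((2 ^ j).+1%:R)^-1 <= y^-1 * 2 :> R.
  rewrite mulrC ler_pdivlMr// mulrC ler_pdivrMr ?ltr0n//.
  rewrite -[(2 ^ j).+1%:R]natr1 natrX; lra.
set b := x * _ + _.
have bp : 0 < b by rewrite /b ltr_wpDl ?invr_gt0 ?ltr0n// mulr_ge0// ltW.
have F1 : 1 <= 8 ^+ B * l ^+ (3 * B) by rewrite -[X in X <= _]mulr1 ler_pM.
have bl : 2 * b <= y^-1 * (6 * (8 ^+ B * l ^+ (3 * B))).
  have yi : 0 < y^-1 by rewrite invr_gt0.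
  have : y^-1 * 2 <= y^-1 * (2 * (8 ^+ B * l ^+ (3 * B))) by rewrite ler_pM2l//; lra.
  have : y^-1 * (6 * (8 ^+ B * l ^+ (3 * B))) = 2 * (y^-1 * (8 ^+ B * l ^+ (3 * B)))
     + 2 * (y^-1 * (2 * (8 ^+ B * l ^+ (3 * B)))) by ring.
  move: E1 E2; rewrite /b; set Y := y^-1; set I := (_.+1%:R)^-1; set F := 8 ^+ B * _; clearbody I Y F => H1 H2 H3 H4.
  lra.
apply: (@lt_le_trans _ _ (y * (6 * (8 ^+ B * l ^+ (3 * B)))^-1)).
  rewrite -invfM ltr_pM2l// ltf_pV2 ?posrE; first lra; lra.
have -> : y * (6 * (8 ^+ B * l ^+ (3 * B)))^-1 = (y^-1 * (6 * (8 ^+ B * l ^+ (3 * B))))^-1.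
  by rewrite [RHS]invfM invrK.
rewrite lef_pV2 ?posrE ?mulr_gt0 ?invr_gt0//; lra.
Qed.

Lemma spectral_upper : exists (C : R) (n : nat) (x0 : R), [/\ 0 < C, 0 < x0 < 1 &
  forall x, 0 < x < x0 ->
    (Qtau w x < (x `^ (- theta) * (C * ell x^-1 ^+ n))%:E)%E].
Proof.
have [x0 [x01 H]] := spectral_scale.
(* [c1] bounds the radius and [c2] the inverse total leak; the 1 added to them below gives
   strictness. *)
pose c1 : R := 16 * 2 ^+ B * 2 ^+ (2 + 5 * B).
pose c2 : R := 2 * 16 ^+ B.
have c10 : 0 < c1.
  apply: mulr_gt0; last exact: exprn_gt0.
  by apply: mulr_gt0 => //; exact: exprn_gt0.
have c20 : 0 < c2 by apply: mulr_gt0 => //; exact: exprn_gt0.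
exists (c1 + c2 + 1), (2 + 5 * B)%N, x0; split => //; first by lra.
move=> x xx0; have [j [Jj jy yj Jl]] := H x xx0.
have /andP[xp xl] := xx0.
have x1 : 0 < x < 1 by rewrite xp (lt_trans xl)//; case/andP: x01.
have [N0 m] := mw Jj.
apply: (le_lt_trans (marked_Qtau_le cw m x1 (Arad j))); rewrite lte_fin.
have V := volume_ge Jj; set v := (nedges _)%:R in V *.
have yE := thetaE xp; set y := x `^ _ in jy yj yE *.
have y0 : 0 < y by apply: lt_le_trans jy.
have l1 : 1 <= ell x^-1 by apply: ell_ge1; rewrite invr_ge0 ltW.
set l := ell _ in Jl l1 *.
have l0 : 0 < l by apply: lt_le_trans l1.
set ln := l ^+ (2 + 5 * B).
have ln1 : 1 <= ln by rewrite exprn_ege1.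
have E1 : (Arad j).+1%:R <= y * (c1 * ln).
  have A1 : 1 <= (Arad j)%:R :> R.
    by rewrite ler1n; apply: leq_trans (Arad_exp j); rewrite expn_gt0.
  have A2 : (Arad j)%:R <= 8 * y * (2 ^+ B * (2 * l) ^+ (2 + 5 * B)) :> R.
    have E : j.+1%:R ^+ 2 * (2 * j.+1%:R ^+ 5) ^+ B <= 2 ^+ B * (2 * l) ^+ (2 + 5 * B) :> R.
      rewrite exprMn -exprM mulrCA -exprD; apply: ler_wpM2l; first by rewrite exprn_ge0.
      by apply: lerXn2r; rewrite ?nnegrE//; lra.
    rewrite natr_Arad -mulrA -[8 * y * _]mulrA -[8 * _ * _]mulrA ler_pM2l//.
    by apply: ler_pM => //; rewrite mulr_ge0 ?exprn_ge0 ?mulr_ge0 ?exprn_ge0.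
  have -> : y * (c1 * ln) = 2 * (8 * y * (2 ^+ B * (2 * l) ^+ (2 + 5 * B))).
    by rewrite /c1 /ln [(2 * l) ^+ _]exprMn; ring.
  rewrite -[(Arad j).+1%:R]natr1; lra.
have E2 : (x * v)^-1 <= y * (c2 * ln).
  have X0 : 0 < y / (16 * l ^+ 2) by rewrite divr_gt0// mulr_gt0// exprn_gt0.
  have X1 : y / (16 * l ^+ 2) <= 2 ^+ j / (2 * j.+1%:R ^+ 2).
    have JJ : 0 < 2 * j.+1%:R ^+ 2 :> R by rewrite mulr_gt0// exprn_gt0// ltr0n.
    rewrite ler_pdivrMr ?mulr_gt0 ?exprn_gt0// mulrAC ler_pdivlMr//.
    have Jl2 : j.+1%:R ^+ 2 <= (2 * l) ^+ 2 by apply: lerXn2r; rewrite ?nnegrE//; lra.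
    apply: (@le_trans _ _ ((2 * 2 ^+ j) * (2 * (2 * l) ^+ 2))).
      apply: ler_pM; rewrite ?(ltW y0) ?(ltW JJ) ?(ltW yj)//.
      by rewrite ler_pM2l.
    by rewrite le_eqVlt; apply/orP; left; apply/eqP; ring.
  have V' := le_trans (powR_mono (ltW X0) X1) V.
  have l2 : 1 <= 16 * l ^+ 2 by have : 1 <= l ^+ 2 := exprn_ege1 2 l1; lra.
  have i0 : 0 <= (16 * l ^+ 2)^-1 by rewrite invr_ge0; lra.
  rewrite (powRM _ (ltW y0) i0) in V'.
  have P : (16 * l ^+ 2)^-1 `^ beta = ((16 * l ^+ 2) `^ beta)^-1.
    by rewrite -powR_inv1 ?(le_trans _ l2)// -powRrM mulN1r powRN.
  rewrite P in V'.
  have L0 : 0 < (16 * l ^+ 2) `^ beta by rewrite powR_gt0; lra.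
  have L0' : (16 * l ^+ 2) `^ beta <= 16 ^+ B * ln.
    apply: (le_trans (powR_le_exp l2)); rewrite exprMn -exprM ler_wpM2l ?exprn_ge0//.
    by apply: ler_weXn2l => //; rewrite (leq_trans _ (leq_addl 2 _))// leq_mul2r orbT.
  have xv : y^-1 / (16 * l ^+ 2) `^ beta <= 2 * (x * v).
    rewrite -yE -mulrA [2 * _]mulrCA; apply: ler_wpM2l => //; exact: ltW.
  have q0 : 0 < y^-1 / (16 * l ^+ 2) `^ beta by rewrite divr_gt0 ?invr_gt0.
  have xv0 : 0 < x * v by lra.
  rewrite -[X in X <= _]mul1r ler_pdivrMr//.
  have : y * (16 * l ^+ 2) `^ beta * (y^-1 / (16 * l ^+ 2) `^ beta) = 1.
    by rewrite mulrACA !divff ?gt_eqF// mulr1.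
  move=> <-.
  have -> : y * (c2 * ln) * (x * v) = (y * (16 ^+ B * ln)) * (2 * (x * v)) by rewrite /c2; ring.
  apply: ler_pM => //; rewrite ?ler_pM2l//; first by rewrite mulr_ge0 ?(ltW y0) ?(ltW L0).
  exact: ltW.
have yl : 0 < y * ln by rewrite mulr_gt0//; lra.
have -> : y * ((c1 + c2 + 1) * ln) = y * (c1 * ln) + y * (c2 * ln) + y * ln by ring.
lra.
Qed.

Lemma marked_hausdorff : hausdorff_dim w beta.
Proof.
have [Cm [nm [rm [Cm0 Hm]]]] := hausdorff_lower.
have [Cp [np [rp [Cp0 Hp]]]] := hausdorff_upper.
exists (maxn rm rp), (fun x => Cm * (ell x ^+ nm)^-1), (fun x => Cp * ell x ^+ np).
have sC (C : R) n : 0 < C -> slowly_varying_infty (fun x => C * ell x ^+ n).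
  by move=> C0; apply: slow_mul; [exact: slow_cst|exact/slow_exp/slow_ell].
split; [|split; [exact: sC|]].
  by apply: slow_mul; [exact: slow_cst|exact/slow_inv/slow_exp/slow_ell].
by move=> r; rewrite gtn_max => /andP[rm1 rp1]; rewrite Hm// Hp.
Qed.

Lemma marked_spectral : spectral_dim w (2 / (1 + alpha)).
Proof.
have [Cm [nm [xm [Cm0 /andP[xm0 xm1] Hm]]]] := spectral_lower.
have [Cp [np [xp [Cp0 /andP[xp0 xp1] Hp]]]] := spectral_upper.
have E : -1 + 2 / (1 + alpha) / 2 = - theta.
  by rewrite /theta; field; rewrite gt_eqF// ltr_wpDl.
exists (Num.min xm xp), (fun x => Cm * (ell x^-1 ^+ nm)^-1), (fun x => Cp * ell x^-1 ^+ np).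
split; first by rewrite lt_min xm0 xp0 gt_min xm1.
split; [|split].
- rewrite /slowly_varying_0; under eq_fun do rewrite invrK.
  by apply: slow_mul; [exact: slow_cst|exact/slow_inv/slow_exp/slow_ell].
- rewrite /slowly_varying_0; under eq_fun do rewrite invrK.
  by apply: slow_mul; [exact: slow_cst|exact/slow_exp/slow_ell].
move=> x /andP[x0]; rewrite lt_min => /andP[xxm xxp]; rewrite E.
by rewrite Hm ?x0// Hp ?x0.
Qed.

End Asymptotics.

(** * Uniqueness of the dimensions *)

Section Uniqueness.
Context (R : realType).

(** The lower bound for [d] against the upper bound for [d'] keeps [r ^ (d - d')] times a slowly
    varying function below 1. *)
Lemma hausdorff_dim_le w (d d' : R) : hausdorff_dim w d -> hausdorff_dim w d' -> d <= d'.
Proof.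
move=> [r1 [Lm [? [sLm [_ H1]]]]] [r2 [? [Lp [_ [sLp H2]]]]].
rewrite -subr_le0.
apply: (slow_exponent (n0 := maxn r1 r2) (slow_mul sLm (slow_inv sLp))) => r.
rewrite gtn_max => /andP[rr1 rr2].
have r0 : 0 < r%:R :> R by rewrite ltr0n; apply: leq_trans rr1.
have /andP[h1 _] := H1 r rr1; have /andP[_ h2] := H2 r rr2.
have Lp0 := sLp.1 _ r0; have p0 : 0 < r%:R `^ d' by exact: powR_gt0.
rewrite powRB ?(gt_eqF r0) ?implybT// mulrACA -invfM.
by rewrite ltr_pdivrMr ?mulr_gt0// mul1r (lt_trans h1 h2).
Qed.

(** The same comparison at [x = 1 / r]; the exponent of [r] is then [1 - d / 2], which reverses the
    order. *)
Lemma spectral_dim_le w (d d' : R) : spectral_dim w d -> spectral_dim w d' -> d' <= d.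
Proof.
move=> [x1 [lm [? [/andP[x10 x11] [sLm [_ H1]]]]]].
move=> [x2 [? [lp [/andP[x20 x21] [_ [sLp H2]]]]]].
suff : (1 - d / 2) - (1 - d' / 2) <= 0 by lra.
apply: (slow_exponent (n0 := maxn (Num.trunc x1^-1).+1 (Num.trunc x2^-1).+1)
  (slow_mul sLm (slow_inv sLp))) => r.
rewrite gtn_max => /andP[rr1 rr2].
have r0 : 0 < r%:R :> R by rewrite ltr0n; apply: leq_trans rr1.
have below (x : R) : 0 < x -> ((Num.trunc x^-1).+1 < r)%N -> 0 < (r%:R^-1 : R) < x.
  move=> x0 xr; rewrite invr_gt0 r0 /= -[X in _ < X]invrK ltf_pV2 ?posrE ?invr_gt0//.
  by apply: lt_trans (truncnS_gt _) _; rewrite ltr_nat.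
have /andP[h1 _] := H1 _ (below _ x10 rr1); have /andP[_ h2] := H2 _ (below _ x20 rr2).
have pE e : (r%:R^-1 : R) `^ (-1 + e) = r%:R `^ (1 - e).
  by rewrite -powR_inv1 ?(ltW r0)// -powRrM; congr (_ `^ _); ring.
have := lt_trans h1 h2; rewrite lte_fin !pE => h.
have Lp0 : 0 < lp r%:R^-1 := sLp.1 _ r0.
have p0 : 0 < r%:R `^ (1 - d' / 2) by exact: powR_gt0.
rewrite powRB ?(gt_eqF r0) ?implybT// mulrACA -invfM.
by rewrite ltr_pdivrMr ?mulr_gt0// mul1r.
Qed.

End Uniqueness.

Lemma ag_dimensions (R : realType) (alpha gamma : R) (D : option nat)
  (Halpha : 0 < alpha <= 1) (Hgamma : 0 <= gamma <= 1)
  (HD : if D is Some d then (3 <= d)%N else true)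
  (P : probability Omega R)
  (Hcons : {ae P, forall w : Omega, consistent w})
  (Hlim : forall (r : nat) (t : ptree),
     (fun k => (ag_prob alpha gamma D k (fun T => trunc r T = t))%:E) @ \oo
       --> P [set w : Omega | w r = t]) :
  {ae P, forall w : Omega,
     hausdorff_dim w alpha^-1 /\ spectral_dim w (2 / (1 + alpha))}.
Proof.
(* The successor provides the strict inequality that [good_marked] requires. *)
pose M j := maxn (2 ^ j) (Kup alpha j).+1.
pose bad j := is_bad (2 ^ j) (Klow alpha j) (Kup alpha j) (Hmax alpha j).
have ev : {ae P, forall w : Omega, exists J, forall j, (J <= j)%N ->
    ~ [set w : Omega | bad j (w (M j).+1)] w}.
  apply: ae_eventually => j; first exact: measurable_event.
  have rM : (2 ^ j <= M j)%N by rewrite leq_max leqnn.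
  have KM : (Kup alpha j <= M j)%N by rewrite leq_max leqnSn orbT.
  apply: (le_trans (bad_event Halpha Hgamma HD Hlim (Hmax alpha j) rM KM (Klow_Kup Halpha j))).
  by rewrite lee_fin; exact: scale_bound.
have FP : Filter (nbhs (almost_everywhere P)) := ae_filter_ringOfSetsType P.
apply: filterS2 Hcons ev => w cw [J HJ].
have mw j : (J <= j)%N -> exists N0, forall N, (N0 <= N)%N ->
    marked w (2 ^ j) (Klow alpha j) (Kup alpha j) (Hmax alpha j) N.
  move=> /HJ /contrapT[c wM g]; exists (M j).+1 => N MN.
  by apply: (good_marked cw _ _ wM g) => //; rewrite /M leq_max leqnn ?orbT.
by split; [exact: (marked_hausdorff Halpha cw mw)|exact: (marked_spectral Halpha cw mw)].
Qed.

Theorem theorem9 (R : realType) (alpha gamma : R) (D : option nat)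
  (Halpha : 0 < alpha <= 1) (Hgamma : 0 <= gamma <= 1)
  (HD : if D is Some d then (3 <= d)%N else true)
  (P : probability Omega R)
  (Hcons : {ae P, forall w : Omega, consistent w})
  (Hlim : forall (r : nat) (t : ptree),
     (fun k => (ag_prob alpha gamma D k (fun T => trunc r T = t))%:E) @ \oo
       --> P [set w : Omega | w r = t]) :
  ({ae P, forall w : Omega, forall d : R, hausdorff_dim w d -> d <= alpha^-1} /\
   {ae P, forall w : Omega, forall d : R, spectral_dim w d -> d <= 2 / (1 + alpha)})
  /\
  ((D = Some 3%N /\ 1/2 <= alpha) \/ (D = None /\ gamma = 0) ->
   {ae P, forall w : Omega, hausdorff_dim w alpha^-1 /\ spectral_dim w (2 / (1 + alpha))}).
Proof.
have dims := ag_dimensions Halpha Hgamma HD Hcons Hlim.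
split; last by move=> _.
have FP : Filter (nbhs (almost_everywhere P)) := ae_filter_ringOfSetsType P.
split; apply: filterS dims => w [hw sw] d.
  by move=> /hausdorff_dim_le; apply.
by move=> /(spectral_dim_le sw).
Qed.
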